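(* Let $\mathcal{C}$ be either $\mathcal{C}_{HS}$ or $\mathcal{C}_P$. Let $G$ be a finitely generated flexibly $\mathcal{C}$-stable group, let $H$ be a finite group and let $i_1,i_2\colon H\to G$ be injective homomorphisms such that $i_1(H)$ and $i_2(H)$ are almost normal in $G$. Then the HNN extension $G*_{i_1,i_2}$ is flexibly $\mathcal{C}$-stable.
   Context: $\mathcal{C}_{HS}$ is the class of groups $\mathrm{Aut}(X)$, where $X$ is a finite-dimensional Hilbert space and $\mathrm{Aut}(X)$ is its unitary group, with the metric $d(A_1,A_2)=\|A_1-A_2\|_{HS}$, $\|A\|_{HS}=\mathrm{Tr}(A^*A)^{1/2}$, $\mathrm{Tr}$ the normalized trace on $X$ (write $\|\cdot\|_{HS,X}$ to indicate $X$). $\mathcal{C}_P$ is the class of groups $\mathrm{Aut}(X)$, where $X$ is a finite set and $\mathrm{Aut}(X)$ is its symmetric group, with the normalized Hamming metric $d(\sigma_1,\sigma_2)=\frac{1}{|X|}\#\{x\in X:\sigma_1(x)\neq\sigma_2(x)\}$. $|X|$ denotes the dimension of the Hilbert space, respectively the size of the set. Flexible stability. A group $G$ is flexibly $\mathcal{C}$-stable if for any sequence of maps $\varphi_n\colon G\to\mathrm{Aut}(X_n)\in\mathcal{C}$ with $d(\varphi_n(g)\varphi_n(h),\varphi_n(gh))\to0$ for all $g,h\in G$ there are $Y_n\supseteq X_n$ (finite-dimensional Hilbert spaces, respectively finite sets) with $|Y_n|/|X_n|\to1$ and homomorphisms $\psi_n\colon G\to\mathrm{Aut}(Y_n)$ such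 that for all $g\in G$: in the case $\mathcal{C}_{HS}$, $\|\varphi_n(g)-p_n\psi_n(g)p_n\|_{HS,X_n}\to0$, where $p_n$ is the orthogonal projection of $Y_n$ onto $X_n$; in the case $\mathcal{C}_P$, $\frac{1}{|X_n|}\#\{x\in X_n:\varphi_n(g)(x)\ne\psi_n(g)(x)\}\to0$. A subgroup $H\le G$ is almost normal if there is a subgroup $H_1$ with $H\trianglelefteq H_1\le G$ and $[G:H_1]<\infty$ (i.e. the normalizer of $H$ has finite index in $G$). $G*_{i_1,i_2}:=(G*\mathbb{Z})/\langle\langle i_1(h)^{-1}\,t\,i_2(h)\,t^{-1}: h\in H\rangle\rangle$, where $\mathbb{Z}=\langle t\rangle$. *)

(* Defs.v *)
From HB Require Import structures.
From mathcomp Require Import all_boot all_order all_algebra all_fingroup.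
From mathcomp Require Import all_classical all_reals all_analysis.
From mathcomp Require Import complex generic_quotient.

Set Implicit Arguments.
Unset Strict Implicit.
Unset Printing Implicit Defensive.

Import Order.TTheory GRing.Theory Num.Theory.
Import numFieldNormedType.Exports.

Local Open Scope classical_set_scope.
Local Open Scope ring_scope.
Local Open Scope quotient_scope.
Local Open Scope sesquilinear_scope.

Section Subgroups.
Local Open Scope group_scope.
Variable G : groupType.
Implicit Types (K L S : set G).

Definition subgroup K : Prop :=
  [/\ K 1, forall x y, K x -> K y -> K (x * y) & forall x, K x -> K x^-1].

Definition normal_in K L : Prop :=
  [/\ subgroup K, subgroup L, K `<=` L & forall x y, K x -> L y -> K (x ^ y)].

(* G is a finite union of left cosets of L. *)
Definition finite_index L : Prop :=
  exists s : seq G, forall g, exists2 x, x \in s & L (x^-1 * g).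

Definition almost_normal K : Prop :=
  exists2 L : set G, normal_in K L & finite_index L.

Definition finitely_generated : Prop :=
  exists s : seq G, smallest subgroup [set` s] = setT.

Definition normal_closure S : set G := smallest (normal_in^~ setT) S.

Lemma normal_closureP S :
  [/\ normal_closure S 1,
      forall x y, normal_closure S x -> normal_closure S y ->
        normal_closure S (x * y),
      forall x, normal_closure S x -> normal_closure S x^-1 &
      forall x y, normal_closure S x -> normal_closure S (x ^ y)].
Proof.
split.
- by move=> K [[[]]].
- move=> x y Sx Sy K [nK SK]; case: (nK) => -[_ KM _] _ _ _.
  by apply: KM; [exact: Sx|exact: Sy].
- move=> x Sx K [nK SK]; case: (nK) => -[_ _ KV] _ _ _.
  by apply: KV; exact: Sx.
- move=> x y Sx K [nK SK]; case: (nK) => _ _ _ KJ.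
  by apply: KJ => //; exact: Sx.
Qed.

End Subgroups.

(* The quotient of a group by the normal closure of a set of relators S. *)
Section QuotientByRelators.
Local Open Scope group_scope.
Variables (G : groupType) (S : set G).

Definition relator_rel : rel G := fun x y => `[< normal_closure S (x^-1 * y) >].

Lemma relator_rel_equiv : equiv_class_of relator_rel.
Proof.
have [S1 SM SV _] := normal_closureP S; split.
- by move=> x; apply/asboolP; rewrite mulVg.
- by move=> x y; apply/asboolP/asboolP => /SV; rewrite invgM invgK.
- move=> y x z /asboolP xy /asboolP yz; apply/asboolP.
  by have := SM _ _ xy yz; rewrite mulgA mulgK.
Qed.

Canonical relator_equiv := EquivRelPack relator_rel_equiv.

Definition quot_relators := {eq_quot relator_equiv}.
HB.instance Definition _ := Choice.on quot_relators.
HB.instance Definition _ := EqQuotient.on quot_relators.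

Definition qr_pi : G -> quot_relators := \pi_(quot_relators).

Definition qr_one : quot_relators := qr_pi 1.
Definition qr_mul (x y : quot_relators) : quot_relators := qr_pi (repr x * repr y).
Definition qr_inv (x : quot_relators) : quot_relators := qr_pi (repr x)^-1.

Lemma qr_W (P : quot_relators -> Prop) : (forall x, P (qr_pi x)) -> forall x, P x.
Proof. by move=> Px x; rewrite -[x]reprK; exact: Px. Qed.

Lemma qr_eqP (x y : G) :
  qr_pi x = qr_pi y <-> normal_closure S (x^-1 * y).
Proof.
split=> [/eqmodP/asboolP //|xy]; apply/eqmodP; exact/asboolP.
Qed.

Lemma qr_reprP (x : G) :
  normal_closure S ((repr (qr_pi x))^-1 * x).
Proof. by apply/qr_eqP; rewrite /qr_pi reprK. Qed.

Lemma qr_mulE (x y : G) :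
  qr_mul (qr_pi x) (qr_pi y) = qr_pi (x * y).
Proof.
have [S1 SM SV SJ] := normal_closureP S.
apply/qr_eqP; set x' := repr _; set y' := repr _.
have -> : (x' * y')^-1 * (x * y) = (x'^-1 * x) ^ y' * (y'^-1 * y).
  by rewrite /conjg invgM !mulgA mulgK.
by apply: SM; [apply: SJ|]; exact: qr_reprP.
Qed.

Lemma qr_invE (x : G) : qr_inv (qr_pi x) = qr_pi x^-1.
Proof.
have [S1 SM SV SJ] := normal_closureP S.
apply/qr_eqP; set x' := repr _; rewrite invgK.
have -> : x' * x^-1 = ((x'^-1 * x)^-1) ^ x'^-1.
  by rewrite /conjg invgM !invgK !mulgA mulgK.
by apply: SJ; apply: SV; exact: qr_reprP.
Qed.

Lemma qr_mulA : associative qr_mul.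
Proof.
by elim/qr_W=> x; elim/qr_W=> y; elim/qr_W=> z; rewrite !qr_mulE mulgA.
Qed.

Lemma qr_mul1 : left_id qr_one qr_mul.
Proof. by elim/qr_W=> x; rewrite qr_mulE mul1g. Qed.

Lemma qr_mulr1 : right_id qr_one qr_mul.
Proof. by elim/qr_W=> x; rewrite qr_mulE mulg1. Qed.

Lemma qr_mulV : left_inverse qr_one qr_inv qr_mul.
Proof. by elim/qr_W=> x; rewrite qr_invE qr_mulE mulVg. Qed.

Lemma qr_mulrV : right_inverse qr_one qr_inv qr_mul.
Proof. by elim/qr_W=> x; rewrite qr_invE qr_mulE mulgV. Qed.

HB.instance Definition _ := isGroup.Build quot_relators
  qr_mulA qr_mul1 qr_mulr1 qr_mulV qr_mulrV.

End QuotientByRelators.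

(* The free product A * B: words in the disjoint union of A and B, modulo
   multiplying adjacent letters of the same factor and erasing units. *)
Section FreeProduct.
Local Open Scope group_scope.
Variables A B : groupType.
Implicit Types u v w : seq (A + B).

Inductive fp_rel : seq (A + B) -> seq (A + B) -> Prop :=
  | fp_refl u : fp_rel u u
  | fp_sym u v : fp_rel u v -> fp_rel v u
  | fp_trans v u w : fp_rel u v -> fp_rel v w -> fp_rel u w
  | fp_cat u u' v v' : fp_rel u u' -> fp_rel v v' -> fp_rel (u ++ v) (u' ++ v')
  | fp_mull a a' : fp_rel [:: inl a; inl a'] [:: inl (a * a')]
  | fp_mulr b b' : fp_rel [:: inr b; inr b'] [:: inr (b * b')]
  | fp_onel : fp_rel [:: inl 1] [::]
  | fp_oner : fp_rel [:: inr 1] [::].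

Definition fp_relb : rel (seq (A + B)) := fun u v => `[< fp_rel u v >].

Lemma fp_relb_equiv : equiv_class_of fp_relb.
Proof.
split.
- by move=> u; apply/asboolP; exact: fp_refl.
- by move=> u v; apply/asboolP/asboolP; exact: fp_sym.
- move=> v u w /asboolP uv /asboolP vw; apply/asboolP; exact: fp_trans uv vw.
Qed.

Canonical fp_equiv := EquivRelPack fp_relb_equiv.

Definition free_product := {eq_quot fp_equiv}.
HB.instance Definition _ := Choice.on free_product.
HB.instance Definition _ := EqQuotient.on free_product.

Definition fp_invl (c : A + B) : A + B :=
  match c with inl a => inl a^-1 | inr b => inr b^-1 end.
Definition fp_invw u : seq (A + B) := rev (map fp_invl u).

Definition fp_pi : seq (A + B) -> free_product := \pi_(free_product).

Definition fp_one : free_product := fp_pi [::].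
Definition fp_mul (x y : free_product) : free_product := fp_pi (repr x ++ repr y).
Definition fp_inv (x : free_product) : free_product := fp_pi (fp_invw (repr x)).

Lemma fp_W (P : free_product -> Prop) : (forall u, P (fp_pi u)) -> forall x, P x.
Proof. by move=> Pu x; rewrite -[x]reprK; exact: Pu. Qed.

Lemma fp_eqP u v : fp_pi u = fp_pi v <-> fp_rel u v.
Proof. by split=> [/eqmodP/asboolP //|xy]; apply/eqmodP; exact/asboolP. Qed.

Lemma fp_reprP u : fp_rel (repr (fp_pi u)) u.
Proof. by apply/fp_eqP; rewrite /fp_pi reprK. Qed.

Lemma fp_invw_cat u v : fp_invw (u ++ v) = fp_invw v ++ fp_invw u.
Proof. by rewrite /fp_invw map_cat rev_cat. Qed.

Lemma fp_invw_rel u v : fp_rel u v -> fp_rel (fp_invw u) (fp_invw v).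
Proof.
elim=> {u v} [u|u v _ IH|v u w _ IH1 _ IH2|u u' v v' _ IH1 _ IH2|a a'|b b'||].
- exact: fp_refl.
- exact: fp_sym.
- exact: fp_trans IH1 IH2.
- by rewrite !fp_invw_cat; exact: fp_cat.
- by rewrite /fp_invw /= /rev /= invgM; exact: fp_mull.
- by rewrite /fp_invw /= /rev /= invgM; exact: fp_mulr.
- by rewrite /fp_invw /= /rev /= invg1; exact: fp_onel.
- by rewrite /fp_invw /= /rev /= invg1; exact: fp_oner.
Qed.

Lemma fp_mulE u v : fp_mul (fp_pi u) (fp_pi v) = fp_pi (u ++ v).
Proof. by apply/fp_eqP; apply: fp_cat; exact: fp_reprP. Qed.

Lemma fp_invE u : fp_inv (fp_pi u) = fp_pi (fp_invw u).
Proof. by apply/fp_eqP; apply: fp_invw_rel; exact: fp_reprP. Qed.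

Lemma fp_invwK : involutive fp_invw.
Proof.
move=> u; rewrite /fp_invw map_rev revK -map_comp map_id_in // => -[a|b] _ /=;
  by rewrite invgK.
Qed.

Lemma fp_invw_mul u : fp_rel (fp_invw u ++ u) [::].
Proof.
elim: u => [|c u IH]; first exact: fp_refl.
rewrite -cat1s fp_invw_cat -catA [_ ++ (_ ++ u)]catA.
apply: fp_trans IH; apply: fp_cat; first exact: fp_refl.
rewrite -[X in fp_rel _ X]cat0s; apply: fp_cat; last exact: fp_refl.
case: c => [a|b]; rewrite /fp_invw /rev /=.
- by apply: fp_trans (fp_mull _ _) _; rewrite mulVg; exact: fp_onel.
- by apply: fp_trans (fp_mulr _ _) _; rewrite mulVg; exact: fp_oner.
Qed.

Lemma fp_mulA : associative fp_mul.
Proof.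
by elim/fp_W=> x; elim/fp_W=> y; elim/fp_W=> z; rewrite !fp_mulE catA.
Qed.

Lemma fp_mul1 : left_id fp_one fp_mul.
Proof. by elim/fp_W=> x; rewrite fp_mulE. Qed.

Lemma fp_mulr1 : right_id fp_one fp_mul.
Proof. by elim/fp_W=> x; rewrite fp_mulE cats0. Qed.

Lemma fp_mulV : left_inverse fp_one fp_inv fp_mul.
Proof.
by elim/fp_W=> x; rewrite fp_invE fp_mulE; apply/fp_eqP; exact: fp_invw_mul.
Qed.

Lemma fp_mulrV : right_inverse fp_one fp_inv fp_mul.
Proof.
elim/fp_W=> x; rewrite fp_invE fp_mulE; apply/fp_eqP.
by rewrite -{1}[x]fp_invwK; exact: fp_invw_mul.
Qed.

HB.instance Definition _ := isGroup.Build free_product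
  fp_mulA fp_mul1 fp_mulr1 fp_mulV fp_mulrV.

Definition fp_inl (a : A) : free_product := fp_pi [:: inl a].
Definition fp_inr (b : B) : free_product := fp_pi [:: inr b].

End FreeProduct.

Arguments fp_inl {A} B a.
Arguments fp_inr A {B} b.

(* The additive group of int, written multiplicatively. *)
Definition intgroup : Type := int.
HB.instance Definition _ := Choice.on intgroup.
HB.instance Definition _ := @isGroup.Build intgroup 0 -%R +%R
  (@addrA int) (@add0r int) (@addr0 int) (@addNr int) (@addrN int).

Definition intgroup_gen : intgroup := 1 : int.

Section HNN.
Local Open Scope group_scope.
Variables (G H : groupType) (i1 i2 : H -> G).

Definition stable_letter : free_product G intgroup := fp_inr G intgroup_gen.

Definition hnn_relators : set (free_product G intgroup) :=
  [set (fp_inl intgroup (i1 h))^-1 * stable_letter *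
       fp_inl intgroup (i2 h) * stable_letter^-1 | h in [set: H]].

Definition HNN : groupType := quot_relators hnn_relators.

End HNN.

Section Metrics.
Variable R : realType.

(* For n = 0 the normalised trace is the junk value 0; only n > 0 is used. *)
Definition normalized_tr n (A : 'M[R[i]]_n) : R[i] := \tr A / n%:R.

(* normalized_tr (A ^t* *m A) is a nonnegative real, hence the harmless Re. *)
Definition hs_norm n (A : 'M[R[i]]_n) : R :=
  Num.sqrt (complex.Re (normalized_tr (A ^t* *m A))).

Definition hamming (X : finType) (Y : eqType) (f g : X -> Y) : R :=
  #|[pred x | f x != g x]|%:R / #|X|%:R.

End Metrics.

Section Stability.
Variable R : realType.
Variable G : groupType.

(* Hilbert spaces are C^k, acted on by matrices on column vectors. The inclusion
   of X_n = C^(k n) into Y_n = C^(m n) is an arbitrary linear isometry V n, so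
   that (V n) ^t* *m A *m V n is the compression of A to X_n. *)
Definition flexibly_HS_stable : Prop :=
  forall (k : nat -> nat) (phi : forall n, G -> 'M[R[i]]_(k n)),
    (forall n, (0 < k n)%N) ->
    (forall n g, phi n g \is unitarymx) ->
    (forall g h : G,
      hs_norm (phi n g *m phi n h - phi n (g * h)%g) @[n --> \oo] --> (0 : R)) ->
  exists (m : nat -> nat) (V : forall n, 'M[R[i]]_(m n, k n))
         (psi : forall n, G -> 'M[R[i]]_(m n)),
    [/\ forall n, (V n) ^t* *m V n = 1%:M,
        (m n)%:R / (k n)%:R @[n --> \oo] --> (1 : R),
        forall n g, psi n g \is unitarymx,
        forall n g h, psi n (g * h)%g = psi n g *m psi n h &
        forall g : G,
          hs_norm (phi n g - (V n) ^t* *m psi n g *m V n) @[n --> \oo]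
            --> (0 : R)].

(* Products are written as compositions of functions because the product of
   {perm X} composes from left to right. The inclusion of X_n into Y_n is an
   arbitrary injection j n. *)
Definition flexibly_P_stable : Prop :=
  forall (X : nat -> finType) (phi : forall n, G -> {perm X n}),
    (forall n, (0 < #|X n|)%N) ->
    (forall g h : G,
      hamming R (phi n g \o phi n h) (phi n (g * h)%g) @[n --> \oo]
        --> (0 : R)) ->
  exists (Y : nat -> finType) (j : forall n, X n -> Y n)
         (psi : forall n, G -> {perm Y n}),
    [/\ forall n, injective (j n),
        #|Y n|%:R / #|X n|%:R @[n --> \oo] --> (1 : R),
        forall n g h, psi n (g * h)%g =1 psi n g \o psi n h &
        forall g : G,
          hamming R (j n \o phi n g) (psi n g \o j n) @[n --> \oo]
            --> (0 : R)].

End Stability.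

Inductive approx_class : Set := ClassHS | ClassP.

Definition flexibly_stable (R : realType) (C : approx_class) (G : groupType) :
    Prop :=
  match C with
  | ClassHS => flexibly_HS_stable R G
  | ClassP => flexibly_P_stable R G
  end.

(* Main.v *)
(* Restrict an approximate homomorphism of the HNN extension to G and correct it
   to homomorphisms psi_n : G -> Aut(Y_n); the image t of the stable letter then
   almost intertwines the two actions psi_n i_2 and psi_n i_1 of the finite group
   H. It suffices to make the two actions exactly isomorphic by a perturbation of
   relative size o(1): t can then be moved to an exact intertwiner, by completing
   its good part with an equivariant bijection (case P), or by taking the polar
   part of the average of t over H and completing it by a partial isometry between
   the kernels (case HS).

   Isomorphism of the two actions is measured by integers, the defects: differences
   of numbers of fixed points of subsets of H, respectively of dimensions of
   eigenspaces of elements of H. They are at most a constant times the distance E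
   between psi_n(i_1 h) t and t psi_n(i_2 h). Since i_1(H) and i_2(H) are almost
   normal, their elements have finitely many conjugates in G; let S be the finite
   set of all these conjugates. By conjugation invariance the defects are linear
   functions of finitely many multiplicities: a point is classified by the class of
   the set of elements of S fixing it, a vector by the joint eigenvalues of the
   class sums of S, which take finitely many values because S generates a finite
   group (Dicman).

   A multiplicity vector w with small defect T(w) is a sum of vectors in the kernel
   of T and of a remainder of size O(1 + |T(w)|). Hence the types occurring in no
   kernel vector have total multiplicity O(|T(w)|), and psi_n may be made trivial
   there. The defects realised by the other types form a group, so that -T(w) is
   realised by an action of G of size O(|T(w)|), which is added to psi_n. *)

Require Import Defs.
From HB Require Import structures.
From mathcomp Require Import all_boot all_order all_algebra all_fingroup.
From mathcomp Require Import all_classical all_reals all_analysis.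
From mathcomp Require Import complex generic_quotient zify ring.

Set Implicit Arguments.
Unset Strict Implicit.
Unset Printing Implicit Defensive.

Import Order.TTheory GRing.Theory Num.Theory.
Import numFieldNormedType.Exports.

Local Open Scope ring_scope.
Local Open Scope sesquilinear_scope.

(** * Integer multiplicity vectors *)

(** Distances are left unnormalised, so that the correction concerns a single action and its
    constant depends only on [G], [H], [i1] and [i2]. It is applied at each n: a bound linear in E
    tends to 0 once divided by the size of X_n, whereas an additive constant would be fatal for
    bounded sizes. That constant disappears because the defects are integers: if they vanish nothing
    is changed, and otherwise 1 + |T(w)| <= 2 |T(w)|. With unitaries this calls for squared norms,
    since for projections P and Q the integer |tr P - tr Q| is at most the squared norm of P - Q.

    The obstacle is that points or vectors cannot be added at will: only defects carried by actions
    of all of G are available. Sums of actions add them. Opposites come from a kernel vector c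
    positive exactly on the retained types: N c - w is nonnegative for large N, and a fixed multiple
    of each retained type occurs alone up to trivial constituents. The trivial type has slope 0 and
    carries no weight, so making a part trivial simply erases its weight. *)

Section ZeroSumDecomposition.
Implicit Types I J K : finType.

Definition functional I (s : I -> int) (w : I -> nat) : int :=
  \sum_i (w i)%:Z * s i.

Lemma functionalD I (s : I -> int) (w w' : I -> nat) :
  functional s (fun i => w i + w' i)%N = functional s w + functional s w'.
Proof.
by rewrite -big_split /=; apply: eq_bigr => i _; rewrite PoszD mulrDl.
Qed.

Lemma functionalM I (s : I -> int) (w : I -> nat) (n : nat) :
  functional s (fun i => n * w i)%N = n%:Z * functional s w.
Proof. by rewrite mulr_sumr; apply: eq_bigr => i _; rewrite PoszM mulrA. Qed.

Lemma functional0 I (s : I -> int) : functional s (fun=> 0%N) = 0.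
Proof. by rewrite /functional big1 // => i _; rewrite mul0r. Qed.

Lemma functional_sum I J (s : I -> int) (r : seq J) (P : pred J) (w : J -> I -> nat) :
  functional s (fun i => \sum_(j <- r | P j) w j i)%N =
  \sum_(j <- r | P j) functional s (w j).
Proof.
rewrite /functional exchange_big /=; apply: eq_bigr => i _.
by rewrite -mulr_suml (big_morph Posz PoszD (erefl _)).
Qed.

Lemma functional_delta I (s : I -> int) (i : I) :
  functional s (fun i' => (i' == i) : nat) = s i.
Proof.
rewrite /functional (bigD1 i) //= eqxx mul1r big1 ?addr0 // => j /negbTE ->.
by rewrite mul0r.
Qed.

(** A nonzero integer slope has absolute value at least 1, so an index on the unbounded side
    contributes at least its own weight to the signed functional; the bounded side, which is the
    positive one when [sg] holds, loses at most twice [M] times its slopes. *)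
Lemma le_functional_abs I (s : I -> int) (w : I -> nat) (M : nat) (sg : bool) :
  (forall i, s i = 0 -> w i = 0%N) ->
  (forall i, (if sg then 0 < s i else s i < 0) -> (w i < M)%N) ->
  (\sum_i w i <= `|functional s w| + 2 * (M * \sum_i `|s i|))%N.
Proof.
move=> w0 wM.
have ub i : (w i)%:Z <= (-1) ^+ sg * ((w i)%:Z * s i) + 2 * (M%:Z * `|s i|%N%:Z).
  have [si0|sin0] := eqVneq (s i) 0; first by rewrite (w0 i si0) si0; lia.
  have := wM i; clear wM; case: sg; rewrite ?expr1 ?expr0 => H.
    have [/H|] := boolP (0 < s i); nia.
  have [/H|] := boolP (s i < 0); nia.
have : (\sum_i w i)%N%:Z <= (-1) ^+ sg * functional s w + 2 * (M * \sum_i `|s i|)%N%:Z.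
  rewrite PoszM !(big_morph Posz PoszD (erefl _)) /functional !mulr_sumr -big_split /=.
  by apply: ler_sum => i _; exact: ub.
by clear ub wM; case: sg; rewrite ?expr1 ?expr0; lia.
Qed.

(** Greedy subtraction of elementary kernel vectors. When none fits under [w] any more, no weight is
    left on slope 0 and all weights on one of the two signs are below [M], so [le_functional_abs]
    bounds the rest. *)
Lemma zero_sum_dec1 I (s : I -> int) :
  exists (J : finType) (z : J -> I -> nat) (C : nat),
    (forall j, functional s (z j) = 0) /\
    forall w : I -> nat, exists (n : J -> nat) (b : I -> nat),
      (forall i, w i = \sum_j n j * z j i + b i)%N /\
      (\sum_i b i <= C * (1 + `|functional s w|))%N.
Proof.
(* [M] exceeds every slope, hence a pair vector fits under [w] as soon as [w] is at least [M] at
   both of its indices. *)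
pose M := (\sum_i `|s i|).+1.
have sM i : (`|s i| < M)%N by rewrite /M (bigD1 i) //= ltnS leq_addr.
pose pm i k := (0 < s i) && (s k < 0).
(* Either one unit at an index of slope 0, or the balanced combination of a positive slope with a
   negative one; other indices [j] give the zero vector. *)
pose z (j : I + I * I) (i : I) : nat := match j with
  | inl i0 => (s i0 == 0) * (i == i0)
  | inr (i0, k) => pm i0 k * (`|s k| * (i == i0) + `|s i0| * (i == k)) end%N.
have z0 j : functional s (z j) = 0.
  case: j => [i0|[i0 k]] /=; rewrite functionalM.
    by rewrite functional_delta; case: eqP => [->|]; rewrite ?mulr0 ?mul0r.
  rewrite functionalD !functionalM !functional_delta.
  rewrite /pm; case: andP => [[si sk]|_]; last by rewrite mul0r.
  have [-> ->] : `|s k|%N%:Z = - s k /\ `|s i0|%N%:Z = s i0 by lia.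
  by rewrite mul1r mulNr mulrC addNr.
exists (I + I * I)%type, z, (2 * M * M + 1)%N; split=> // w.
have [N] := ubnP (\sum_i w i)%N; elim: N => // N IH in w *; rewrite ltnS => wN.
have step j : (forall i, z j i <= w i)%N -> (exists i, 0 < z j i)%N ->
    exists (n : (I + I * I)%type -> nat) (b : I -> nat),
      (forall i, w i = \sum_j n j * z j i + b i)%N /\
      (\sum_i b i <= (2 * M * M + 1) * (1 + `|functional s w|))%N.
  move=> zw [i zi].
  have wE : w = (fun i => (w i - z j i) + z j i)%N by apply/funext => i'; rewrite subnK.
  have [|n [b [nb bC]]] := IH (fun i => w i - z j i)%N.
    apply: leq_trans wN; rewrite {2}wE big_split /= -[X in (X < _)%N]addn0 ltn_add2l.
    by rewrite (bigD1 i) //= addn_gt0 zi.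
  exists (fun j' => n j' + (j' == j))%N, b; split.
    move=> i'; rewrite {1}wE nb; under [in RHS]eq_bigr do rewrite mulnDl.
    rewrite big_split /= addnAC; congr (_ + _ + _)%N.
    by rewrite (bigD1 j) //= eqxx mul1n big1 ?addn0 // => j' /negbTE ->.
  by move: bC; rewrite [in X in _ -> X]wE functionalD z0 addr0.
have [/existsP[i /andP[si0 wi]]|nA] := boolP [exists i, (s i == 0) && (0 < w i)%N].
  apply: (step (inl i)) => /=; last by exists i; rewrite si0 eqxx.
  by move=> i'; rewrite si0; case: eqP => [->|].
have [/existsP[i /existsP[k /and3P[ik wi wk]]]|nB] :=
    boolP [exists i, exists k, [&& pm i k, M <= w i & M <= w k]%N].
  apply: (step (inr (i, k))) => /=; last first.
    by exists i; rewrite ik eqxx; move: ik; rewrite /pm; lia.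
  have nik : i != k by apply/eqP => E; move: ik; rewrite /pm E; lia.
  move=> i'; rewrite ik mul1n; have := sM i; have := sM k.
  have [->|] := eqVneq i' i; first by rewrite (negbTE nik); lia.
  by have [->|] := eqVneq i' k; lia.
exists (fun=> 0%N), w; split; first by move=> i; rewrite big1.
have w0 i : s i = 0 -> w i = 0%N.
  move=> si; apply/eqP; rewrite -leqn0 leqNgt; apply/negP => wi; case/negP: nA.
  by apply/existsP; exists i; rewrite si eqxx.
have [sg Hsg] : exists sg : bool, forall i, (if sg then 0 < s i else s i < 0) -> (w i < M)%N.
  have [/existsP[i /andP[si wi]]|nP] := boolP [exists i, (0 < s i) && (M <= w i)%N].
    exists false => k sk; rewrite ltnNge; apply/negP => wk; case/negP: nB.
    by apply/existsP; exists i; apply/existsP; exists k; rewrite /pm si sk wi.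
  exists true => i si; rewrite ltnNge; apply/negP => wi; case/negP: nP.
  by apply/existsP; exists i; rewrite si.
have := le_functional_abs w0 Hsg; have : (\sum_i `|s i| <= M)%N by rewrite /M.
by move: (\sum_i `|s i|)%N => S; nia.
Qed.

(** Induction on the functionals: the kernel vectors found so far serve as new coordinates, and the
    next functional, read in these coordinates, is again an integer functional to which
    [zero_sum_dec1] applies. Its value on the coordinates differs from its value on [w] only by its
    value on the remainder. *)
Lemma zero_sum_dec I K (s : K -> I -> int) (ks : seq K) :
  exists (J : finType) (z : J -> I -> nat) (C : nat),
    (forall j k, k \in ks -> functional (s k) (z j) = 0) /\
    forall w : I -> nat, exists (n : J -> nat) (b : I -> nat),
      (forall i, w i = \sum_j n j * z j i + b i)%N /\
      (\sum_i b i <= C * (1 + \sum_(k <- ks) `|functional (s k) w|))%N.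
Proof.
elim: ks => [|k ks [J [z [C [z0 zC]]]]].
  exists I, (fun i i' => (i' == i) : nat), 0%N; split=> // w.
  exists w, (fun=> 0%N); split; last by rewrite big1.
  move=> i; rewrite addn0 (bigD1 i) //= eqxx muln1 big1 ?addn0 // => j.
  by rewrite eq_sym => /negbTE ->; rewrite muln0.
have [J' [z' [C' [z'0 z'C]]]] := zero_sum_dec1 (fun j => functional (s k) (z j)).
pose y j' i := (\sum_j z' j' j * z j i)%N.
have fy k' j' : functional (s k') (y j') =
    functional (fun j => functional (s k') (z j)) (z' j').
  by rewrite /y functional_sum; apply: eq_bigr => j _; rewrite functionalM.
pose Z := (\sum_j \sum_i z j i)%N; pose A := (\sum_i `|s k i|)%N.
exists J', y, (C + C' * (1 + A * C) * Z)%N; split.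
  move=> j' k'; rewrite inE => /orP[/eqP ->|k'ks]; rewrite fy ?z'0 //.
  by rewrite /functional big1 // => j _; rewrite -/(functional _ _) z0 // mulr0.
move=> w; have [n [b [wE bC]]] := zC w.
have [n' [b' [nE b'C]]] := z'C n.
exists n', (fun i => \sum_j b' j * z j i + b i)%N; split.
  move=> i; rewrite wE addnA; congr (_ + _)%N.
  under eq_bigr do rewrite nE mulnDl.
  rewrite big_split /=; congr (_ + _)%N.
  under eq_bigr do rewrite big_distrl /=.
  rewrite exchange_big; apply: eq_bigr => j' _ /=.
  by rewrite /y big_distrr /=; apply: eq_bigr => j _; rewrite mulnA.
have fn : (`|functional (fun j => functional (s k) (z j)) n| <=
    `|functional (s k) w| + A * \sum_i b i)%N.
  have -> : functional (fun j => functional (s k) (z j)) n =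
      functional (s k) w - functional (s k) b.
    rewrite (funext wE) functionalD functional_sum addrK.
    by apply: eq_bigr => j _; rewrite functionalM.
  suff : (`|functional (s k) b| <= A * \sum_i b i)%N by lia.
  rewrite /A big_distrl /=; have : forall r : seq I, (`|(\sum_(i <- r) (b i)%:Z * s k i)%R| <=
    \sum_(i <- r) `|s k i| * \sum_i b i)%N; last exact.
  elim=> [|i r IH]; rewrite ?big_nil // !big_cons.
  have : (`|((b i)%:Z * s k i)%R| <= `|s k i| * \sum_i b i)%N.
    by rewrite abszM mulnC leq_mul2l absz_nat (bigD1 i) //= leq_addr orbT.
  move: IH; move: ((b i)%:Z * s k i) (\sum_(j <- r) (b j)%:Z * s k j) => x x'.
  lia.
have b'Z : (\sum_i \sum_j b' j * z j i <= (\sum_j b' j) * Z)%N.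
  rewrite exchange_big big_distrl /=; apply: leq_sum => j _.
  rewrite -big_distrr /= leq_mul2l /Z (bigD1 j) //= leq_addr orbT //.
rewrite big_split /= big_cons.
move: (\sum_(k <- ks) _)%N bC => B bC.
move: b'Z; move: (\sum_i \sum_j b' j * z j i)%N b'C fn bC.
move: (\sum_i b i)%N (\sum_j b' j)%N `|functional (s k) w|%N `|functional _ n|%N.
clear; move=> b b' x y q h1 h2 h3 h4.
have e1 : (1 + y <= (1 + A * C) * (1 + (x + B)))%N by nia.
have e2 : (b' <= C' * (1 + A * C) * (1 + (x + B)))%N by rewrite -mulnA; nia.
have e3 : (b' * Z <= C' * (1 + A * C) * Z * (1 + (x + B)))%N.
  by rewrite [in leqRHS]mulnAC leq_mul2r e2 orbT.
rewrite mulnDl [leqLHS]addnC; apply: leq_add; last by lia.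
by apply: leq_trans h3 _; rewrite leq_mul2l; lia.
Qed.

End ZeroSumDecomposition.

(** [Q v d] says that [v] is realised at cost [d]. The realised vectors form a subgroup of a free
    abelian group of finite rank; division along an echelon basis writes each of them with
    coefficients linear in its size, so the cost of the rewritten realisation no longer depends on
    [d]. *)
Lemma lattice_bound (K : finType) (Q : (K -> int) -> nat -> Prop) :
  Q (fun=> 0) 0%N ->
  (forall v v' d d', Q v d -> Q v' d' -> Q (fun k => v k + v' k) (d + d')%N) ->
  (forall v d, Q v d -> exists d', Q (fun k => - v k) d') ->
  exists C : nat, forall v d, Q v d ->
    exists2 d', (d' <= C * \sum_k `|v k|)%N & Q v d'.
Proof.
move=> Q0 QD QN.
have QM v d (n : nat) : Q v d -> Q (fun k => n%:Z * v k) (n * d)%N.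
  move=> Qv; elim: n => [|n IH].
    by rewrite mul0n; under eq_fun do rewrite mul0r.
  rewrite mulSn; under eq_fun do rewrite -addn1 addnC PoszD mulrDl mul1r.
  exact: QD.
have QZ v d : Q v d -> exists D, forall q : int,
    exists2 d', (d' <= `|q| * D)%N & Q (fun k => q * v k) d'.
  move=> Qv; have [e Qe] := QN _ _ Qv; exists (maxn d e) => -[n|n].
    by exists (n * d)%N; [rewrite leq_mul2l leq_maxl orbT|exact: QM].
  exists (n.+1 * e)%N; first by rewrite leq_mul2l leq_maxr orbT.
  have := QM _ _ n.+1 Qe; congr Q; apply/funext => k.
  by rewrite NegzE mulrN mulNr.
suff [C HC] : exists C : nat, forall v d, Q v d ->
    (forall k, k \notin enum K -> v k = 0) ->
    exists2 d', (d' <= C * \sum_k `|v k|)%N & Q v d'.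
  by exists C => v d Qv; apply: (HC v d Qv) => k; rewrite mem_enum.
elim: (enum K) => [|k ks [C IH]].
  exists 0%N => v d _ v0; exists 0%N => //.
  suff -> : v = fun=> 0 by [].
  by apply/funext => k; exact: v0.
have [[v0 [d0 [Q0v s0 nz0]]]|none] := pselect (exists v d,
    [/\ Q v d, forall k', k' \notin k :: ks -> v k' = 0 & v k != 0]); last first.
  exists C => v d Qv sv; apply: (IH v d Qv) => k' k'ks.
  have [->|k'k] := eqVneq k' k; last by apply: sv; rewrite inE negb_or k'k.
  by have [->//|vk] := eqVneq (v k) 0; case: none; exists v, d.
(* The pivot [u] has the smallest nonzero absolute value at [k], so the remainder of a division by
   [u k], being realised as well, must vanish there. *)
pose R (g : nat) := `[< exists v d, [/\ Q v d,
  forall k', k' \notin k :: ks -> v k' = 0, v k != 0 & `|v k|%N = g] >].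
have exR : exists g, R g by exists `|v0 k|%N; apply/asboolP; exists v0, d0.
case: (ex_minnP exR) => g /asboolP[u [du [Qu su nzu <-]]] gmin.
have [D HD] := QZ _ _ Qu.
exists (C * (1 + \sum_k `|u k|) + D)%N => v d Qv sv.
pose q := (v k %/ u k)%Z; pose r k' := v k' - q * u k'.
have [d1 _ Q1] := HD (- q).
have Qr : Q r (d + d1)%N.
  by have := QD _ _ _ _ Qv Q1; congr Q; apply/funext => k'; rewrite mulNr.
have sr k' : k' \notin k :: ks -> r k' = 0.
  by move=> k'ks; rewrite /r sv // su // mulr0 subrr.
have rk : r k = 0.
  apply/eqP; apply: contraT => rk0.
  have : (`|u k| <= `|r k|)%N.
    by apply: gmin; apply/asboolP; exists r, (d + d1)%N.
  have -> : r k = (v k %% u k)%Z by rewrite /r {1}(divz_eq (v k) (u k)) addrC addKr.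
  have := modz_ge0 (v k) nzu; have := ltz_mod (v k) nzu; lia.
have [|d2 d2C Q2] := IH _ _ Qr.
  move=> k' k'ks; have [->//|k'k] := eqVneq k' k.
  by apply: sr; rewrite inE negb_or k'k.
have [d3 d3D Q3] := HD q.
exists (d2 + d3)%N; last first.
  by have := QD _ _ _ _ Q2 Q3; congr Q; apply/funext => k'; rewrite subrK.
have qv : (`|q| <= `|v k|)%N.
  have : (`|q| * `|u k| = `|v k|)%N.
    by rewrite -abszM; congr absz; apply/eqP; rewrite eq_sym -subr_eq0; apply/eqP.
  move: nzu; rewrite -absz_gt0; nia.
have vk : (`|v k| <= \sum_k `|v k|)%N by rewrite [leqRHS](bigD1 k) //= leq_addr.
have rC : (\sum_k `|r k| <= \sum_k `|v k| + `|q| * \sum_k `|u k|)%N.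
  rewrite big_distrr -big_split /=; apply: leq_sum => k' _.
  by rewrite -abszM /r; lia.
move: rC d2C d3D qv vk.
move: (\sum_k `|v k|)%N (\sum_k `|u k|)%N (\sum_k `|r k|)%N `|q|%N `|v k|%N.
clear=> V U S p x h1 h2 h3 h4 h5.
have h6 : (S <= (1 + U) * V)%N by nia.
have : (C * S <= C * (1 + U) * V)%N by rewrite -mulnA leq_mul2l h6 orbT.
have : (p * D <= D * V)%N by nia.
lia.
Qed.

(* [P w d] reads: "some object of size [d] has [w i] constituents of type [i]". *)
Section WeightCorrection.
Variables (I K : finType) (s : K -> I -> int) (P : (I -> nat) -> nat -> Prop).
Hypothesis P0 : P (fun=> 0%N) 0%N.
Hypothesis PD : forall w w' d d',
  P w d -> P w' d' -> P (fun i => w i + w' i)%N (d + d')%N.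
Hypothesis Pres : forall w d i0,
  P w d -> exists d', P (fun i => (i == i0) * w i)%N d'.

Let PM w d n : P w d -> P (fun i => n * w i)%N (n * d)%N.
Proof.
move=> Pw; elim: n => [|n IH]; first exact: P0.
by rewrite mulSn; under eq_fun do rewrite mulSn; exact: PD.
Qed.

Let Psum (L : eqType) (r : seq L) (w : L -> I -> nat) :
  (forall l, l \in r -> exists d, P (w l) d) ->
  exists d, P (fun i => \sum_(l <- r) w l i)%N d.
Proof.
elim: r => [|l r IH] H.
  by exists 0%N; under eq_fun do rewrite big_nil; exact: P0.
have [|d Pd] := IH; first by move=> l' l'r; apply: H; rewrite inE l'r orbT.
have [d' Pd'] := H l (mem_head _ _); exists (d' + d)%N.
by under eq_fun do rewrite big_cons; exact: PD.
Qed.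

Let PresJ w d (J : {set I}) : P w d -> exists d', P (fun i => (i \in J) * w i)%N d'.
Proof.
move=> Pw; have [|d' Pd'] := @Psum I (enum J) (fun l i => (i == l) * w i)%N.
  by move=> l _; exact: Pres Pw.
exists d'; move: Pd'; congr P; apply/funext => i.
rewrite -big_distrl /= big_enum /=; congr (_ * _)%N.
have [iJ|iJ] := boolP (i \in J); last first.
  by rewrite big1 // => l lJ; case: eqP => // il; rewrite il lJ in iJ.
by rewrite (bigD1 i) //= eqxx big1 // => l /andP[_]; rewrite eq_sym => /negbTE ->.
Qed.

Let defect w := (\sum_k `|functional (s k) w|)%N.

(** [c] adds up the kernel vectors all of whose types are realised, and [J] is its support. A kernel
    vector used in decomposing a realised [w] lies below [w], so it is one of these; the weight of
    [w] outside [J] therefore sits in the remainder. *)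
Let zero_sum_support : exists (J : {set I}) (c : I -> nat) (C : nat),
  [/\ forall k, functional (s k) c = 0,
      forall i, (0 < c i)%N = (i \in J),
      forall i, i \in J -> exists2 w, (0 < w i)%N & exists d, P w d &
      forall w d, P w d -> (\sum_(i | i \notin J) w i <= C * (1 + defect w))%N].
Proof.
have [L [z [C [z0 zC]]]] := zero_sum_dec s (enum K).
pose real i := `[< exists2 w, (0 < w i)%N & exists d, P w d >].
pose good l := [forall i, (0 < z l i)%N ==> real i].
pose c i := (\sum_(l | good l) z l i)%N.
exists [set i | (0 < c i)%N], c, C; split=> [k|i|i|w d Pw].
- rewrite functional_sum big1 // => l _.
  by rewrite z0 // mem_enum.
- by rewrite inE.
- rewrite inE lt0n sum_nat_eq0 => /forallPn[l].
  rewrite negb_imply -lt0n => /andP[/forallP/(_ i)/implyP gl] zl.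
  exact/asboolP/gl.
have [n [b [wE bC]]] := zC w.
apply: leq_trans (_ : \sum_i b i <= _)%N; last first.
  by move: bC; rewrite big_enum.
rewrite [leqRHS](bigID (mem [set i | (0 < c i)%N])) /=.
apply: leq_trans (leq_addl _ _); apply: leq_sum => i.
rewrite inE -leqNgt leqn0 sum_nat_eq0 => /forallP ci.
rewrite wE big1 // => l _; have [->//|nl] := posnP (n l).
suff gl : good l by have := ci l; rewrite gl /= => /eqP ->; rewrite muln0.
apply/forallP => i'; apply/implyP => zi'; apply/asboolP; exists w; last by exists d.
by rewrite wE (bigD1 l) //= addn_gt0 addn_gt0 muln_gt0 nl zi'.
Qed.

Lemma weight_correction : exists C : nat, forall w d, P w d ->
  exists (J : {set I}) (w' : I -> nat) (d' : nat),
    [/\ P w' d', (\sum_(i | i \notin J) w i <= C * defect w)%N,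
        (d' <= C * defect w)%N &
        forall k, functional (s k) (fun i => (i \in J) * w i)%N +
                  functional (s k) w' = 0].
Proof.
have [J [c [C [c0 cJ realJ boundJ]]]] := zero_sum_support.
have [r rP] : {r : I -> nat & forall i, i \in J ->
    (0 < r i)%N /\ exists d, P (fun i' => (i' == i) * r i)%N d}.
  apply: (@choice _ _ (fun i ri => i \in J -> (0 < ri)%N /\
    exists d, P (fun i' => (i' == i) * ri)%N d)) => i.
  have [/realJ|] := boolP (i \in J); last by exists 0%N.
  move=> [w wi [d Pw]]; exists (w i); move=> _; split=> //.
  have [d' Pd'] := Pres i Pw; exists d'; move: Pd'; congr P; apply/funext => i'.
  by case: eqP => [->|].
(* A common multiple of the [r i]: every multiple of [m] at a single type of [J] is realised. *)
pose m := (\prod_(i in J) r i)%N.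
have m_gt0 : (0 < m)%N by rewrite prodn_cond_gt0 // => i /rP[].
have unit_m i n : i \in J -> exists d, P (fun i' => (i' == i) * (m * n))%N d.
  move=> iJ; have [ri [d Pd]] := rP i iJ.
  exists (m %/ r i * n * d)%N; have := PM (m %/ r i * n) Pd; congr P.
  apply/funext => i'; rewrite mulnCA mulnAC divnK //.
  by rewrite /m (bigD1 i) //= dvdn_mulr.
pose Q v d := exists w, [/\ P w d, forall i, i \notin J -> w i = 0%N &
  v = fun k => functional (s k) w].
have Q0 : Q (fun=> 0) 0%N.
  by exists (fun=> 0%N); split=> //; apply/funext => k; rewrite functional0.
have QD v v' d d' : Q v d -> Q v' d' -> Q (fun k => v k + v' k) (d + d')%N.
  move=> [w [Pw wJ ->]] [w' [Pw' w'J ->]].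
  exists (fun i => w i + w' i)%N; split; first exact: PD.
    by move=> i iJ; rewrite wJ // w'J.
  by apply/funext => k; rewrite functionalD.
have QN v d : Q v d -> exists d', Q (fun k => - v k) d'.
  move=> [w [Pw wJ ->]]; pose N := (\sum_i w i)%N.
  have wN i : (w i <= N)%N by rewrite /N (bigD1 i) //= leq_addr.
  have [|d1 Pd1] := @Psum I (enum J) (fun i i' => (i' == i) * (m * (N * c i - w i)))%N.
    by move=> i; rewrite mem_enum; exact: unit_m.
  exists (m.-1 * d + d1)%N.
  (* Here (m - 1) w + m (N c - w) = m N c - w, which has the same functionals as - w because those
     of [c] vanish; [N] makes the subtraction exact on [J]. *)
  exists (fun i => m.-1 * w i + (i \in J) * (m * (N * c i - w i)))%N; split.
  - have := PD (PM m.-1 Pw) Pd1; congr P; apply/funext => i; congr (_ + _)%N.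
    rewrite big_enum /=; have [iJ|iJ] := boolP (i \in J); last first.
      by rewrite big1 // => l lJ; case: eqP => // il; rewrite il lJ in iJ.
    rewrite (bigD1 i) //= eqxx big1 ?addn0 // => l /andP[_].
    by rewrite eq_sym => /negbTE ->.
  - by move=> i iJ; rewrite wJ // (negbTE iJ) muln0.
  apply/funext => k; apply/eqP; rewrite eq_sym -addr_eq0 -functionalD.
  rewrite (_ : (fun i => _) = (fun i => (m * N) * c i)%N) ?functionalM ?c0 ?mulr0 //.
  apply/funext => i; have [iJ|iJ] := boolP (i \in J); last first.
    rewrite wJ // muln0 mul0n; move: iJ; rewrite -cJ -leqNgt leqn0.
    by move=> /eqP ->; rewrite muln0.
  have : (w i <= N * c i)%N.
    by apply: leq_trans (wN i) _; rewrite leq_pmulr // cJ.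
  by move: m_gt0; case: (m) => // p _; rewrite /= mul1n; nia.
have [C' HC'] := lattice_bound Q0 QD QN.
pose A := (\sum_k \sum_i `|s k i|)%N.
(* [2 * C] bounds the weight outside [J] when the defect is positive; discarding it changes the
   defect by at most [A] times that weight, and [C'] is the cost per unit of the defect that
   remains. *)
exists (2 * C + C' * (1 + A * (2 * C)))%N => w d Pw.
have [dw0|dw] := posnP (defect w).
  exists finset.setT, (fun=> 0%N), 0%N; split=> //.
    by rewrite big_pred0 // => i; rewrite inE.
  move=> k; rewrite functional0 addr0.
  rewrite (_ : (fun i => _) = w); last by apply/funext => i; rewrite inE mul1n.
  apply/eqP; rewrite -absz_eq0; move/eqP: dw0.
  by rewrite sum_nat_eq0 => /forallP/(_ k)/implyP/(_ isT).
have bJ : (\sum_(i | i \notin J) w i <= 2 * C * defect w)%N.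
  by apply: leq_trans (boundJ _ _ Pw) _; nia.
have [d1 Pd1] := PresJ J Pw.
pose wJ i := ((i \in J) * w i)%N.
have QJ : Q (fun k => functional (s k) wJ) d1.
  by exists wJ; split=> // i iJ; rewrite /wJ (negbTE iJ).
have [d2 QJN] := QN _ _ QJ.
have [d' d'C [w' [Pw' _ w'E]]] := HC' _ _ QJN.
exists J, w', d'; split=> //.
- by apply: leq_trans bJ _; rewrite leq_mul2r leq_addr orbT.
- apply: leq_trans d'C _; rewrite mulnDl; apply: leq_trans (leq_addl _ _).
  rewrite -mulnA leq_mul2l; apply/orP; right.
  pose B := (\sum_(i | i \notin J) w i)%N.
  apply: (@leq_trans (defect w + A * B)%N); last first.
    by rewrite mulnDl mul1n -mulnA leq_add2l leq_mul2l bJ orbT.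
  rewrite /defect /A big_distrl -big_split /=; apply: leq_sum => k _.
  have -> : functional (s k) w = functional (s k) wJ +
      functional (s k) (fun i => (i \notin J) * w i)%N.
    rewrite -functionalD; congr functional; apply/funext => i.
    by rewrite /wJ; case: (i \in J); lia.
  suff : (`|functional (s k) (fun i => (i \notin J) * w i)%N| <=
    (\sum_i `|s k i|) * B)%N by lia.
  have : forall r : seq I, (`|(\sum_(i <- r) ((i \notin J) * w i)%N%:Z * s k i)%R| <=
      (\sum_(i <- r) `|s k i|) * B)%N; last exact.
  elim=> [|i l IH]; rewrite ?big_nil // !big_cons mulnDl.
  have : (`|(((i \notin J) * w i)%N%:Z * s k i)%R| <= `|s k i| * B)%N.
    rewrite abszM mulnC leq_mul2l absz_nat; apply/orP; right.
    have [//|iJ] := boolP (i \in J).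
    by rewrite mul1n /B (bigD1 i) //= leq_addr.
  move: IH; move: (\sum_(j <- l) ((j \notin J) * w j)%N%:Z * s k j).
  by move: (_ * _)%R => x x'; lia.
- move=> k; have /(congr1 (fun f => f k)) := w'E => /= <-; exact: addrN.
Qed.

End WeightCorrection.

(** * Groups and HNN extensions *)

Section GroupLemmas.
Local Open Scope group_scope.

Definition ghom (A B : groupType) (f : A -> B) := {morph f : x y / x * y}.

Section Hom.
Variables (A B : groupType) (f : A -> B).
Hypothesis fM : ghom f.

Lemma ghom1 : f 1 = 1.
Proof. by apply: (@mulgI _ (f 1)); rewrite -fM !mulg1. Qed.

Lemma ghomV x : f x^-1 = (f x)^-1.
Proof. by apply: (@mulgI _ (f x)); rewrite -fM !mulgV ghom1. Qed.

Lemma ghomX x n : f (x ^+ n) = f x ^+ n.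
Proof. by elim: n => [|n IH]; rewrite ?expg0 ?ghom1 // !expgS fM IH. Qed.

Lemma ghomJ x y : f (x ^ y) = f x ^ f y.
Proof. by rewrite !conjgE !fM ghomV. Qed.

End Hom.

Lemma expg_card (H : finGroupType) (h : H) : h ^+ #|H| = 1.
Proof.
have /dvdnP[k ->] : (#[h] %| #|H|)%N by rewrite -cardsT cardSg ?finset.subsetT.
by rewrite mulnC expgnA expg_order expg1n.
Qed.

(** Conjugation by [L] permutes the image of [i], so a conjugate of [i h] only depends, up to the
    choice of [h], on a coset of [L]; finitely many representatives suffice. *)
Lemma almost_normal_conj_closed (G : groupType) (H : finGroupType) (i : H -> G) :
  ghom i -> almost_normal (range i) ->
  exists S : seq G,
    [/\ forall h, i h \in S, forall s g, s \in S -> s ^ g \in S &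
        forall s, s \in S -> s ^+ #|H| = 1].
Proof.
move=> iM [L [sK sL KL nKL] [r rP]].
have rangeE k : range i k -> exists h, k = i h by case=> h _ <-; exists h.
exists [seq i h ^ x^-1 | h <- enum H, x <- r]; split.
- move=> h; have [x xr Lx] := rP 1.
  have [|h' h'E] := rangeE (i h ^ x); last first.
    by apply/allpairsP; exists (h', x); rewrite mem_enum xr -h'E conjgK.
  rewrite -(invgK x); apply: nKL; first by exists h.
  by case: sL => _ _; apply; move: Lx; rewrite mulg1.
- move=> s g /allpairsP[[h x] /= [_ xr ->]].
  have [y yr Ly] := rP (g^-1 * x).
  apply/allpairsP; have [|h' h'E] := rangeE (i h ^ (y^-1 * (g^-1 * x))^-1).
    apply: nKL; first by exists h.
    by case: sL => _ _; exact.
  exists (h', y); rewrite mem_enum; split=> //=.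
  by rewrite -h'E -!conjgM !invgM !invgK mulgK.
- move=> s /allpairsP[[h x] /= [_ _ ->]].
  rewrite -conjXg -(ghomX iM).
  by rewrite expg_card (ghom1 iM) conj1g.
Qed.

Lemma size_le_count (T : eqType) (S w : seq T) (e : nat) :
  {subset w <= S} -> (forall s, s \in S -> count_mem s w <= e)%N ->
  (size w <= e * size S)%N.
Proof.
elim: S w => [|s S IH] w wS we.
  by case: w wS {we} => [|x w] // /(_ x (mem_head _ _)).
rewrite -(count_predC (pred1 s)) /= mulnS leq_add ?we ?mem_head // -size_filter.
apply: IH => [x|x xS].
  by rewrite mem_filter /= => /andP[xs /wS]; rewrite inE (negbTE xs).
apply: leq_trans (we x _); last by rewrite inE xS orbT.
by rewrite count_filter; apply: sub_count => y /andP[].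
Qed.

(* Dicman's lemma: collecting equal letters of a long word shortens it. *)
Lemma dicman (G : groupType) (S : seq G) (e : nat) :
  (forall s g, s \in S -> s ^ g \in S) ->
  (0 < e)%N -> (forall s, s \in S -> s ^+ e = 1) ->
  exists F : seq G, 1 \in F /\ forall s x, s \in S -> x \in F -> s * x \in F.
Proof.
move=> SJ e_gt0 Se.
pose prod (w : seq G) := foldr *%g 1 w.
(* Moving a letter [s] to the front replaces each letter it crosses by a conjugate, which is still
   in [S]. *)
have collect s k w : {subset w <= S} -> (k <= count_mem s w)%N ->
    exists w', [/\ {subset w' <= S}, (size w' + k = size w)%N &
                   prod w = s ^+ k * prod w'].
  elim: w k => [|x w IH] k wS kw.
    by exists [::]; move: kw; rewrite leqn0 => /eqP ->; rewrite expg0 mul1g.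
  have w_S : {subset w <= S} by move=> y yw; apply: wS; rewrite inE yw orbT.
  move: kw => /=; have [xs|xs] := eqVneq x s.
    rewrite xs in wS *; case: k => [|k] kw.
      by exists (s :: w); split; rewrite ?addn0 ?expg0 ?mul1g.
    have [w' [w'S sw pw]] := IH k w_S kw.
    by exists w'; rewrite /= -sw addnS pw expgS mulgA.
  move=> kw; have [w' [w'S sw pw]] := IH k w_S kw.
  exists (x ^ (s ^+ k) :: w'); split; last 2 first.
  - by rewrite /= addSn sw.
  - by rewrite /= pw mulgA (conjgC x) -mulgA.
  move=> y; rewrite inE => /predU1P[->|/w'S //]; apply: SJ.
  by apply: wS; exact: mem_head.
(* A word longer than [N] contains some letter at least [e] times, and the [e] collected copies
   multiply to 1. *)
pose N := (e * size S)%N.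
have short w : {subset w <= S} ->
    exists w', [/\ {subset w' <= S}, (size w' <= N)%N & prod w = prod w'].
  have [n] := ubnP (size w); elim: n => // n IH in w *; rewrite ltnS => wn wS.
  have [|Nw] := leqP (size w) N; first by exists w.
  have [s sS sw] : exists2 s, s \in S & (e <= count_mem s w)%N.
    apply/hasP; apply: contraLR Nw => /hasPn few; rewrite -leqNgt.
    by apply: size_le_count => // s sS; rewrite ltnW // ltnNge few.
  have [w' [w'S sw' pw]] := collect s e w wS sw.
  have sw'n : (size w' < n)%N.
    by move: wn; rewrite -sw'; apply: leq_trans; rewrite -addn1 leq_add2l.
  have [u [uS su pu]] := IH w' sw'n w'S.
  by exists u; split=> //; rewrite pw (Se s sS) mul1g.
pose fix words n : seq G := if n is n'.+1 then
  1 :: [seq s * x | s <- S, x <- words n'] else [:: 1].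
have words1 n : 1 \in words n by case: n => *; exact: mem_head.
have wordsP n x : reflect
    (exists w, [/\ {subset w <= S}, (size w <= n)%N & x = prod w]) (x \in words n).
  elim: n x => [|n IH] x /=.
    rewrite inE; apply: (iffP eqP) => [->|[w [_ sw ->]]]; first by exists [::].
    by case: w sw.
  rewrite inE; apply: (iffP orP) => [[/eqP ->|]|[w [wS sw ->]]].
  - by exists [::].
  - move=> /allpairsP[[s y] /= [sS /IH[w [wS sw ->]] ->]].
    exists (s :: w); split=> // z.
    by rewrite inE => /predU1P[->|/wS].
  case: w wS sw => [|s w] wS sw; first by left.
  right; apply/allpairsP; exists (s, prod w); split=> //=.
    by apply: wS; exact: mem_head.
  by apply/IH; exists w; split=> // z zw; apply: wS; rewrite inE zw orbT.
exists (words N); split=> // s x sS /wordsP[w [wS _ ->]].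
have [|w' [w'S sw' pw]] := short (s :: w).
  by move=> z; rewrite inE => /predU1P[->|/wS].
apply/wordsP; exists w'; split=> //; exact: pw.
Qed.

End GroupLemmas.

(** * Universal property of the HNN extension *)

Section HNNUniversal.
Local Open Scope group_scope.

Definition zexpg (K : groupType) (t : K) (z : intgroup) : K :=
  match (z : int) with Posz n => t ^+ n | Negz n => t ^- n.+1 end.

Lemma zexpgD (K : groupType) (t : K) : ghom (zexpg t).
Proof.
have sub m n : zexpg t (m%:Z - n%:Z)%R = t ^+ m * t ^- n.
  have [le_nm|/ltnW le_mn] := leqP n m.
    by rewrite subzn // /zexpg expgnFr.
  rewrite -opprB subzn //.
  have -> : zexpg t (- (n - m)%N%:Z)%R = t ^- (n - m).
    by case: (n - m)%N => [|k]; rewrite ?oppr0 /zexpg ?expg0 ?invg1 // -NegzE.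
  by rewrite expgnFr // invgM invgK.
have split (a : int) : exists m n, a = (m%:Z - n%:Z)%R.
  case: a => n; first by exists n, 0%N; rewrite subr0.
  by exists 0%N, n.+1; rewrite sub0r NegzE.
move=> a b; have [m [n ->]] := split a; have [p [q ->]] := split b.
have -> : ((m%:Z - n%:Z)%R : intgroup) * ((p%:Z - q%:Z)%R : intgroup) =
    ((m + p)%N%:Z - (n + q)%N%:Z)%R.
  by rewrite !PoszD opprD addrACA.
rewrite !sub [in RHS]mulgA.
have c k : commute (t ^- n) (t ^+ k).
  by apply/commute_sym/commuteV/commuteX2/commute_refl.
rewrite -[in RHS](mulgA _ (t ^- n)) [t ^- n * _]c [(m + p)%N]addnC [(n + q)%N]addnC.
by rewrite !expgnDr invgM [t ^+ p * _](commuteX2 _ _ (commute_refl t)) !mulgA.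
Qed.

Variables (G H : groupType) (i1 i2 : H -> G).

Definition hnn_in (g : G) : HNN i1 i2 := qr_pi _ (fp_inl intgroup g).
Definition hnn_t : HNN i1 i2 := qr_pi _ (stable_letter G).

Lemma qr_piM (K : groupType) (S : set K) : ghom (@qr_pi K S).
Proof. by move=> x y; rewrite -qr_mulE. Qed.

Lemma fp_inlM (A B : groupType) : ghom (@fp_inl A B).
Proof.
by move=> x y; apply/esym; rewrite /fp_inl [LHS]fp_mulE; apply/fp_eqP/fp_mull.
Qed.

Lemma fp_inrM (A B : groupType) : ghom (@fp_inr A B).
Proof.
by move=> x y; apply/esym; rewrite /fp_inr [LHS]fp_mulE; apply/fp_eqP/fp_mulr.
Qed.

Lemma hnn_inM : ghom hnn_in.
Proof. by move=> x y; rewrite /hnn_in fp_inlM qr_piM. Qed.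

Lemma hnn_rel h : hnn_in (i1 h) * hnn_t = hnn_t * hnn_in (i2 h).
Proof.
rewrite /hnn_in /hnn_t -!qr_piM; apply/qr_eqP.
move=> N [nN SN]; case: (nN) => -[N1 _ _] _ _ NJ.
have Nr : N ((fp_inl intgroup (i1 h))^-1 * stable_letter G *
    fp_inl intgroup (i2 h) * (stable_letter G)^-1).
  by apply: SN; exists h.
have := NJ _ (stable_letter G) Nr I.
by rewrite conjgE invgM !mulgA mulgVK.
Qed.

Lemma hnn_ind (P : HNN i1 i2 -> Prop) :
  (forall g, P (hnn_in g)) -> P hnn_t ->
  (forall x y, P x -> P y -> P (x * y)) -> (forall x, P x -> P x^-1) ->
  forall x, P x.
Proof.
move=> Pin Pt PM PV.
have P1 : P 1 by rewrite -(ghom1 hnn_inM).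
have PX n : P (hnn_t ^+ n).
  by elim: n => [|n IH]; [rewrite expg0|rewrite expgS; exact: PM].
apply: qr_W; apply: fp_W; elim=> [|c u IH].
  have -> : fp_pi [::] = 1 :> free_product G intgroup by [].
  by rewrite (ghom1 (@qr_piM _ _)).
have -> : fp_pi (c :: u) = fp_pi [:: c] * fp_pi u :> free_product G intgroup.
  by apply/esym; exact: fp_mulE.
rewrite qr_piM; apply: PM => //; case: c => [g|z]; first exact: Pin.
have -> : fp_pi [:: inr z] = zexpg (stable_letter G) z.
  have SX n : fp_inr G (n%:Z : intgroup) = stable_letter G ^+ n.
    elim: n => [|n IHn]; first by rewrite expg0 -(ghom1 (@fp_inrM G intgroup)).
    by rewrite expgS -IHn -fp_inrM.
  case: z => n; first exact: SX.
  rewrite -[fp_pi _]/(fp_inr G (Negz n : intgroup)) NegzE.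
  by rewrite -[fp_inr _ _]/(fp_inr G ((n.+1%:Z : intgroup)^-1)) (ghomV (@fp_inrM _ _)) SX.
case: z => n /=; first by rewrite (ghomX (@qr_piM _ _)).
by rewrite (ghomV (@qr_piM _ _)) (ghomX (@qr_piM _ _)); exact/PV/PX.
Qed.

Lemma hnn_rec (K : groupType) (f : G -> K) (t : K) :
  ghom f -> (forall h, f (i1 h) * t = t * f (i2 h)) ->
  exists F : HNN i1 i2 -> K,
    [/\ ghom F, forall g, F (hnn_in g) = f g & F hnn_t = t].
Proof.
move=> fM ft.
pose ev (c : G + intgroup) : K := match c with inl g => f g | inr z => zexpg t z end.
pose evw (u : seq (G + intgroup)) : K := foldr (fun c x => ev c * x) 1 u.
have evw_cat u v : evw (u ++ v) = evw u * evw v.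
  by elim: u => [|c u IH] /=; rewrite ?mul1g // IH mulgA.
have evw_rel u v : fp_rel u v -> evw u = evw v.
  elim=> {u v} //= [v u w _ -> _ -> //|u u' v v' _ IH1 _ IH2|a a'|b b'||].
  - by rewrite !evw_cat IH1 IH2.
  - by rewrite fM mulgA.
  - by rewrite (zexpgD t) mulgA.
  - by rewrite (ghom1 fM) mulg1.
  - by rewrite expg0 mulg1.
pose F0 (x : free_product G intgroup) : K := evw (repr x).
have F0pi u : F0 (fp_pi u) = evw u by apply: evw_rel; exact: fp_reprP.
have F0M : ghom F0.
  by apply: fp_W => u; apply: fp_W => v; rewrite [_ * _]fp_mulE !F0pi evw_cat.
pose N := [set x | F0 x = 1]%classic.
have NP x : normal_closure (hnn_relators i1 i2) x -> F0 x = 1.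
  have sN : subgroup N.
    split=> [|x' y Nx' Ny|x' Nx']; rewrite /N /=.
    - exact: (ghom1 F0M).
    - by rewrite F0M Nx' Ny mulg1.
    - by rewrite (ghomV F0M) Nx' invg1.
  have nN : normal_in N setT.
    by split=> // x' y Nx' _; rewrite /N /= (ghomJ F0M) Nx' conj1g.
  move=> /(_ N); apply; split=> //.
  move=> _ [h _ <-]; rewrite /N /= !F0M !(ghomV F0M) /stable_letter !F0pi /= !mulg1.
  by rewrite expg1 -!mulgA [t * (_ * _)]mulgA -ft -mulgA mulKg mulgV.
pose F (x : HNN i1 i2) : K := F0 (repr x).
have Fpi x : F (qr_pi _ x) = F0 x.
  have /NP := @qr_reprP _ (hnn_relators i1 i2) x.
  by rewrite F0M (ghomV F0M) => /mulg1_eq; rewrite invgK.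
exists F; split.
- by apply: qr_W => x; apply: qr_W => y; rewrite [_ * _]qr_mulE !Fpi F0M.
- by move=> g; rewrite Fpi F0pi /= mulg1.
- by rewrite Fpi F0pi /= mulg1.
Qed.

End HNNUniversal.

(** * Stability over a family of metric groups *)

Section Negligible.
Variables (R : realType) (k : nat -> nat).
Implicit Types x y : nat -> R.

(** The divisor is always the size of the original X_n, also for distances measured in a larger
    Y_n. *)
Definition negligible x :=
  (x n / (k n)%:R @[n --> \oo] --> (0 : R))%classic.

Lemma negligible0 : negligible (fun=> 0).
Proof. by rewrite /negligible; under eq_fun do rewrite mul0r; exact: cvg_cst. Qed.

Lemma negligible_le x y :
  (forall n, 0 <= x n <= y n) -> negligible y -> negligible x.
Proof.
move=> xy; apply: (@squeeze_cvgr _ _ _ _ (fun=> 0)); last exact: cvg_cst.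
near=> n; have /andP[x0 xy'] := xy n.
by rewrite divr_ge0 //= ler_wpM2r // invr_ge0.
Unshelve. all: by end_near. Qed.

Lemma negligibleD x y :
  negligible x -> negligible y -> negligible (fun n => x n + y n).
Proof.
move=> cx cy; rewrite /negligible -[0](addr0 0).
by under eq_fun do rewrite mulrDl; exact: cvgD.
Qed.

Lemma negligibleZ (a : R) x : negligible x -> negligible (fun n => a * x n).
Proof.
move=> cx; rewrite /negligible -(mulr0 a).
by under eq_fun do rewrite -mulrA; exact: cvgMr.
Qed.

Lemma negligible_sum (I : Type) (r : seq I) (x : I -> nat -> R) :
  (forall i, negligible (x i)) -> negligible (fun n => \sum_(i <- r) x i n).
Proof.
move=> cx; elim: r => [|i r IH].
  by under eq_fun do rewrite big_nil; exact: negligible0.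
by under eq_fun do rewrite big_cons; exact: negligibleD.
Qed.

Lemma ratio_negligible (m : nat -> nat) :
  (forall n, (0 < k n)%N) -> (forall n, (k n <= m n)%N) ->
  ((m n)%:R / (k n)%:R @[n --> \oo] --> (1 : R))%classic <->
  negligible (fun n => (m n - k n)%N%:R).
Proof.
move=> k0 km; rewrite /negligible.
have -> : (fun n => (m n - k n)%N%:R / (k n)%:R) =
    (fun n => (m n)%:R / (k n)%:R - 1) :> (nat -> R).
  by apply/funext => n; rewrite natrB // mulrBl divff // pnatr_eq0 -lt0n.
split=> [c|c]; first by rewrite -(subrr 1); apply: cvgB c _; exact: cvg_cst.
have -> : (fun n => (m n)%:R / (k n)%:R) =
    (fun n => (m n)%:R / (k n)%:R - 1 + 1) :> (nat -> R).
  by apply/funext => n; rewrite subrK.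
by have := cvgD c (cvg_cst (1 : R)); rewrite add0r; exact.
Qed.

End Negligible.

Section MetricFamilies.
Variable R : realType.

(** Common frame for both classes. [dist] is unnormalised and [ext] extends an automorphism by the
    identity, which is why [dist_ext] is an equality. *)
Record metric_family := MetricFamily {
  obj : Type;
  aut : obj -> groupType;
  osize : obj -> nat;
  dist : forall o, aut o -> aut o -> R;
  emb : obj -> obj -> Type;
  ext : forall o o', emb o o' -> aut o -> aut o';
  dist_ge0 : forall o (x y : aut o), 0 <= dist x y;
  distxx : forall o (x : aut o), dist x x = 0;
  distC : forall o (x y : aut o), dist x y = dist y x;
  (* The factor 2 allows [dist] to be a squared Hilbert-Schmidt norm. *)
  dist_triangle : forall o (x y z : aut o), dist x z <= 2 * (dist x y + dist y z);
  dist_mull : forall o (z x y : aut o), dist (z * x)%g (z * y)%g = dist x y;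
  dist_mulr : forall o (z x y : aut o), dist (x * z)%g (y * z)%g = dist x y;
  extM : forall o o' (e : emb o o'), ghom (ext e);
  dist_ext : forall o o' (e : emb o o') (x y : aut o),
    dist (ext e x) (ext e y) = dist x y;
  emb_size : forall o o', emb o o' -> (osize o <= osize o')%N;
  emb_comp : forall o o' o'' (e : emb o o') (e' : emb o' o''),
    exists e'' : emb o o'', forall x, ext e'' x = ext e' (ext e x)
}.

Variable F : metric_family.

(** Extending [phi] to the larger space replaces the compression, respectively the restriction to
    the smaller set. The two readings agree up to the number of added dimensions or points, which is
    negligible. *)
Definition family_stable (G : groupType) : Prop :=
  forall (o : nat -> obj F) (phi : forall n, G -> aut (o n)),
    (forall n, (0 < osize (o n))%N) ->
    (forall g h : G, negligible (@osize F \o o) (fun n =>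
      dist (phi n g * phi n h)%g (phi n (g * h)%g))) ->
  exists (o' : nat -> obj F) (e : forall n, emb (o n) (o' n))
         (psi : forall n, G -> aut (o' n)),
    [/\ negligible (@osize F \o o) (fun n => (osize (o' n) - osize (o n))%N%:R : R),
        forall n, ghom (psi n) &
        forall g : G, negligible (@osize F \o o) (fun n =>
          dist (ext (e n) (phi n g)) (psi n g))].

(** [C] is chosen before the object, [psi] and [t]: the same constant has to serve along a whole
    sequence. *)
Definition hnn_correctable (G : groupType) (H : finGroupType) (i1 i2 : H -> G) :=
  exists2 C : R, 0 <= C &
  forall (o : obj F) (psi : G -> aut o) (t : aut o), ghom psi ->
  exists (o' : obj F) (e : emb o o') (psi' : G -> aut o') (t' : aut o'),
    let E := \sum_(h : H) dist (psi (i1 h) * t)%g (t * psi (i2 h))%g in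
    [/\ ghom psi', forall h, (psi' (i1 h) * t' = t' * psi' (i2 h))%g,
        (osize o' - osize o)%N%:R <= C * E,
        forall g, dist (ext e (psi g)) (psi' g) <= C * E &
        dist (ext e t) t' <= C * E].

Section Near.
Variables (k : nat -> nat) (o : nat -> obj F).
Implicit Types x y z : forall n, aut (o n).

Definition near_seq x y := negligible k (fun n => dist (x n) (y n)).

Lemma near_refl x : near_seq x x.
Proof. by rewrite /near_seq; under eq_fun do rewrite distxx; exact: negligible0. Qed.

Lemma near_sym x y : near_seq x y -> near_seq y x.
Proof. by rewrite /near_seq; under eq_fun do rewrite distC. Qed.

Lemma near_trans y x z : near_seq x y -> near_seq y z -> near_seq x z.
Proof.
move=> xy yz; have := negligibleZ 2 (negligibleD xy yz).
by apply: negligible_le => n; rewrite dist_ge0 dist_triangle.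
Qed.

Lemma near_mul x x' y y' : near_seq x x' -> near_seq y y' ->
  near_seq (fun n => x n * y n)%g (fun n => x' n * y' n)%g.
Proof.
move=> xx' yy'; apply: (@near_trans (fun n => x' n * y n)%g).
  by rewrite /near_seq; under eq_fun do rewrite dist_mulr.
by rewrite /near_seq; under eq_fun do rewrite dist_mull.
Qed.

Lemma near_inv x y : near_seq x y ->
  near_seq (fun n => (x n)^-1)%g (fun n => (y n)^-1)%g.
Proof.
suff E n : dist (x n)^-1%g (y n)^-1%g = dist (x n) (y n).
  by rewrite /near_seq; under [X in _ -> negligible _ X]eq_fun do rewrite E.
rewrite -(dist_mull (x n)) mulgV -(dist_mulr (y n)) mul1g mulgVK.
exact: distC.
Qed.

End Near.

Theorem hnn_family_stable (G : groupType) (H : finGroupType) (i1 i2 : H -> G) :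
  hnn_correctable i1 i2 -> family_stable G -> family_stable (HNN i1 i2).
Proof.
move=> [C C0 corr] stG o phi o_gt0 phiM.
pose k := @osize F \o o.
have inM := @hnn_inM G H i1 i2.
have [||o1 [e1 [psi [so1 psiM npsi]]]] := stG o (fun n g => phi n (hnn_in i1 i2 g)).
- exact: o_gt0.
- by move=> g h; under eq_fun do rewrite inM; exact: phiM.
pose t n := ext (e1 n) (phi n (hnn_t i1 i2)).
pose E n := \sum_(h : H) dist (psi n (i1 h) * t n)%g (t n * psi n (i2 h))%g.
have E0 n : 0 <= E n by apply: sumr_ge0 => h _; exact: dist_ge0.
have negE : negligible k E.
  apply: negligible_sum => h.
  apply: (@near_trans _ _ (fun n => ext (e1 n) (phi n (hnn_in i1 i2 (i1 h))) * t n)%g).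
    by apply: near_mul; [exact/near_sym/npsi|exact: near_refl].
  apply: (@near_trans _ _ (fun n =>
    t n * ext (e1 n) (phi n (hnn_in i1 i2 (i2 h))))%g); last first.
    by apply: near_mul; [exact: near_refl|exact: npsi].
  rewrite /near_seq /t; under eq_fun do rewrite -!extM dist_ext.
  apply: (@near_trans k o (fun n => phi n (hnn_in i1 i2 (i1 h) * hnn_t i1 i2)%g)).
    exact: phiM.
  by apply: near_sym; rewrite hnn_rel; exact: phiM.
(* The space, the embedding and the homomorphism are chosen together, since the types of the last
   two depend on the first. *)
pose good n (p : {o2 : obj F & (emb (o n) o2 * (HNN i1 i2 -> aut o2))%type}) :=
  let: existT o2 (e2, Psi) := p in
  [/\ ghom Psi,
      (osize o2 - osize (o n))%N%:R <= (osize (o1 n) - osize (o n))%N%:R + C * E n,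
      forall g, dist (ext e2 (phi n (hnn_in i1 i2 g))) (Psi (hnn_in i1 i2 g)) <=
        2 * (dist (ext (e1 n) (phi n (hnn_in i1 i2 g))) (psi n g) + C * E n) &
      dist (ext e2 (phi n (hnn_t i1 i2))) (Psi (hnn_t i1 i2)) <= C * E n].
have ex n : exists p, good n p.
  have [ o2 [e2 [psi' [t' [psi'M rel so2 npsi' nt']]]]] := corr _ _ (t n) (psiM n).
  have [Psi [PsiM Psiin Psit]] := hnn_rec psi'M rel.
  have [e3 e3E] := emb_comp (e1 n) e2.
  exists (existT _ o2 (e3, Psi)); split=> //.
  - apply: le_trans (lerD (lexx _) so2); rewrite -natrD ler_nat.
    by have := emb_size (e1 n); have := emb_size e2; lia.
  - move=> g; rewrite e3E Psiin; apply: le_trans (dist_triangle _ (ext e2 (psi n g)) _) _.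
    by rewrite dist_ext ler_pM2l // lerD2l.
  - by rewrite e3E Psit.
pose p n := projT1 (cid (ex n)).
have pP n : good n (p n) := projT2 (cid (ex n)).
pose o2 n := projT1 (p n).
pose e2 n : emb (o n) (o2 n) := (projT2 (p n)).1.
pose Psi n : HNN i1 i2 -> aut (o2 n) := (projT2 (p n)).2.
have {pP} wP n : good n (existT _ (o2 n) (e2 n, Psi n)).
  by have := pP n; rewrite /o2 /e2 /Psi; case: (p n) => ? [].
have negCE : negligible k (fun n => C * E n) by exact: negligibleZ.
exists o2, e2, Psi; split.
- apply: negligible_le (negligibleD so1 negCE) => n.
  by have [_ ? _ _] := wP n; rewrite ler0n.
- by move=> n; have [] := wP n.
have PsiM n : ghom (Psi n) by have [] := wP n.
pose nearP x := near_seq k (fun n => ext (e2 n) (phi n x)) (fun n => Psi n x).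
have phi_mul x y : near_seq k (fun n => ext (e2 n) (phi n (x * y)%g))
    (fun n => ext (e2 n) (phi n x) * ext (e2 n) (phi n y))%g.
  apply: near_sym; rewrite /near_seq; under eq_fun do rewrite -extM dist_ext.
  exact: phiM.
(* Nothing is assumed on [phi n 1], but its square is close to it, and cancelling one factor brings
   it close to 1. *)
have phi1 : near_seq k (fun n => ext (e2 n) (phi n 1%g)) (fun=> 1%g).
  have := phi_mul 1%g 1%g; rewrite /near_seq mulg1.
  congr negligible; apply/funext => n.
  set u := ext _ _; have := dist_mull u 1%g u; rewrite mulg1 => ->.
  exact: distC.
(* The elements at which [Psi] approximates [phi] are closed under products and inverses, so [G] and
   the stable letter suffice. *)
apply: (hnn_ind (P := nearP)) => [g||x y nx ny|x nx].
- apply: negligible_le (negligibleZ 2 (negligibleD (npsi g) negCE)) => n.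
  by have [_ _ + _] := wP n; rewrite dist_ge0; apply.
- apply: negligible_le negCE => n.
  by have [_ _ _ ?] := wP n; rewrite dist_ge0.
- apply: near_trans (phi_mul x y) _; rewrite /near_seq.
  by under eq_fun do rewrite PsiM; exact: near_mul.
apply: (@near_trans _ _ (fun n => (ext (e2 n) (phi n x))^-1)%g); last first.
  by rewrite /near_seq; under eq_fun do rewrite (ghomV (PsiM _)); exact: near_inv.
have := near_trans (near_sym (phi_mul x^-1%g x)) _.
rewrite mulVg => /(_ _ phi1); rewrite /near_seq.
by under eq_fun do rewrite -[X in dist _ X](mulVg (ext (e2 _) (phi _ x))) dist_mulr.
Qed.

End MetricFamilies.

(** * Permutations *)

Section EquivariantBijection.
Variables (Z : finType) (H : finGroupType).
Implicit Types (a b : H -> {perm Z}) (A B : {set Z}) (K : {set H}).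

Definition fixed_by a K y := [forall h in K, a h y == y].

Lemma fixed_byP a K y :
  reflect (forall h, h \in K -> a h y = y) (fixed_by a K y).
Proof. by apply: (iffP forall_inP) => f h hK; apply/eqP/f. Qed.

Let stab a y := [set h | a h y == y].

Let fixed_by_stab a K y : fixed_by a K y = (K \subset stab a y).
Proof.
apply/fixed_byP/fintype.subsetP => f h /f; first by rewrite inE => ->.
by rewrite inE => /eqP.
Qed.

(** Burnside: finite [H]-sets with equal numbers of fixed points are isomorphic. One orbit with a
    stabiliser of maximal size is matched and removed at a time. *)
Lemma equivariant_injection a b A B : ghom a -> ghom b ->
  (forall h y, y \in A -> a h y \in A) -> (forall h y, y \in B -> b h y \in B) ->
  (forall K, #|[set y in A | fixed_by a K y]| = #|[set y in B | fixed_by b K y]|) ->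
  exists f : Z -> Z, [/\ {in A, forall y, f y \in B}, {in A &, injective f} &
    forall h y, y \in A -> f (a h y) = b h (f y)].
Proof.
move=> aM bM; have [n] := ubnP #|A|.
elim: n => // n IH in A B *; rewrite ltnS => An aA bB marks.
have [->|[ya yaA]] := set_0Vmem A.
  by exists id; split=> [y|y ?|? y]; rewrite inE.
have aJ h h' y : a h' (a h y) = a (h * h')%g y by rewrite aM permM.
have bJ h h' y : b h' (b h y) = b (h * h')%g y by rewrite bM permM.
case: (arg_maxnP (fun y => #|stab a y|) yaA) => y0 y0_A y0max.
have y0A : y0 \in A := y0_A.
have ex_fix (c d : H -> {perm Z}) (X X' : {set Z}) x :
    #|[set y in X | fixed_by c (stab c x) y]| =
    #|[set y in X' | fixed_by d (stab c x) y]| -> x \in X ->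
    exists2 z, z \in X' & stab c x \subset stab d z.
  move=> E xX; have : (0 < #|[set y in X' | fixed_by d (stab c x) y]|)%N.
    by rewrite -E card_gt0; apply/set0Pn; exists x; rewrite inE xX fixed_by_stab /=.
  by rewrite card_gt0 => /set0Pn[z]; rewrite inE fixed_by_stab => /andP[]; exists z.
(* Equal marks give a point of [B] with a stabiliser containing that of [y0], and then a point of
   [A] with one at least as large again; maximality forces equality. *)
have [z0 z0B sub0] := ex_fix a b A B y0 (marks _) y0A.
have [y1 y1A sub1] := ex_fix b a B A z0 (esym (marks _)) z0B.
have stE : stab a y0 = stab b z0.
  apply/eqP; rewrite eqEcard sub0 /=.
  exact: leq_trans (subset_leq_card sub1) (y0max _ y1A).
have orbE h h' : (a h y0 == a h' y0) = (b h z0 == b h' z0).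
  have -> : (a h y0 == a h' y0) = (h * h'^-1 \in stab a y0)%g.
    by rewrite inE -aJ -[RHS](inj_eq (@perm_inj _ (a h'))) [a h' (a _ _)]aJ mulVg
      (ghom1 aM) perm1.
  by rewrite stE inE -bJ -[LHS](inj_eq (@perm_inj _ (b h'))) [b h' (b _ _)]bJ mulVg
    (ghom1 bM) perm1.
(* The orbit map sending a translate of [y0] to the same translate of [z0]; the default value is
   only taken off the orbit. *)
pose psi y := if [pick h | a h y0 == y] is Some h then b h z0 else z0.
have psiE h : psi (a h y0) = b h z0.
  rewrite /psi; case: pickP => [h'|/(_ h)]; last by rewrite eqxx.
  by rewrite orbE => /eqP.
pose O1 := [set a h y0 | h in [set: H]]; pose O2 := [set b h z0 | h in [set: H]].
have O1P y : y \in O1 -> exists h, y = a h y0 by case/imsetP => h _ ->; exists h.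
have O2P y : y \in O2 -> exists h, y = b h z0 by case/imsetP => h _ ->; exists h.
have inO1 h : a h y0 \in O1 by apply/imsetP; exists h; rewrite ?inE.
have inO2 h : b h z0 \in O2 by apply/imsetP; exists h; rewrite ?inE.
have O1A : O1 \subset A by apply/fintype.subsetP => y /O1P[h ->]; exact: aA.
have O2B : O2 \subset B by apply/fintype.subsetP => y /O2P[h ->]; exact: bB.
have psi_inj : {in O1 &, injective psi}.
  move=> y y' /O1P[h ->] /O1P[h' ->]; rewrite !psiE => /eqP.
  by rewrite -orbE => /eqP.
have psi_eqv h y : y \in O1 -> psi (a h y) = b h (psi y).
  by move=> /O1P[h' ->]; rewrite aJ !psiE bJ.
have O1inv h y : (a h y \in O1) = (y \in O1).
  apply/idP/idP => [/O1P[h' E]|/O1P[h' ->]]; last by rewrite aJ.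
  have -> : y = a (h' * h^-1)%g y0 by rewrite -aJ -E aJ mulgV (ghom1 aM) perm1.
  exact: inO1.
have O2inv h y : (b h y \in O2) = (y \in O2).
  apply/idP/idP => [/O2P[h' E]|/O2P[h' ->]]; last by rewrite bJ.
  have -> : y = b (h' * h^-1)%g z0 by rewrite -bJ -E bJ mulgV (ghom1 bM) perm1.
  exact: inO2.
have split_card (X O : {set Z}) (p : pred Z) : O \subset X ->
    #|[set y in X | p y]| = (#|[set y in O | p y]| + #|[set y in X :\: O | p y]|)%N.
  move=> OX; rewrite -(cardsID O); congr (_ + _)%N; apply: eq_card => y; rewrite !inE.
    by case yO: (y \in O); rewrite ?andbF ?andbT // (fintype.subsetP OX).
  by rewrite andbA.
have [||||f [fA' f_inj f_eqv]] := IH (A :\: O1) (B :\: O2).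
- apply: leq_trans An; apply: proper_card; rewrite properE subsetDl /=.
  apply/fintype.subsetPn; exists y0 => //; rewrite inE y0A andbT negbK.
  by have := inO1 1%g; rewrite (ghom1 aM) perm1.
- by move=> h y; rewrite !inE O1inv => /andP[-> /aA ->].
- by move=> h y; rewrite !inE O2inv => /andP[-> /bB ->].
- move=> K; have := marks K; rewrite (split_card _ _ _ O1A) (split_card _ _ _ O2B).
  suff -> : #|[set y in O1 | fixed_by a K y]| = #|[set y in O2 | fixed_by b K y]|.
    by move/addnI.
  have -> : [set y in O2 | fixed_by b K y] = psi @: [set y in O1 | fixed_by a K y].
    apply/setP => z; apply/idP/imsetP => [|[y + ->]].
      rewrite inE => /andP[/O2P[h ->] /fixed_byP fz].
      exists (a h y0); rewrite ?psiE // inE inO1; apply/fixed_byP => h' h'K.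
      by rewrite aJ; apply/eqP; rewrite orbE -bJ fz.
    rewrite !inE => /andP[yO /fixed_byP fy]; apply/andP; split.
      by have [h ->] := O1P _ yO; rewrite psiE.
    by apply/fixed_byP => h hK; rewrite -psi_eqv // fy.
  rewrite card_in_imset // => y y'; rewrite !inE => /andP[yO _] /andP[yO' _].
  exact: psi_inj.
exists (fun y => if y \in O1 then psi y else f y); split.
- move=> y yA; case: ifPn => [/O1P[h ->]|yO]; first by rewrite psiE bB.
  by have : f y \in B :\: O2; [apply: fA'; rewrite inE yO|rewrite inE => /andP[]].
- have psiO y : y \in O1 -> psi y \in O2 by move=> /O1P[h ->]; rewrite psiE.
  have fO y : y \in A -> y \notin O1 -> f y \notin O2.
    move=> yA yO; have : f y \in B :\: O2 by apply: fA'; rewrite inE yO.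
    by rewrite inE => /andP[].
  move=> y y' yA y'A; case: ifPn => yO; case: ifPn => y'O; first exact: psi_inj.
  + by move=> E; have := fO _ y'A y'O; rewrite -E psiO.
  + by move=> E; have := fO _ yA yO; rewrite E psiO.
  + by apply: f_inj; rewrite inE ?yO ?y'O.
- move=> h y yA; rewrite O1inv; case: ifPn => yO; first exact: psi_eqv.
  by apply: f_eqv; rewrite inE yO.
Qed.

(** The points [X] at which [t] is equivariant for every [h] form an invariant set with invariant
    image. Subtracting their marks leaves equal marks on the two complements, where [t] is replaced
    by an equivariant bijection. *)
Lemma equivariant_correction a b (t : {perm Z}) : ghom a -> ghom b ->
  (forall K, #|[set y | fixed_by a K y]| = #|[set y | fixed_by b K y]|) ->
  exists t' : {perm Z},
    (forall h, a h * t' = t' * b h)%g /\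
    (#|[pred y | t y != t' y]| <= \sum_h #|[pred y | (a h * t)%g y != (t * b h)%g y]|)%N.
Proof.
move=> aM bM marks.
have aJ h h' y : a h' (a h y) = a (h * h')%g y by rewrite aM permM.
have bJ h h' y : b h' (b h y) = b (h * h')%g y by rewrite bM permM.
have aK h y : a h^-1%g (a h y) = y by rewrite aJ mulgV (ghom1 aM) perm1.
have bK h y : b h^-1%g (b h y) = y by rewrite bJ mulgV (ghom1 bM) perm1.
pose X := [set y | [forall h, t (a h y) == b h (t y)]].
have XP y : reflect (forall h, t (a h y) = b h (t y)) (y \in X).
  by rewrite inE; apply: (iffP forallP) => E h; apply/eqP/E.
have aX h y : y \in X -> a h y \in X.
  by move=> /XP yX; apply/XP => h'; rewrite aJ !yX bJ.
have aX' h y : y \in ~: X -> a h y \in ~: X.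
  by rewrite !finset.in_setC; apply: contra => ahX; rewrite -(aK h y); exact: aX.
pose X2 := t @: X.
have bX2 h z : z \in X2 -> b h z \in X2.
  move=> /imsetP[y yX ->]; rewrite -(XP _ yX); apply/imsetP; exists (a h y) => //.
  exact: aX.
have bX2' h y : y \in ~: X2 -> b h y \in ~: X2.
  by rewrite !finset.in_setC; apply: contra => bhX; rewrite -(bK h y); exact: bX2.
have [K|f [fX f_inj f_eqv]] := equivariant_injection aM bM aX' bX2'.
  have split_card (X' : {set Z}) (p : pred Z) :
      #|[set y | p y]| = (#|[set y in X' | p y]| + #|[set y in ~: X' | p y]|)%N.
    by rewrite -(cardsID X'); congr (_ + _)%N; apply: eq_card => y; rewrite !inE andbC.
  have := marks K; rewrite (split_card X (fixed_by a K)).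
  rewrite (split_card X2 (fixed_by b K)).
  suff -> : #|[set y in X | fixed_by a K y]| = #|[set y in X2 | fixed_by b K y]|.
    by move/addnI.
  have -> : [set y in X2 | fixed_by b K y] = t @: [set y in X | fixed_by a K y].
    apply/setP => z; apply/idP/imsetP => [|[y + ->]].
      rewrite inE => /andP[/imsetP[y yX ->] /fixed_byP fz]; exists y => //.
      rewrite inE yX; apply/fixed_byP => h hK; apply: (@perm_inj _ t).
      by rewrite (XP _ yX) fz.
    rewrite inE => /andP[yX /fixed_byP fy]; rewrite inE imset_f //=.
    by apply/fixed_byP => h hK; rewrite -(XP _ yX) fy.
  by rewrite card_imset //; exact: perm_inj.
pose f' y := if y \in X then t y else f y.
have f'_inj : injective f'.
  have fX2 y : y \notin X -> f y \notin X2.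
    by move=> yX; have := fX y; rewrite !finset.in_setC; exact.
  move=> y y'; rewrite /f'; case: ifPn => yX; case: ifPn => y'X.
  - exact: perm_inj.
  - by move=> E; have := fX2 _ y'X; rewrite -E imset_f.
  - by move=> E; have := fX2 _ yX; rewrite E imset_f.
  - by apply: f_inj; rewrite finset.in_setC.
exists (perm f'_inj); split.
  move=> h; apply/permP => y; rewrite !permM !permE /f'.
  have [yX|yX] := boolP (y \in X); first by rewrite aX // (XP _ yX).
  have := aX' h y; rewrite !finset.in_setC yX => /(_ isT)/negbTE ->.
  by apply: f_eqv; rewrite finset.in_setC.
apply: (@leq_trans #|~: X|).
  apply: subset_leq_card; apply/fintype.subsetP => y.
  rewrite finset.in_setC inE permE /f'; case: ifP => //.
  by rewrite eqxx.
have -> : ~: X = \bigcup_h [set y | (a h * t)%g y != (t * b h)%g y].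
  apply/setP => y; rewrite finset.in_setC inE; apply/idP/bigcupP => [/forallPn[h]|[h _]].
    by exists h => //; rewrite inE !permM.
  by rewrite inE !permM => ?; apply/forallPn; exists h.
elim/big_rec2: _ => [|h m U _ IH]; first by rewrite cards0.
apply: leq_trans (leq_card_setU _ _) _; rewrite leq_add // cardsE.
exact: leqnn.
Qed.

End EquivariantBijection.

(** * Types of points in a permutation action *)

Section PermutationTypes.
Variables (G : groupType) (H : finGroupType) (i1 i2 : H -> G) (S : seq G).
Hypotheses (SJ : forall s g, s \in S -> (s ^ g)%g \in S).
Hypotheses (i1S : forall h, i1 h \in S) (i2S : forall h, i2 h \in S).

Let T := seq_sub S.
Let sconj (g : G) (s : T) : T := SeqSub (SJ g (valP s)).
Let conj_set (g : G) (A : {set T}) : {set T} := [set s | sconj g^-1%g s \in A].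
Let type_class (A : {set T}) : pred {set T} := fun B => `[< exists g, B = conj_set g A >].
(** [pick] returns the same set for all members of a conjugacy class of subsets, because they define
    the same predicate; the default is never taken, since [A] lies in its own class. *)
Let type_repr (A : {set T}) : {set T} := odflt A [pick B | type_class A B].

Let conj_setM g h A : conj_set h (conj_set g A) = conj_set (g * h)%g A.
Proof.
apply/setP => s; rewrite !inE; congr (_ \in A); apply: val_inj => /=.
by rewrite -conjgM invgM.
Qed.

Let conj_set1 A : conj_set 1%g A = A.
Proof.
by apply/setP => s; rewrite inE; congr (_ \in A); apply: val_inj; rewrite /= invg1 conjg1.
Qed.

Let conj_setT g : conj_set g finset.setT = finset.setT.
Proof. by apply/setP => s; rewrite !inE. Qed.

Let type_reprP A : exists g, type_repr A = conj_set g A.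
Proof.
rewrite /type_repr; case: pickP => [B /asboolP //|/(_ A)/negP[]].
by apply/asboolP; exists 1%g; rewrite conj_set1.
Qed.

Let type_reprJ g A : type_repr (conj_set g A) = type_repr A.
Proof.
rewrite /type_repr (_ : type_class (conj_set g A) = type_class A).
  case: pickP => // /(_ A)/negP[].
  by apply/asboolP; exists 1%g; rewrite conj_set1.
apply/funext => B; apply/asboolP/asboolP => -[h ->].
  by exists (g * h)%g; rewrite conj_setM.
by exists (g^-1 * h)%g; rewrite conj_setM mulgA mulgV mul1g.
Qed.

Let type_repr_id A : type_repr (type_repr A) = type_repr A.
Proof. by have [g {1}->] := type_reprP A; exact: type_reprJ. Qed.

Let type_repr_eqT A : (type_repr A == finset.setT) = (A == finset.setT).
Proof.
apply/eqP/eqP => [|->]; last by have [g ->] := type_reprP finset.setT.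
have [g ->] := type_reprP A => E.
by rewrite -(conj_set1 A) -(mulgV g) -conj_setM E conj_setT.
Qed.

Section Action.
Variables (Y : finType) (psi : G -> {perm Y}).
Hypothesis psiM : ghom psi.

Definition fix_type y : {set T} := [set s | psi (val s) y == y].

Let fix_type_act g y : fix_type (psi g y) = conj_set g (fix_type y).
Proof.
apply/setP => s; rewrite !inE /= -[LHS](inj_eq (@perm_inj _ (psi g^-1%g))).
by rewrite -!permM -!psiM mulgV (ghom1 psiM) perm1 conjgE invgK mulgA.
Qed.

Definition fix_count (B : {set T}) := #|[set y | fix_type y == B]|.

Let fix_count_conj g B : fix_count (conj_set g B) = fix_count B.
Proof.
rewrite /fix_count -[RHS](card_imset _ (@perm_inj _ (psi g))); apply: eq_card => y.
rewrite inE; apply/eqP/imsetP => [E|[x]]; last first.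
  by rewrite inE => /eqP <- ->; rewrite fix_type_act.
exists (psi g^-1%g y); last by rewrite -permM -psiM mulVg (ghom1 psiM) perm1.
by rewrite inE fix_type_act E conj_setM mulgV conj_set1.
Qed.

(** Weights sit on the chosen representatives, and [fix_count] counts one member of the class only:
    all members occur equally often. The full set is the trivial type. *)
Definition fix_weight (B : {set T}) :=
  if (B != finset.setT) && (type_repr B == B) then fix_count B else 0%N.

Let fix_countE B : B != finset.setT -> fix_count B = fix_weight (type_repr B).
Proof.
move=> BT; rewrite /fix_weight type_repr_eqT BT type_repr_id eqxx /=.
by have [g ->] := type_reprP B; rewrite fix_count_conj.
Qed.

Definition sub_type (i : H -> G) (K : {set H}) (B : {set T}) :=
  [forall h in K, [exists s in B, val s == i h]].

(** Counts the members of the class of [B] containing the image of [K] under [i1], minus those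
    containing its image under [i2]; this is the effect on the marks of one point for each member of
    the class. *)
Definition mark_slope (K : {set H}) (B : {set T}) : int :=
  #|[set A | (type_repr A == B) && sub_type i1 K A]|%:Z -
  #|[set A | (type_repr A == B) && sub_type i2 K A]|%:Z.

Let sub_typeE i K y : (forall h, i h \in S) ->
  sub_type i K (fix_type y) = fixed_by (psi \o i) K y.
Proof.
move=> iS; apply/forall_inP/fixed_byP => E h hK.
  by have /existsP[s] := E h hK; rewrite inE => /andP[/eqP + /eqP] /= => + <-.
by apply/existsP; exists (SeqSub (iS h)); rewrite inE /= eqxx andbT; apply/eqP/E.
Qed.

Let sub_typeT i K : (forall h, i h \in S) -> sub_type i K finset.setT.
Proof.
move=> iS; apply/forall_inP => h _; apply/existsP; exists (SeqSub (iS h)).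
by rewrite inE eqxx.
Qed.

(** Double counting: the classes partition the subsets, and [fix_count] is constant on each
    class. *)
Let sum_weight (p : pred {set T}) :
  (\sum_B fix_weight B * #|[set A | (type_repr A == B) && p A]| =
  \sum_(A | p A && (A != finset.setT)) fix_count A)%N.
Proof.
under eq_bigr do rewrite -sum1_card big_distrr /=.
rewrite (exchange_big_dep p) /=; last by move=> B A _; rewrite inE => /andP[].
rewrite (eq_bigr (fun A => fix_weight (type_repr A))); last first.
  move=> A pA; rewrite (big_pred1 (type_repr A)) ?muln1 //.
  by move=> B /=; rewrite inE pA andbT eq_sym.
rewrite (bigID (fun A => A != finset.setT)) /= [X in (_ + X)%N]big1 ?addn0; last first.
  by move=> A /andP[_]; rewrite negbK => /eqP ->; rewrite /fix_weight type_repr_eqT eqxx.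
by apply: eq_bigr => A /andP[_ AT]; rewrite fix_countE.
Qed.

Let sum_fix_count (p : pred {set T}) :
  (\sum_(A | p A) fix_count A = #|[set y | p (fix_type y)]|)%N.
Proof.
under eq_bigr do rewrite /fix_count -sum1_card.
rewrite (exchange_big_dep predT) //= -sum1_card big_mkcond [RHS]big_mkcond /=.
apply: eq_bigr => y _; rewrite inE; under eq_bigl do rewrite inE.
case: ifP => py.
  rewrite (big_pred1 (fix_type y)) // => A /=; rewrite eq_sym.
  by case: eqP => [->|]; rewrite ?py ?andbF.
by rewrite big_pred0 // => A; case: eqP => [<-|]; rewrite ?py ?andbF.
Qed.

(** A point is fixed by the image of [K] exactly when its type contains that image; points of
    trivial type count on both sides and cancel. *)
Lemma functional_mark (K : {set H}) : functional (mark_slope K) fix_weight =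
  #|[set y | fixed_by (psi \o i1) K y]|%:Z - #|[set y | fixed_by (psi \o i2) K y]|%:Z.
Proof.
rewrite /functional; under eq_bigr do rewrite mulrBr -!PoszM.
rewrite big_split /= sumrN -!(big_morph Posz PoszD (erefl _)) !sum_weight.
have E i : (forall h, i h \in S) -> #|[set y | fixed_by (psi \o i) K y]| =
    (\sum_(A | sub_type i K A && (A != finset.setT)) fix_count A + fix_count finset.setT)%N.
  move=> iS; rewrite (_ : [set y | _] = [set y | sub_type i K (fix_type y)]).
    by rewrite -sum_fix_count (bigD1 finset.setT) ?sub_typeT //= addnC.
  by apply/setP => y; rewrite !inE sub_typeE.
by rewrite !E // !PoszD; ring.
Qed.

(** The factor bounds the number of members of a class, as the weight counts only one of them. *)
Lemma card_type_notin (J : {set {set T}}) :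
  (#|[set y | (type_repr (fix_type y) \notin J) && (fix_type y != finset.setT)]| <=
   #|{set T}| * \sum_(B | B \notin J) fix_weight B)%N.
Proof.
rewrite -(sum_fix_count (fun A => (type_repr A \notin J) && (A != finset.setT))).
rewrite -(sum_weight (fun A => type_repr A \notin J)) big_distrr /=.
rewrite (bigID (mem J)) /= big1 ?add0n; last first.
  move=> B BJ; rewrite (_ : [set A | _] = finset.set0) ?cards0 ?muln0 //.
  by apply/setP => A; rewrite !inE; apply/negP => /andP[/eqP ->]; rewrite BJ.
by apply: leq_sum => B _; rewrite mulnC leq_mul2r max_card orbT.
Qed.

Variable J : {set {set T}}.

(* Points fixed by all of [S] have slope [0], so they need not be discarded. *)
Definition kept y := (type_repr (fix_type y) \in J) || (fix_type y == finset.setT).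

Let kept_act g y : kept (psi g y) = kept y.
Proof.
rewrite /kept fix_type_act type_reprJ; congr (_ || _).
rewrite -[LHS]type_repr_eqT type_reprJ; exact: type_repr_eqT.
Qed.

Let restr_inj g : injective (fun y => if kept y then psi g y else y).
Proof.
move=> y y'; case: ifPn => ky; case: ifPn => ky' E.
- exact: perm_inj E.
- by rewrite -E kept_act ky in ky'.
- by rewrite E kept_act ky' in ky.
- by [].
Qed.

Definition restr_act g : {perm Y} := perm (@restr_inj g).

Lemma restr_actE g y : restr_act g y = if kept y then psi g y else y.
Proof. by rewrite permE. Qed.

Lemma restr_actM : ghom restr_act.
Proof.
move=> g h; apply/permP => y; rewrite permM !restr_actE.
by have [ky|ky] := boolP (kept y); rewrite ?kept_act ?ky ?psiM ?permM // (negbTE ky).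
Qed.

End Action.

Lemma fix_type_restr (Y : finType) (psi : G -> {perm Y}) (psiM : ghom psi) J y :
  fix_type (restr_act psiM J) y = if kept psi J y then fix_type psi y else finset.setT.
Proof.
case: ifPn => ky; apply/setP => s; rewrite !inE restr_actE ?ky //.
by rewrite (negbTE ky) eqxx.
Qed.

(** A discarded point acquires the trivial type, which has no weight, while a kept point retains its
    type. *)
Lemma fix_weight_restr (Y : finType) (psi : G -> {perm Y}) (psiM : ghom psi) J B :
  fix_weight (restr_act psiM J) B = ((B \in J) * fix_weight psi B)%N.
Proof.
rewrite /fix_weight; case: ifP => [/andP[BT /eqP BB]|_]; last by rewrite muln0.
rewrite /fix_count; have [BJ|BJ] := boolP (B \in J).
  rewrite mul1n; apply: eq_card => y; rewrite !inE fix_type_restr /kept.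
  case: ifP => // /negbT; rewrite negb_or => /andP[nJ nT].
  rewrite eq_sym (negbTE BT); apply/esym/negbTE/eqP => E.
  by rewrite E BB BJ in nJ.
apply/eqP; rewrite mul0n cards_eq0; apply/eqP/setP => y; rewrite !inE fix_type_restr /kept.
apply/negbTE/eqP; case: ifP => [/orP[yJ|/eqP ->]|_] E.
- by rewrite -E in BB BJ; rewrite BB in yJ; rewrite yJ in BJ.
- by rewrite E eqxx in BT.
- by rewrite E eqxx in BT.
Qed.

Section Sum.
Variables (Y Y' : finType) (psi : G -> {perm Y}) (psi' : G -> {perm Y'}).

Definition sum_fun (s : {perm Y}) (s' : {perm Y'}) (y : Y + Y') : Y + Y' :=
  match y with inl y => inl (s y) | inr y => inr (s' y) end.

Let sum_inj s s' : injective (sum_fun s s').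
Proof. by move=> [y|y] [z|z] //= [/perm_inj ->]. Qed.

Definition sum_perm s s' := perm (@sum_inj s s').

Lemma sum_permE s s' y : sum_perm s s' y = sum_fun s s' y.
Proof. exact: permE. Qed.

Lemma sum_permM s s' u u' : (sum_perm (s * u) (s' * u') = sum_perm s s' * sum_perm u u')%g.
Proof. by apply/permP => -[y|y]; rewrite permM !sum_permE /= permM. Qed.

Lemma card_sum_pred (p : pred (Y + Y')) :
  #|[set y | p y]| = (#|[set y | p (inl y)]| + #|[set y | p (inr y)]|)%N.
Proof.
rewrite -!sum1_card big_mkcond big_sumType /= -!big_mkcond /=.
by congr (_ + _)%N; apply: eq_bigl => y; rewrite !inE.
Qed.

End Sum.

End PermutationTypes.

(** * Symmetric groups as a metric family *)

Section PermutationFamily.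

Section PermDist.
Variable Y : finType.
Implicit Types s t u : {perm Y}.

Definition perm_dist s t := #|[set y | s y != t y]|.

Lemma perm_dist_triangle t s u : (perm_dist s u <= perm_dist s t + perm_dist t u)%N.
Proof.
apply: leq_trans (leq_card_setU _ _).
apply: subset_leq_card; apply/fintype.subsetP => y; rewrite !inE.
by case: (eqVneq (s y) (t y)) => [->|].
Qed.

Lemma perm_distC s t : perm_dist s t = perm_dist t s.
Proof. by apply: eq_card => y; rewrite !inE eq_sym. Qed.

Lemma perm_distss s : perm_dist s s = 0%N.
Proof. by apply: eq_card0 => y; rewrite !inE eqxx. Qed.

Lemma perm_dist_mull u s t : perm_dist (u * s)%g (u * t)%g = perm_dist s t.
Proof.
rewrite /perm_dist -[LHS](card_imset _ (@perm_inj _ u)).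
apply: eq_card => y; rewrite [RHS]inE; apply/imsetP/idP => [[z + ->]|E].
  by rewrite !inE !permM.
by exists (u^-1 y)%g; rewrite ?inE ?permM permKV.
Qed.

Lemma perm_dist_mulr u s t : perm_dist (s * u)%g (t * u)%g = perm_dist s t.
Proof. by apply: eq_card => y; rewrite !inE !permM (inj_eq perm_inj). Qed.

Lemma perm_distV s t : perm_dist s^-1%g t^-1%g = perm_dist s t.
Proof.
by rewrite -(perm_dist_mull s) mulgV -(perm_dist_mulr t) mul1g mulgVK perm_distC.
Qed.

End PermDist.

Section PermExt.
Variables (X Y : finType) (j : X -> Y).
Hypothesis j_inj : injective j.

Definition ext_fun (s : {perm X}) (y : Y) : Y :=
  if [pick x | j x == y] is Some x then j (s x) else y.

Lemma ext_fun_in s x : ext_fun s (j x) = j (s x).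
Proof.
rewrite /ext_fun; case: pickP => [z /eqP/j_inj -> //|/(_ x)].
by rewrite eqxx.
Qed.

Lemma ext_fun_out s y : (forall x, j x != y) -> ext_fun s y = y.
Proof. by move=> yj; rewrite /ext_fun; case: pickP => // x; rewrite (negbTE (yj x)). Qed.

Lemma ext_case y : (exists x, y = j x) \/ (forall x, j x != y).
Proof.
have [/existsP[x /eqP <-]|/existsPn] := boolP [exists x, j x == y]; last by right.
by left; exists x.
Qed.

Lemma ext_fun_inj s : injective (ext_fun s).
Proof.
have E x y : (forall x, j x != y) -> j (s x) = y -> False.
  by move=> yj E; move: (yj (s x)); rewrite E eqxx.
move=> y z; have [[x ->]|yj] := ext_case y; have [[x' ->]|zj] := ext_case z.
- by rewrite !ext_fun_in => /j_inj/perm_inj ->.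
- by rewrite ext_fun_in ext_fun_out // => /E.
- by rewrite ext_fun_in (ext_fun_out _ yj) => /esym/E.
- by rewrite !ext_fun_out.
Qed.

Definition ext_perm s := perm (@ext_fun_inj s).

Lemma ext_perm_in s x : ext_perm s (j x) = j (s x).
Proof. by rewrite permE ext_fun_in. Qed.

Lemma ext_perm_out s y : (forall x, j x != y) -> ext_perm s y = y.
Proof. by rewrite permE; exact: ext_fun_out. Qed.

Lemma ext_permM : ghom ext_perm.
Proof.
move=> s t; apply/permP => y; rewrite permM.
have [[x ->]|yj] := ext_case y; first by rewrite !ext_perm_in permM.
by rewrite !ext_perm_out.
Qed.

Lemma ext_perm_dist s t : perm_dist (ext_perm s) (ext_perm t) = perm_dist s t.
Proof.
rewrite /perm_dist -[RHS](card_imset _ j_inj).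
apply: eq_card => y; apply/idP/imsetP => [|[x + ->]]; last first.
  by rewrite !inE !ext_perm_in (inj_eq j_inj).
rewrite inE; have [[x ->]|yj] := ext_case y; last by rewrite /= !ext_perm_out // eqxx.
by rewrite /= !ext_perm_in (inj_eq j_inj) => E; exists x; rewrite ?inE.
Qed.

End PermExt.

Variable R : realType.

Lemma ext_perm_comp (X Y Z : finType) (j : {j : X -> Y | injective j})
    (j' : {j' : Y -> Z | injective j'}) :
  exists j2 : {j2 : X -> Z | injective j2},
    forall s, ext_perm (svalP j2) s = ext_perm (svalP j') (ext_perm (svalP j) s).
Proof.
pose J : {j2 : X -> Z | injective j2} := exist _ _ (inj_comp (svalP j') (svalP j)).
exists J => s; apply/permP => z.
have [[y ->]|zj'] := ext_case (sval j') z; last first.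
  by rewrite !ext_perm_out // => x; exact: zj'.
rewrite ext_perm_in; have [[x ->]|yj] := ext_case (sval j) y.
  rewrite ext_perm_in.
  exact: (ext_perm_in (svalP J) s x).
rewrite (ext_perm_out _ _ yj) ext_perm_out // => x.
by rewrite /= (inj_eq (svalP j')).
Qed.

Program Definition perm_family : metric_family R := @MetricFamily R finType
  (fun X => {perm X} : groupType) (fun X => #|X|)
  (fun X s t => (perm_dist s t)%:R)
  (fun X Y => {j : X -> Y | injective j})
  (fun X Y j => ext_perm (svalP j)) _ _ _ _ _ _ _ _ _ _.
Next Obligation. by move=> *; exact: ler0n. Qed.
Next Obligation. by move=> Y s; rewrite /= perm_distss. Qed.
Next Obligation. by move=> Y s t; rewrite /= perm_distC. Qed.
Next Obligation.
move=> Y s t u; rewrite /= -natrD -natrM ler_nat mul2n -addnn.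
exact: leq_trans (perm_dist_triangle t s u) (leq_addr _ _).
Qed.
Next Obligation. by move=> Y u s t; rewrite /= perm_dist_mull. Qed.
Next Obligation. by move=> Y u s t; rewrite /= perm_dist_mulr. Qed.
Next Obligation. by move=> X Y j; exact: ext_permM. Qed.
Next Obligation. by move=> X Y j s t; rewrite /= ext_perm_dist. Qed.
Next Obligation. by move=> X Y j; exact: leq_card (svalP j). Qed.
Next Obligation. exact: ext_perm_comp. Qed.

Variables (G : groupType) (H : finGroupType) (i1 i2 : H -> G) (S : seq G).
Hypotheses (SJ : forall s g, s \in S -> (s ^ g)%g \in S).

Let actual_weight (w : {set seq_sub S} -> nat) (d : nat) :=
  exists (Y : finType) (psi : G -> {perm Y}),
    [/\ ghom psi, #|Y| = d & w = fix_weight SJ psi].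

(** Weights of actual actions contain 0 by the empty action, are closed under addition by disjoint
    unions, and can be cut down to one type by making all other points trivial. *)
Lemma fix_weight_correction : exists C : nat,
  forall (Y : finType) (psi : G -> {perm Y}) (psiM : ghom psi),
  exists (J : {set {set seq_sub S}}) (Y' : finType) (psi' : G -> {perm Y'}),
    let D := (\sum_K `|functional (mark_slope i1 i2 SJ K) (fix_weight SJ psi)|)%N in
    [/\ ghom psi', (\sum_(B | B \notin J) fix_weight SJ psi B <= C * D)%N,
        (#|Y'| <= C * D)%N &
        forall K, functional (mark_slope i1 i2 SJ K) (fix_weight SJ (restr_act SJ psiM J)) +
                  functional (mark_slope i1 i2 SJ K) (fix_weight SJ psi') = 0].
Proof.
have [|||C CP] := @weight_correction _ _ (mark_slope i1 i2 SJ) actual_weight.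
- exists void, (fun=> 1%g); split; [by move=> *; rewrite mulg1|exact: card_void|].
  apply/funext => B; rewrite /fix_weight; case: ifP => // _.
  by apply/esym/eqP; rewrite cards_eq0; apply/eqP/setP => -[].
- move=> w w' d d' [Y [psi [psiM <- ->]]] [Y' [psi' [psi'M <- ->]]].
  exists (Y + Y')%type, (fun g => sum_perm (psi g) (psi' g)); split.
  + by move=> g h; rewrite psiM psi'M sum_permM.
  + by rewrite card_sum.
  apply/funext => B; rewrite /fix_weight; case: ifP => // _.
  rewrite /fix_count card_sum_pred; congr (_ + _)%N; apply: eq_card => y; rewrite !inE;
    congr (_ == _); apply/setP => s; rewrite !inE sum_permE /=; by apply/eqP/eqP => [->|[]].
- move=> w d B0 [Y [psi [psiM _ ->]]].
  exists #|Y|, Y, (restr_act SJ psiM [set B0]); split=> //; first exact: restr_actM.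
  by apply/funext => B; rewrite fix_weight_restr inE.
exists C => Y psi psiM.
have [|J [w' [d' [[Y' [psi' [psi'M <- ->]]] JC dC E]]]] := CP (fix_weight SJ psi) #|Y|.
  by exists Y, psi.
exists J, Y', psi'; split=> // K; rewrite -[RHS](E K); congr (functional _ _ + _).
by apply/funext => B; rewrite fix_weight_restr.
Qed.

End PermutationFamily.

(** * Correction of permutation actions *)

Section PermutationStability.
Variable R : realType.

Section Correctable.
Variables (G : groupType) (H : finGroupType) (i1 i2 : H -> G) (S : seq G).
Hypotheses (i1M : ghom i1) (i2M : ghom i2).
Hypotheses (SJ : forall s g, s \in S -> (s ^ g)%g \in S).
Hypotheses (i1S : forall h, i1 h \in S) (i2S : forall h, i2 h \in S).

Let hdist (Y : finType) (psi : G -> {perm Y}) (t : {perm Y}) :=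
  (\sum_h perm_dist (psi (i1 h) * t) (t * psi (i2 h)))%g%N.

(** Off the set [X] where some relation fails, [t] matches the points fixed through [i1] with those
    fixed through [i2]. *)
Lemma mark_diff_le (Y : finType) (psi : G -> {perm Y}) (t : {perm Y}) K :
  (`|#|[set y | fixed_by (psi \o i1) K y]|%:Z -
     #|[set y | fixed_by (psi \o i2) K y]|%:Z| <= hdist psi t)%N.
Proof.
pose X := [set y | [exists h, (psi (i1 h) * t)%g y != (t * psi (i2 h))%g y]].
have XE : (#|X| <= hdist psi t)%N.
  have -> : X = \bigcup_h [set y | (psi (i1 h) * t)%g y != (t * psi (i2 h))%g y].
    apply/setP => y; rewrite inE; apply/existsP/bigcupP => -[h].
      by exists h => //; rewrite inE.
    by rewrite inE; exists h.
  rewrite /hdist; elim/big_rec2: _ => [|h m U _ IH]; first by rewrite cards0.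
  by apply: leq_trans (leq_card_setU _ _) _; rewrite leq_add.
pose F1 := [set y | fixed_by (psi \o i1) K y].
pose F2 := t @^-1: [set y | fixed_by (psi \o i2) K y].
have good y : y \notin X -> forall h, t (psi (i1 h) y) = psi (i2 h) (t y).
  by rewrite inE => /existsPn E h; have := E h; rewrite negbK !permM => /eqP.
have F12 : F1 \subset F2 :|: X.
  apply/fintype.subsetP => y; rewrite finset.in_setU orbC.
  have [//|/good yX] := boolP (y \in X); rewrite !inE => /fixed_byP f1.
  by apply/fixed_byP => h hK; rewrite /= -yX; congr (t _); exact: f1.
have F21 : F2 \subset F1 :|: X.
  apply/fintype.subsetP => y; rewrite finset.in_setU orbC.
  have [//|/good yX] := boolP (y \in X); rewrite !inE => /fixed_byP f2.
  apply/fixed_byP => h hK; apply: (@perm_inj _ t); rewrite /= yX; exact: f2.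
have F2E : #|F2| = #|[set y | fixed_by (psi \o i2) K y]|.
  by rewrite /F2 card_preimset //; exact: perm_inj.
have := leq_trans (subset_leq_card F12) (leq_card_setU _ _).
have := leq_trans (subset_leq_card F21) (leq_card_setU _ _).
by move: XE; rewrite F2E -/F1; lia.
Qed.

Lemma fixed_by_restr (Y : finType) (psi : G -> {perm Y}) (psiM : ghom psi) J
    (Y' : finType) (psi' : G -> {perm Y'}) (i : H -> G) K :
  let Psi g := sum_perm (restr_act SJ psiM J g) (psi' g) in
  #|[set y | fixed_by (Psi \o i) K y]| =
  (#|[set y | fixed_by (restr_act SJ psiM J \o i) K y]| +
   #|[set y | fixed_by (psi' \o i) K y]|)%N.
Proof.
move=> Psi; rewrite card_sum_pred; congr (_ + _)%N; apply: eq_card => y; rewrite !inE;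
  apply/fixed_byP/fixed_byP => f h hK; have := f h hK; rewrite /= sum_permE /=.
- by case.
- by move=> ->.
- by case.
- by move=> ->.
Qed.

Lemma perm_hnn_correctable : hnn_correctable (perm_family R) i1 i2.
Proof.
have [C HC] := fix_weight_correction i1 i2 SJ.
(* Per unit of the error, [a] bounds the added points, each of the marks contributing a defect of at
   most one unit, and [b] the discarded ones. In [c], each [h] brings [2 * b + a] new failures of
   equivariance; the last [b + a] is the displacement of [psi]. *)
pose a := (C * #|{set H}|)%N; pose b := (#|{set seq_sub S}| * a)%N.
pose c := (1 + #|H| * (2 * b + a) + b + a)%N.
exists c%:R; first exact: ler0n.
move=> Y psi t psiM; have psi_hom : ghom (psi : G -> {perm Y}) := psiM.
have [J [Y' [rho [rhoM JC Y'C marks]]]] := HC Y psi psi_hom.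
pose En := hdist psi t.
set D := (\sum_K _)%N in JC Y'C.
have DE : (D <= #|{set H}| * En)%N.
  rewrite /D -sum_nat_const; apply: leq_sum => K _.
  rewrite (functional_mark SJ i1S i2S psi_hom); exact: mark_diff_le.
have {}Y'C : (#|Y'| <= a * En)%N.
  by apply: leq_trans Y'C _; rewrite /a -mulnA leq_mul2l DE orbT.
pose psiJ := restr_act SJ psi_hom J.
pose bad := [set y | ~~ kept SJ psi J y].
have badE : (#|bad| <= b * En)%N.
  have -> : bad = [set y | ~~ kept SJ psi J y] by [].
  under eq_finset do rewrite /kept negb_or.
  apply: leq_trans (card_type_notin SJ psi_hom J) _; rewrite -mulnA leq_mul2l.
  by rewrite (leq_trans JC) ?orbT // /a -mulnA leq_mul2l DE orbT.
pose Psi g := sum_perm (psiJ g) (rho g).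
have PsiM : ghom Psi by move=> g h; rewrite /Psi /psiJ restr_actM rhoM sum_permM.
pose tt := sum_perm t (1%g : {perm Y'}).
have [||K|t' [t'rel t'E]] := @equivariant_correction _ H (Psi \o i1) (Psi \o i2) tt.
- by move=> x y; rewrite /= i1M PsiM.
- by move=> x y; rewrite /= i2M PsiM.
- rewrite !fixed_by_restr; apply/eqP; rewrite -eqz_nat !PoszD.
  have := marks K; rewrite (functional_mark SJ i1S i2S (@restr_actM _ _ SJ _ _ psi_hom J)).
  by rewrite (functional_mark SJ i1S i2S rhoM); lia.
have inl_inj : injective (@inl Y Y') by move=> x y [].
pose j : {j : Y -> Y + Y' | injective j} := exist _ _ inl_inj.
have extE (s : {perm Y}) : ext_perm (svalP j) s = sum_perm s (1%g : {perm Y'}).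
  apply/permP => -[y|y]; rewrite sum_permE /=; first exact: (ext_perm_in (svalP j)).
  by rewrite ext_perm_out // perm1.
have EnE : \sum_(h : H) ((perm_dist (psi (i1 h) * t) (t * psi (i2 h)))%g%:R : R) = En%:R.
  by rewrite natr_sum.
exists ((Y + Y')%type : finType), j, Psi, t'; rewrite /= EnE; split=> //.
- rewrite -natrM ler_nat card_sum addKn; apply: leq_trans Y'C _.
  by rewrite leq_mul2r /c; lia.
- move=> g; rewrite -natrM ler_nat extE.
  apply: (@leq_trans (#|bad| + #|Y'|)%N); last first.
    by apply: leq_trans (leq_add badE Y'C) _; rewrite -mulnDl leq_mul2r /c; lia.
  rewrite /perm_dist card_sum_pred leq_add ?max_card //.
  apply: subset_leq_card; apply/fintype.subsetP => y; rewrite !inE !sum_permE /= restr_actE.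
  by apply: contra => ->.
rewrite -natrM ler_nat extE /perm_dist cardsE; apply: leq_trans t'E _.
have -> : c = (1 + #|H| * (2 * b + a) + (b + a))%N by rewrite /c addnA.
rewrite mulnDl; apply: leq_trans (leq_addr _ _).
rewrite mulnDl mul1n /En /hdist -mulnA -sum_nat_const -big_split /=.
apply: leq_sum => h _; rewrite -/(hdist psi t) -/En.
rewrite -(cardsE [pred y | _]) card_sum_pred mulnDl addnA; apply: leq_add; last first.
  by apply: leq_trans Y'C; exact: max_card.
rewrite -mulnA mul2n -addnn.
apply: leq_trans (_ : _ <= perm_dist (psi (i1 h) * t)%g (t * psi (i2 h))%g +
  (#|bad| + #|t @^-1: bad|))%N _; last first.
  rewrite leq_add2l leq_add // card_preimset //; exact: perm_inj.
(* On [Y] a relation can only fail after the change if it failed before, or if [y] or [t y] was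
   discarded. *)
apply: leq_trans (_ : _ <= #|[set y | (psi (i1 h) * t)%g y != (t * psi (i2 h))%g y] :|:
  (bad :|: t @^-1: bad)|)%N _; last first.
  by apply: leq_trans (leq_card_setU _ _) _; rewrite leq_add2l leq_card_setU.
apply: subset_leq_card; apply/fintype.subsetP => y.
rewrite !inE !permM /tt /Psi !sum_permE /= /psiJ !restr_actE.
by case: (kept SJ psi J y) => //=; case: (kept SJ psi J (t y)); rewrite ?orbT ?orbF.
Qed.

End Correctable.

(** The second term counts the points outside the image of [j], where nothing is known about [u]. *)
Lemma ext_perm_dist_le (X Y : finType) (j : X -> Y) (j_inj : injective j)
    (s : {perm X}) (u : {perm Y}) :
  (perm_dist (ext_perm j_inj s) u <=
    #|[pred x | (j \o s) x != (u \o j) x]| + (#|Y| - #|X|))%N.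
Proof.
have -> : (#|Y| - #|X|)%N = #|~: (j @: [set: X])|.
  by rewrite -(cardsC (j @: [set: X])) card_imset // cardsT addKn.
rewrite -(cardsE [pred x | _]) -(card_imset _ j_inj); apply: leq_trans (leq_card_setU _ _).
apply: subset_leq_card; apply/fintype.subsetP => y; rewrite inE finset.in_setU.
have [[x ->]|yj _] := ext_case j y.
  rewrite ext_perm_in => E; apply/orP; left; apply/imsetP; exists x => //.
  by rewrite !inE.
apply/orP; right; rewrite finset.in_setC; apply/imsetP => -[x _ E].
by move: (yj x); rewrite E eqxx.
Qed.

Lemma le_ext_perm_dist (X Y : finType) (j : X -> Y) (j_inj : injective j)
    (s : {perm X}) (u : {perm Y}) :
  (#|[pred x | (j \o s) x != (u \o j) x]| <= perm_dist (ext_perm j_inj s) u)%N.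
Proof.
rewrite -(cardsE [pred x | _]) -(card_imset _ j_inj); apply: subset_leq_card.
by apply/fintype.subsetP => y /imsetP[x + ->]; rewrite !inE ext_perm_in.
Qed.

(** The product of permutations and the composition of functions have opposite orders; passing to
    inverses exchanges the two and preserves distances. *)
Lemma flexibly_P_stableE (G : groupType) :
  flexibly_P_stable R G <-> family_stable (perm_family R) G.
Proof.
have hamE (X : finType) (s u t : {perm X}) :
    hamming R (s \o u) t = (perm_dist (s^-1 * u^-1) t^-1)%g%:R / #|X|%:R.
  rewrite -invgM perm_distV /perm_dist /hamming cardsE; congr (_%:R / _).
  apply: eq_card => x; rewrite !inE; congr (_ != _).
  exact/esym/permM.
split=> st.
- move=> X phi X0 phiM.
  have [||Y [j [psi [j_inj YX psiM npsi]]]] := st X (fun n g => (phi n g)^-1%g).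
  + exact: X0.
  + by move=> g h; under eq_fun do rewrite hamE !invgK; exact: phiM.
  exists Y, (fun n => exist _ _ (j_inj n)), (fun n g => (psi n g)^-1%g); split.
  + apply/(@ratio_negligible R (fun n => #|X n|) (fun n => #|Y n|)) => // n.
    exact: leq_card (j_inj n).
  + move=> n g h; rewrite -invgM; congr (_^-1)%g; apply/permP => y.
    by rewrite psiM; exact/esym/permM.
  move=> g; pose J n : {j : X n -> Y n | injective j} := exist _ _ (j_inj n).
  have YX' : negligible (fun n => #|X n|) (fun n => (#|Y n| - #|X n|)%N%:R : R).
    apply/(@ratio_negligible R (fun n => #|X n|) (fun n => #|Y n|)) => // n.
    exact: leq_card (j_inj n).
  have c : negligible (fun n => #|X n|)
      (fun n => #|[pred x | (j n \o (phi n g)^-1%g) x != (psi n g \o j n) x]|%:R : R).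
    exact: npsi.
  apply: negligible_le (negligibleD c YX') => n; rewrite dist_ge0 /= -natrD ler_nat.
  rewrite -perm_distV invgK -(ghomV (ext_permM (svalP (J n)))).
  exact: (ext_perm_dist_le (svalP (J n))).
move=> X phi X0 phiM.
have [||Y [j [psi [YX psiM npsi]]]] := st X (fun n g => (phi n g)^-1%g).
- exact: X0.
- move=> g h; have := phiM g h.
  by under eq_fun do rewrite hamE; exact.
exists Y, (fun n => sval (j n)), (fun n g => (psi n g)^-1%g); split.
- by move=> n; exact: svalP (j n).
- apply/(@ratio_negligible R (fun n => #|X n|) (fun n => #|Y n|)) => // n.
  exact: leq_card (svalP (j n)).
- by move=> n g h y; rewrite psiM invgM; exact: permM.
move=> g; apply: negligible_le (npsi g) => n; rewrite ler0n ler_nat.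
rewrite /= -perm_distV -(ghomV (ext_permM (svalP (j n)))) invgK.
exact: le_ext_perm_dist.
Qed.

End PermutationStability.

(** * Unitary matrices *)

Section FrobeniusNorm.
Variable C : numClosedFieldType.

Section Adjoint.
Variables (m n p : nat).
Implicit Types (A : 'M[C]_(m, n)) (B : 'M[C]_(n, p)).

Lemma adjmxM A B : (A *m B) ^t* = B ^t* *m A ^t*.
Proof. by rewrite trmx_mul map_mxM. Qed.

Lemma adjmxD A A' : (A + A') ^t* = A ^t* + A' ^t*.
Proof. by rewrite linearD map_mxD. Qed.

Lemma adjmxN A : (- A) ^t* = - A ^t*.
Proof. by rewrite linearN map_mxN. Qed.

Lemma adjmxB A A' : (A - A') ^t* = A ^t* - A' ^t*.
Proof. by rewrite adjmxD adjmxN. Qed.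

Lemma adjmxZ a A : (a *: A) ^t* = a^* *: A ^t*.
Proof. by rewrite linearZ map_mxZ. Qed.

Lemma adjmxK A : (A ^t*) ^t* = A.
Proof. exact: trmxCK. Qed.

End Adjoint.

Lemma adjmx_sum m n I (r : seq I) (P : pred I) (F : I -> 'M[C]_(m, n)) :
  (\sum_(i <- r | P i) F i) ^t* = \sum_(i <- r | P i) (F i) ^t*.
Proof.
apply: (big_morph (fun A : 'M[C]_(m, n) => A ^t*)); first exact: adjmxD.
by rewrite trmx0 map_mx0.
Qed.

Lemma adjmx1 n : (1%:M : 'M[C]_n) ^t* = 1%:M.
Proof. by rewrite trmx1 map_mx1. Qed.

Lemma mxtrace_adj n (A : 'M[C]_n) : \tr (A ^t*) = (\tr A)^*.
Proof. by rewrite rmorph_sum; apply: eq_bigr => i _; rewrite !mxE. Qed.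

Lemma unitarymx_adjr n (A : 'M[C]_n) : A \is unitarymx -> A *m A ^t* = 1%:M.
Proof. by move/unitarymxP. Qed.

Lemma unitarymx_adjl n (A : 'M[C]_n) : A \is unitarymx -> A ^t* *m A = 1%:M.
Proof. by rewrite -trmxC_unitary => /unitarymxP; rewrite adjmxK. Qed.

(** Squared Frobenius norm, kept in the complex field so that traces can be compared without taking
    real parts. *)
Definition frob2 m n (A : 'M[C]_(m, n)) : C := \tr (A ^t* *m A).

Lemma frob2E m n (A : 'M[C]_(m, n)) : frob2 A = \sum_j \sum_i `|A i j| ^+ 2.
Proof.
apply: eq_bigr => j _; rewrite !mxE; apply: eq_bigr => i _.
by rewrite !mxE mulrC -normCK.
Qed.

Lemma frob2_ge0 m n (A : 'M[C]_(m, n)) : 0 <= frob2 A.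
Proof. by rewrite frob2E !sumr_ge0 // => j _; rewrite sumr_ge0 // => i _; rewrite exprn_ge0. Qed.

Lemma frob2_eq0 m n (A : 'M[C]_(m, n)) : frob2 A = 0 -> A = 0.
Proof.
rewrite frob2E => /eqP; rewrite psumr_eq0; last first.
  by move=> j _; rewrite sumr_ge0 // => i _; rewrite exprn_ge0.
move=> /allP A0; apply/matrixP => i j; rewrite mxE.
have := A0 j (mem_index_enum _); rewrite psumr_eq0; last by move=> k _; rewrite exprn_ge0.
by move=> /allP/(_ i (mem_index_enum _)); rewrite sqrf_eq0 normr_eq0 => /eqP.
Qed.

Lemma frob20 m n : frob2 (0 : 'M[C]_(m, n)) = 0.
Proof. by rewrite /frob2 mulmx0 mxtrace0. Qed.

Lemma frob2N m n (A : 'M[C]_(m, n)) : frob2 (- A) = frob2 A.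
Proof. by rewrite /frob2 adjmxN mulNmx mulmxN opprK. Qed.

Lemma frob2B m n (A B : 'M[C]_(m, n)) : frob2 (A - B) = frob2 (B - A).
Proof. by rewrite -frob2N opprB. Qed.

Lemma frob2_parallelogram m n (A B : 'M[C]_(m, n)) :
  frob2 (A + B) + frob2 (A - B) = 2 * (frob2 A + frob2 B).
Proof.
rewrite /frob2 adjmxD adjmxB !mulmxDl !mulmxDr !mulmxN !mulNmx !mxtraceD !linearN /=.
by ring.
Qed.

Lemma frob2D m n (A B : 'M[C]_(m, n)) : frob2 (A + B) <= 2 * (frob2 A + frob2 B).
Proof. by rewrite -frob2_parallelogram lerDl frob2_ge0. Qed.

Lemma frob2_triangle m n (A B D : 'M[C]_(m, n)) :
  frob2 (A - D) <= 2 * (frob2 (A - B) + frob2 (B - D)).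
Proof. by apply: le_trans (frob2D _ _); rewrite addrA subrK. Qed.

Lemma frob2Z m n a (A : 'M[C]_(m, n)) : frob2 (a *: A) = `|a| ^+ 2 * frob2 A.
Proof.
by rewrite /frob2 adjmxZ -scalemxAl -scalemxAr !linearZ /= mulrA normCK [a^* * _]mulrC.
Qed.

(** Iterating [frob2D] gives this crude constant, which is independent of the dimension of the
    matrices. *)
Lemma frob2_sum m n (I : Type) (r : seq I) (F : I -> 'M[C]_(m, n)) :
  frob2 (\sum_(i <- r) F i) <= 2 ^+ size r * \sum_(i <- r) frob2 (F i).
Proof.
elim: r => [|i r IH]; first by rewrite !big_nil frob20 mulr0.
rewrite !big_cons; apply: le_trans (frob2D _ _) _.
rewrite /= exprS -mulrA ler_pM2l // mulrDr; apply: lerD => //.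
by rewrite ler_peMl ?frob2_ge0 // exprn_ege1 // ler1n.
Qed.

Lemma frob2_adj m n (A : 'M[C]_(m, n)) : frob2 (A ^t*) = frob2 A.
Proof. by rewrite /frob2 adjmxK mxtrace_mulC. Qed.

Lemma frob2_isoM m n p (V : 'M[C]_(m, n)) (A : 'M[C]_(n, p)) :
  V ^t* *m V = 1%:M -> frob2 (V *m A) = frob2 A.
Proof. by move=> VV; rewrite /frob2 adjmxM mulmxA -[_ *m _ *m V]mulmxA VV mulmx1. Qed.

Lemma frob2_Miso m n p (V : 'M[C]_(n, p)) (A : 'M[C]_(m, n)) :
  V *m V ^t* = 1%:M -> frob2 (A *m V) = frob2 A.
Proof.
by move=> VV; rewrite -frob2_adj adjmxM frob2_isoM ?frob2_adj // adjmxK.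
Qed.

Lemma frob2_unitM n p (V : 'M[C]_n) (A : 'M[C]_(n, p)) :
  V \is unitarymx -> frob2 (V *m A) = frob2 A.
Proof. by move=> Vu; rewrite frob2_isoM // unitarymx_adjl. Qed.

Lemma frob2_Munit m n (V : 'M[C]_n) (A : 'M[C]_(m, n)) :
  V \is unitarymx -> frob2 (A *m V) = frob2 A.
Proof. by move=> Vu; rewrite frob2_Miso // unitarymx_adjr. Qed.

Definition projection n (P : 'M[C]_n) := P ^t* = P /\ P *m P = P.

Lemma projectionC n (P : 'M[C]_n) : projection P -> projection (1%:M - P).
Proof.
move=> [Pa PP]; split; first by rewrite adjmxB adjmx1 Pa.
by rewrite mulmxBl mul1mx mulmxBr mulmx1 PP subrr subr0.
Qed.

Lemma frob2_projection n (P : 'M[C]_n) : projection P -> frob2 P = \tr P.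
Proof. by move=> [Pa PP]; rewrite /frob2 Pa PP. Qed.

(** Pythagoras for [P] and its complementary projection. *)
Lemma frob2_projM n p (P : 'M[C]_n) (A : 'M[C]_(n, p)) :
  projection P -> frob2 (P *m A) <= frob2 A.
Proof.
move=> projP; have [Qa QQ] := projectionC projP; case: (projP) => Pa PP.
have -> : frob2 A = frob2 (P *m A) + frob2 ((1%:M - P) *m A).
  rewrite /frob2 !adjmxM Pa Qa -!mulmxA [P *m (P *m A)]mulmxA PP.
  rewrite [(1%:M - P) *m (_ *m _)]mulmxA QQ -mxtraceD -mulmxDr -mulmxDl.
  by rewrite addrC subrK mul1mx.
by rewrite lerDl frob2_ge0.
Qed.

Lemma frob2_coisoM m n p (V : 'M[C]_(m, n)) (A : 'M[C]_(m, p)) :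
  V ^t* *m V = 1%:M -> frob2 (V ^t* *m A) <= frob2 A.
Proof.
move=> VV; rewrite -(frob2_isoM _ VV) mulmxA; apply: frob2_projM; split.
  by rewrite adjmxM adjmxK.
by rewrite mulmxA -[_ *m _ *m V]mulmxA VV mulmx1.
Qed.

Lemma frob2_block m n m' n' (A : 'M[C]_(m, n)) B D (E : 'M[C]_(m', n')) :
  frob2 (block_mx A B D E) = frob2 A + frob2 D + (frob2 B + frob2 E).
Proof.
rewrite !frob2E big_split_ord /= -!big_split /=; congr (_ + _);
  apply: eq_bigr => j _; rewrite big_split_ord /=; congr (_ + _);
  apply: eq_bigr => i _.
- by rewrite block_mxEul.
- by rewrite block_mxEdl.
- by rewrite block_mxEur.
- by rewrite block_mxEdr.
Qed.

Lemma frob2_unitary n (A : 'M[C]_n) : A \is unitarymx -> frob2 A = n%:R.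
Proof. by move=> Au; rewrite /frob2 unitarymx_adjl // mxtrace1. Qed.

End FrobeniusNorm.

(** * Simultaneous diagonalisation and functional calculus *)

Section Diagonalization.
Variable C : numClosedFieldType.

(** The family and its adjoints are put in triangular form by one unitary; a matrix that is
    triangular together with its adjoint is diagonal. *)
Lemma codiagonalization n (As : seq 'M[C]_n) :
  {in As &, forall A B, A *m B = B *m A} ->
  {in As &, forall A B, A *m B ^t* = B ^t* *m A} ->
  exists2 U : 'M[C]_n, U \is unitarymx &
    forall A, A \in As -> exists d : 'rV_n, A = U ^t* *m diag_mx d *m U.
Proof.
move=> AsC AsCV; pose Bs := As ++ [seq A ^t* | A <- As].
have [|U Uu /allP Utrig] := @cotrigonalization _ _ Bs.
  move=> A B; rewrite !mem_cat => /orP[AA|/mapP[A' AA ->]] /orP[BA|/mapP[B' BA ->]].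
  - exact: AsC.
  - exact: AsCV.
  - by rewrite /comm_mx AsCV.
  - by rewrite /comm_mx -!adjmxM AsC.
exists U => // A AA; have U_unit := unitarymx_unit Uu.
have tA : is_trig_mx (U *m A *m U ^t*).
  have := Utrig A; rewrite mem_cat AA => /(_ isT) /=.
  by rewrite /similar_to conjymx.
have tAV : is_trig_mx (U *m A ^t* *m U ^t*).
  have ABs : A ^t* \in Bs.
    by rewrite mem_cat; apply/orP; right; apply/mapP; exists A.
  by have := Utrig _ ABs; rewrite /= /similar_to conjymx.
have dA : is_diag_mx (U *m A *m U ^t*).
  apply/is_diag_mxP => i j; case: ltngtP => // ij _.
    by move/is_trig_mxP: tA; apply.
  move/is_trig_mxP: tAV => /(_ j i ij)/(congr1 Num.conj); rewrite rmorph0 => <-.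
  rewrite -[U in U *m A ^t*]adjmxK -!adjmxM mulmxA.
  by rewrite [in RHS]mxE [in RHS]mxE conjCK.
have /diag_mxP[d E] := dA.
exists d; rewrite -E !mulmxA unitarymx_adjl // mul1mx.
by rewrite -mulmxA unitarymx_adjl // mulmx1.
Qed.

End Diagonalization.

Section FunctionalCalculus.
Variables (C : numClosedFieldType) (n : nat) (U : 'M[C]_n).
Hypothesis Uu : U \is unitarymx.
Implicit Types d e : 'I_n -> C.

Definition udiag d : 'M[C]_n := U ^t* *m diag_mx (\row_i d i) *m U.

Lemma udiagM d e : udiag d *m udiag e = udiag (fun i => d i * e i).
Proof.
rewrite /udiag !mulmxA; congr (_ *m U); rewrite -mulmxA -[_ *m U *m _]mulmxA.
rewrite [U *m _]mulmxA unitarymx_adjr // mul1mx -mulmxA mulmx_diag.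
by congr (_ *m diag_mx _); apply/rowP => i; rewrite !mxE.
Qed.

Lemma udiagB d e : udiag d - udiag e = udiag (fun i => d i - e i).
Proof.
rewrite /udiag -mulmxBl -mulmxBr -raddfB; congr (_ *m diag_mx _ *m _).
by apply/rowP => i; rewrite !mxE.
Qed.

Lemma udiagD d e : udiag d + udiag e = udiag (fun i => d i + e i).
Proof.
rewrite /udiag -mulmxDl -mulmxDr -raddfD; congr (_ *m diag_mx _ *m _).
by apply/rowP => i; rewrite !mxE.
Qed.

Lemma udiagZ a d : a *: udiag d = udiag (fun i => a * d i).
Proof.
rewrite /udiag scalemxAl scalemxAr -linearZ; congr (_ *m diag_mx _ *m _).
by apply/rowP => i; rewrite !mxE.
Qed.

Lemma udiag1 : udiag (fun=> 1) = 1%:M.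
Proof.
rewrite /udiag (_ : \row_i 1 = const_mx 1) ?diag_const_mx ?mulmx1 ?unitarymx_adjl //.
by apply/rowP => i; rewrite !mxE.
Qed.

Lemma udiag_adj d : (udiag d) ^t* = udiag (fun i => (d i)^*).
Proof.
rewrite /udiag !adjmxM adjmxK mulmxA tr_diag_mx map_diag_mx.
by congr (_ *m diag_mx _ *m _); apply/rowP => i; rewrite !mxE.
Qed.

Lemma mxtrace_udiag d : \tr (udiag d) = \sum_i d i.
Proof.
rewrite /udiag mxtrace_mulC mulmxA unitarymx_adjr // mul1mx mxtrace_diag.
by apply: eq_bigr => i _; rewrite mxE.
Qed.

Lemma frob2_udiag d : frob2 (udiag d) = \sum_i `|d i| ^+ 2.
Proof.
rewrite /frob2 udiag_adj udiagM mxtrace_udiag; apply: eq_bigr => i _.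
by rewrite mulrC normCK.
Qed.

Lemma udiag_conj d : U *m udiag d *m U ^t* = diag_mx (\row_i d i).
Proof.
rewrite /udiag !mulmxA unitarymx_adjr // mul1mx -mulmxA unitarymx_adjr //.
by rewrite mulmx1.
Qed.

Lemma udiag_inj d e : udiag d = udiag e -> d =1 e.
Proof.
move=> /(congr1 (fun M => U *m M *m U ^t*)); rewrite !udiag_conj.
by move=> /matrixP E i; have := E i i; rewrite !mxE eqxx !mulr1n.
Qed.

(** In the basis [U], an entry of [X] vanishes unless all [d k] agree at its two indices, so [X]
    commutes with every function of the joint eigenvalues. *)
Lemma udiag_comm (K : Type) (d : K -> 'I_n -> C) e (X : 'M[C]_n) :
  (forall k, X *m udiag (d k) = udiag (d k) *m X) ->
  (forall i j, (forall k, d k i = d k j) -> e i = e j) ->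
  X *m udiag e = udiag e *m X.
Proof.
move=> Xd de; pose Y := U *m X *m U ^t*.
have E f : (X *m udiag f = udiag f *m X) <->
    (Y *m diag_mx (\row_i f i) = diag_mx (\row_i f i) *m Y).
  have EX : X = U ^t* *m Y *m U.
    by rewrite /Y !mulmxA unitarymx_adjl // mul1mx -mulmxA unitarymx_adjl // mulmx1.
  split=> [|YE].
    rewrite -udiag_conj /Y; move: (udiag f) => D XE; rewrite -!mulmxA.
    rewrite ![U ^t* *m (U *m _)]mulmxA unitarymx_adjl // !mul1mx.
    by rewrite [X *m _]mulmxA XE -mulmxA.
  clearbody Y; rewrite EX /udiag; move: (diag_mx _) YE => D YE; rewrite -!mulmxA.
  rewrite ![U *m (U ^t* *m _)]mulmxA unitarymx_adjr // !mul1mx.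
  by rewrite [Y *m _]mulmxA YE -mulmxA.
clearbody Y; apply/E/matrixP => i j; rewrite mul_mx_diag mul_diag_mx !mxE.
have [->|Yij] := eqVneq (Y i j) 0; first by rewrite mul0r mulr0.
rewrite mulrC (de i j) // => k; have /E/matrixP/(_ i j) := Xd k.
rewrite mul_mx_diag mul_diag_mx !mxE mulrC => /eqP.
by rewrite -subr_eq0 -mulrBl mulf_eq0 (negbTE Yij) orbF subr_eq0 => /eqP.
Qed.

End FunctionalCalculus.

(** * Polar parts and intertwiners of unitary representations *)

Section Intertwiners.
Variable C : numClosedFieldType.

Lemma normal_udiag n (A : 'M[C]_n) : A *m A ^t* = A ^t* *m A ->
  exists2 U : 'M[C]_n, U \is unitarymx & exists d, A = udiag U d.
Proof.
move=> An; have [||U Uu Ud] := @codiagonalization _ _ [:: A].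
- by move=> X Y; rewrite !inE => /eqP -> /eqP ->.
- by move=> X Y; rewrite !inE => /eqP -> /eqP ->.
have [d ->] := Ud A (mem_head _ _); exists U => //; exists (d 0).
by rewrite /udiag; congr (_ *m diag_mx _ *m _); apply/rowP => i; rewrite mxE.
Qed.

Lemma projection_trace_nat n (P : 'M[C]_n) : projection P ->
  exists r : nat, \tr P = r%:R.
Proof.
move=> [Pa PP]; have [|U Uu [d Pd]] := @normal_udiag _ P; first by rewrite Pa.
have dd i : d i = (d i == 1)%:R.
  have := @udiag_inj _ _ _ Uu _ _ (_ : udiag U (fun i => d i * d i) = udiag U d) i.
  rewrite -udiagM // -Pd => /(_ PP) /eqP; rewrite -subr_eq0 -{3}[d i]mulr1 -mulrBr.
  rewrite mulf_eq0 subr_eq0 => /orP[|] /eqP ->; last by rewrite eqxx.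
  by rewrite eq_sym oner_eq0.
exists #|[pred i | d i == 1]|; rewrite Pd mxtrace_udiag //.
under eq_bigr do rewrite dd.
by rewrite -sum1_card natr_sum [RHS]big_mkcond /=; apply: eq_bigr => i _; rewrite inE; case: eqP.
Qed.

Lemma partial_isometryK n (W : 'M[C]_n) :
  projection (W ^t* *m W) -> W *m (W ^t* *m W) = W.
Proof.
move=> [Pa PP]; apply/eqP; rewrite -subr_eq0; apply/eqP/frob2_eq0.
set P := W ^t* *m W in Pa PP *.
have -> : W *m P - W = W *m (P - 1%:M) by rewrite mulmxBr mulmx1.
rewrite /frob2 adjmxM -mulmxA [_ *m (W *m _)]mulmxA -/P mulmxBr mulmx1 PP subrr.
by rewrite mulmx0 mxtrace0.
Qed.

(* Here [M] is the positive square root of [S ^t* *m S], and [W] vanishes on the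
   kernel of [S]. *)
Lemma polar n (S : 'M[C]_n) : exists (W M : 'M[C]_n),
  [/\ S = W *m M, projection (W ^t* *m W), W ^t* *m W *m M = M,
      frob2 (1%:M - M) <= frob2 (1%:M - S ^t* *m S) &
      [/\ forall X Y, Y *m S = S *m X -> Y ^t* *m S = S *m X ^t* -> Y *m W = W *m X,
          forall Q, Q *m S = S -> Q *m W = W &
          forall P, P ^t* = P -> S *m P = S -> W *m P = W]].
Proof.
have [|U Uu [d Sd]] := @normal_udiag _ (S ^t* *m S).
  by rewrite adjmxM adjmxK.
have d0 i : 0 <= d i.
  have := congr1 (fun M : 'M[C]_n => (U *m M *m U ^t*) i i) Sd.
  rewrite udiag_conj // !mxE eqxx mulr1n => <-.
  have E : (S *m U ^t*) ^t* *m (S *m U ^t*) = U *m (S ^t* *m S) *m U ^t*.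
    by rewrite adjmxM adjmxK !mulmxA.
  have -> : \sum_j (U *m (S ^t* *m S)) i j * (U ^t*) j i =
      ((S *m U ^t*) ^t* *m (S *m U ^t*)) i i by rewrite E [RHS]mxE.
  rewrite mxE sumr_ge0 // => k _.
  by rewrite [X in X * _]mxE [X in X^* * _]mxE mulrC -normCK exprn_ge0.
pose s i := sqrtC (d i).
have s0 i : 0 <= s i by rewrite sqrtC_ge0.
have ss i : s i * s i = d i by rewrite -expr2 sqrtCK.
(* The convention that 0 has inverse 0 makes [W] vanish on the kernel of [S]. *)
pose f i := (s i)^-1.
have fr i : (f i)^* = f i by rewrite geC0_conj // invr_ge0.
pose W := S *m udiag U f; pose M := udiag U s.
have WW : W ^t* *m W = udiag U (fun i => (d i != 0)%:R).
  rewrite /W adjmxM udiag_adj -mulmxA [S ^t* *m _]mulmxA Sd !udiagM //.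
  congr (udiag U _); apply/funext => i; rewrite fr -ss /f.
  have [->|si] := eqVneq (s i) 0; first by rewrite invr0 !mul0r eqxx.
  by rewrite mulf_neq0 // mulfK // mulVf.
have ker : S *m udiag U (fun i => (d i == 0)%:R) = 0.
  apply: frob2_eq0; rewrite /frob2 adjmxM udiag_adj -mulmxA [S ^t* *m _]mulmxA Sd.
  rewrite !udiagM // mxtrace_udiag // big1 // => i _.
  by case: eqP => [->|]; rewrite ?mul0r ?mulr0.
exists W, M; split.
- rewrite /W /M -mulmxA udiagM //; apply/eqP; rewrite -subr_eq0 -{1}[S]mulmx1.
  rewrite -mulmxBr -(udiag1 Uu) udiagB //; apply/eqP; rewrite -[RHS]ker.
  congr (S *m udiag U _); apply/funext => i; rewrite /f -ss.
  have [->|si] := eqVneq (s i) 0; first by rewrite mulr0 subr0 mul0r eqxx.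
  by rewrite mulVf // subrr mulf_eq0 (negbTE si).
- rewrite WW; split.
    by rewrite udiag_adj; congr (udiag U _); apply/funext => i; rewrite conjC_nat.
  rewrite udiagM //; congr (udiag U _); apply/funext => i.
  by case: (d i != 0); rewrite ?mulr1 ?mulr0.
- rewrite WW /M udiagM //; congr (udiag U _); apply/funext => i.
  by rewrite -ss mulf_eq0 orbb; case: eqP => [->|]; rewrite ?mulr0 ?mul1r.
(* On eigenvalues: |1 - s| <= |1 - s| (1 + s) = |1 - s^2|, as s is nonnegative. *)
- rewrite Sd -(udiag1 Uu) !udiagB // !frob2_udiag //; apply: ler_sum => i _.
  rewrite -ss lerXn2r ?nnegrE ?normr_ge0 //.
  have -> : 1 - s i * s i = (1 - s i) * (1 + s i) by ring.
  by rewrite normrM ler_peMr ?normr_ge0 // ger0_norm ?addr_ge0 ?ler01 // lerDl.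
split.
- move=> X Y YX YXa; rewrite /W mulmxA YX -mulmxA -[RHS]mulmxA; congr (_ *m _).
  apply: (@udiag_comm _ _ _ Uu unit (fun=> d)) => [_|i j /(_ tt) E]; last by rewrite /f /s E.
  rewrite -Sd mulmxA; have := congr1 (fun A => A ^t*) YXa.
  rewrite !adjmxM !adjmxK => <-; by rewrite -!mulmxA YX.
- by move=> Q QS; rewrite /W mulmxA QS.
- move=> P Pa SP; rewrite /W -mulmxA -(_ : P *m udiag U f = udiag U f *m P).
    by rewrite mulmxA SP.
  apply: (@udiag_comm _ _ _ Uu unit (fun=> d)) => [_|i j /(_ tt) E]; last by rewrite /f /s E.
  rewrite -Sd -mulmxA SP mulmxA; have := congr1 (fun A => A ^t*) SP.
  by rewrite adjmxM Pa => ->.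
Qed.

Variable H : finGroupType.

Definition urep (G : groupType) n (a : G -> 'M[C]_n) :=
  (forall g, a g \is unitarymx) /\ (forall g h, a (g * h)%g = a g *m a h).

Lemma urep1 (G : groupType) n (a : G -> 'M[C]_n) : urep a -> a 1%g = 1%:M.
Proof.
move=> [au aM]; have E := aM 1%g 1%g; rewrite mulg1 in E.
by rewrite -(unitarymx_adjl (au 1%g)) {3}E mulmxA unitarymx_adjl // mul1mx.
Qed.

Lemma urepV (G : groupType) n (a : G -> 'M[C]_n) g : urep a -> a g^-1%g = (a g) ^t*.
Proof.
move=> ra; case: (ra) => au aM.
rewrite -[LHS]mul1mx -(unitarymx_adjl (au g)) -mulmxA -aM mulgV (urep1 ra).
by rewrite mulmx1.
Qed.

(* Schur orthogonality in the form [\sum_h |chi h| ^+ 2 > 0] produces a nonzero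
   intertwiner, whose partial isometry is then split off. *)
Lemma equal_character_intertwiner n (a b : H -> 'M[C]_n) (P Q : 'M[C]_n) :
  urep a -> urep b -> projection P -> projection Q ->
  (forall h, a h *m P = P *m a h) -> (forall h, b h *m Q = Q *m b h) ->
  (forall h, \tr (a h *m P) = \tr (b h *m Q)) ->
  exists W, [/\ forall h, b h *m W = W *m a h, W ^t* *m W = P & W *m W ^t* = Q].
Proof.
(* The induction is on a strict bound for the rank of [P]; the disjunction only allows it to be
   picked before [P] is assumed to be a projection. *)
move=> ra rb; have [r] : exists r : nat, \tr P < r%:R \/ ~ projection P.
  have [pP|nP] := pselect (projection P); last by exists 0%N; right.
  have [r ->] := projection_trace_nat pP; exists r.+1; left.
  by rewrite ltr_nat.
case=> [trP|//]; move: trP.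
elim: r P Q => [|r IH] P Q trP pP pQ aP bQ ab.
  by have := frob2_ge0 P; rewrite frob2_projection // => /le_lt_trans /(_ trP); rewrite ltxx.
case: (ra) => au aM; case: (rb) => bu bM.
have [P0|P0] := eqVneq P 0.
  exists 0; rewrite P0; split=> [h||]; [by rewrite mulmx0 mul0mx|by rewrite mulmx0|].
  rewrite mul0mx; apply/esym/frob2_eq0; rewrite frob2_projection //.
  by have := ab 1%g; rewrite P0 mulmx0 mxtrace0 (urep1 rb) mul1mx.
case: (pP) => Pa PP; case: (pQ) => Qa QQ.
pose avg X := \sum_h b h *m Q *m X *m P *m (a h) ^t*.
have avgE X g : b g *m avg X = avg X *m a g.
  rewrite /avg mulmx_sumr mulmx_suml (reindex_inj (mulgI g^-1%g)) /=.
  apply: eq_bigr => h _.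
  rewrite bM !mulmxA (urepV _ rb) unitarymx_adjr // mul1mx.
  rewrite aM (urepV _ ra) adjmxM adjmxK -!mulmxA; congr (_ *m (_ *m (_ *m (_ *m _)))).
have avgQ X : Q *m avg X = avg X.
  rewrite /avg mulmx_sumr; apply: eq_bigr => h _.
  by rewrite !mulmxA -bQ -[_ *m Q *m Q]mulmxA QQ.
have avgP X : avg X *m P = avg X.
  rewrite /avg mulmx_suml; apply: eq_bigr => h _; rewrite -mulmxA -(urepV _ ra) aP.
  by rewrite mulmxA -[_ *m P *m P]mulmxA PP.
have [X X0] : exists X, avg X != 0.
  apply: contrapT => no; have {no} all0 X : avg X = 0.
    by apply/eqP; apply: contraT => X0; case: no; exists X.
  (* If all averages vanished, adding the entries (i, j) of the averages of the matrix units would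
     give this sum, by equality of the characters; but its term at h = 1 is the squared rank of
     [P]. *)
  have E : \sum_h `|\tr (a h *m P)| ^+ 2 = 0.
    transitivity (\sum_i \sum_j avg (delta_mx i j) i j); last first.
      by rewrite big1 // => i _; rewrite big1 // => j _; rewrite all0 mxE.
    rewrite /avg; under [RHS]eq_bigr do under eq_bigr do rewrite summxE.
    under [RHS]eq_bigr do rewrite exchange_big.
    rewrite [RHS]exchange_big; apply: eq_bigr => h _ /=.
    transitivity ((\tr (b h *m Q)) * \tr (P *m (a h) ^t*)).
      rewrite -ab normCK; congr (_ * _); rewrite -mxtrace_adj adjmxM Pa.
      by [].
    rewrite big_distrl; apply: eq_bigr => i _; rewrite big_distrr; apply: eq_bigr => j _ /=.
    rewrite -mulmxA [RHS]mxE (bigD1 j) //= big1 ?addr0 => [|k kj].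
      rewrite [X in _ = X * _]mxE (bigD1 i) //= big1 => [|k ki].
        by rewrite [delta_mx _ _ _ _]mxE !eqxx mulr1 addr0.
      by rewrite [delta_mx _ _ _ _]mxE (negbTE ki) mulr0.
    rewrite [X in X * _]mxE big1 ?mul0r // => l _.
    by rewrite [delta_mx _ _ _ _]mxE (negbTE kj) andbF mulr0.
  have /eqP : `|\tr (a 1%g *m P)| ^+ 2 = 0.
    by apply: (psumr_eq0P _ E) => // h _; rewrite exprn_ge0.
  rewrite sqrf_eq0 normr_eq0 (urep1 ra) mul1mx -frob2_projection // => /eqP/frob2_eq0.
  by move/eqP: P0.
have [W0 [M [SW pP0 _ _ [Wc WQ WP]]]] := polar (avg X).
set P1 := W0 ^t* *m W0 in pP0.
have W0c h : b h *m W0 = W0 *m a h.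
  by apply: Wc => //; rewrite -(urepV _ rb) -(urepV _ ra); exact: avgE.
have {}WQ : Q *m W0 = W0 by exact: WQ.
have {}WP : W0 *m P = W0 by exact: WP.
have W0n : W0 != 0.
  by apply: contraNneq X0 => W00; rewrite SW W00 mul0mx.
pose Q1 := W0 *m W0 ^t*.
have W0K : W0 *m P1 = W0 by exact: partial_isometryK.
have pQ1 : projection Q1.
  split; first by rewrite adjmxM adjmxK.
  by rewrite /Q1 !mulmxA -[W0 *m _ *m W0]mulmxA -/P1 W0K.
have P1P : P1 *m P = P1 by rewrite -mulmxA WP.
have PP1 : P *m P1 = P1.
  by have := congr1 (fun A => A ^t*) P1P; rewrite adjmxM Pa (proj1 pP0).
have QQ1 : Q *m Q1 = Q1 by rewrite mulmxA WQ.
have Q1Q : Q1 *m Q = Q1.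
  by have := congr1 (fun A => A ^t*) QQ1; rewrite adjmxM Qa (proj1 pQ1).
have projB (A A1 : 'M[C]_n) : projection A -> projection A1 ->
    A *m A1 = A1 -> A1 *m A = A1 -> projection (A - A1).
  move=> [Aa AA] [A1a A1A1] h1 h2; split; first by rewrite adjmxB Aa A1a.
  by rewrite mulmxBl !mulmxBr AA h1 h2 A1A1 subrr subr0.
have W0cV h : W0 ^t* *m b h = a h *m W0 ^t*.
  have := congr1 (fun A => A ^t*) (W0c h^-1%g).
  by rewrite !adjmxM (urepV _ rb) (urepV _ ra) !adjmxK.
have aP1 h : a h *m P1 = P1 *m a h.
  by rewrite /P1 mulmxA -W0cV -mulmxA W0c mulmxA.
have bQ1 h : b h *m Q1 = Q1 *m b h.
  by rewrite /Q1 mulmxA W0c -mulmxA -W0cV mulmxA.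
have [||||||W' [W'c W'P W'Q]] := IH (P - P1) (Q - Q1).
(* The rank drops because [P1] has trace [frob2 W0], which is nonzero. *)
- have [p Ep] := projection_trace_nat pP; have [q Eq] := projection_trace_nat pP0.
  have q0 : (0 < q)%N.
    rewrite -(ltr_nat C) -Eq lt0r -[\tr P1]/(frob2 W0) frob2_ge0 andbT.
    by apply: contraNneq W0n => /frob2_eq0 ->.
  rewrite linearB /= Ep Eq ltrBlDr -natrD ltr_nat.
  by move: trP; rewrite Ep ltr_nat; lia.
- exact: projB.
- exact: projB.
- by move=> h; rewrite mulmxBl mulmxBr aP aP1.
- by move=> h; rewrite mulmxBl mulmxBr bQ bQ1.
- move=> h; rewrite !mulmxBr !linearB /= ab; congr (_ - _).
  by rewrite /P1 /Q1 mulmxA -W0cV -mulmxA mxtrace_mulC mulmxA.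
have W'K : W' *m (P - P1) = W'.
  by rewrite -W'P; apply: partial_isometryK; rewrite W'P; exact: projB.
have W'K2 : (Q - Q1) *m W' = W' by rewrite -W'Q -mulmxA W'P.
have W0K2 : W0 ^t* *m Q1 = W0 ^t*.
  have := congr1 (fun A => A ^t*) W0K; rewrite adjmxM (proj1 pP0) => E.
  by rewrite /Q1 mulmxA -/P1 E.
have W0' : W0 ^t* *m W' = 0.
  rewrite -W0K2 -W'K2 mulmxA -[_ *m Q1 *m _]mulmxA mulmxBr Q1Q.
  by rewrite (proj2 pQ1) subrr mulmx0 mul0mx.
have W0'' : W0 *m W' ^t* = 0.
  rewrite -W0K -W'K adjmxM adjmxB Pa (proj1 pP0) mulmxA -[_ *m P1 *m _]mulmxA mulmxBr P1P.
  by rewrite (proj2 pP0) subrr mulmx0 mul0mx.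
exists (W0 + W'); split.
- by move=> h; rewrite mulmxDr mulmxDl W0c W'c.
- rewrite adjmxD mulmxDl !mulmxDr W0' -/P1 W'P addr0.
  have -> : W' ^t* *m W0 = 0 by rewrite -[W0]adjmxK -adjmxM W0' trmx0 map_mx0.
  by rewrite add0r addrC subrK.
- rewrite adjmxD mulmxDl !mulmxDr W0'' -/Q1 W'Q addr0.
  have -> : W' *m W0 ^t* = 0 by rewrite -[W']adjmxK -adjmxM W0'' trmx0 map_mx0.
  by rewrite add0r addrC subrK.
Qed.

Lemma unitary_intertwiner_correction n (a b : H -> 'M[C]_n) (t : 'M[C]_n) :
  urep a -> urep b -> t \is unitarymx -> (forall h, \tr (a h) = \tr (b h)) ->
  exists t', [/\ t' \is unitarymx, forall h, b h *m t' = t' *m a h &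
    frob2 (t' - t) <= (10 * 4 ^ #|H|)%:R * \sum_h frob2 (b h *m t - t *m a h)].
Proof.
move=> ra rb tu ab; case: (ra) => au aM; case: (rb) => bu bM.
(* [L] is the cost of [frob2_sum] over [H]. The squared distance of the average [S] to [t] is at
   most L E, the defect of unitarity of [S] at most 4 L times that, and 2 (4 L L E + L L E) = 10 L^2
   E. *)
set E := \sum_h _; pose c : C := #|H|%:R; pose L : C := 2 ^+ #|H|.
have c_ge1 : 1 <= c by rewrite ler1n; apply/card_gt0P; exists 1%g.
have c_gt0 : 0 < c by exact: lt_le_trans ltr01 c_ge1.
have ci_ge0 : 0 <= c^-1 by rewrite invr_ge0 ltW.
have L_ge1 : 1 <= L by rewrite exprn_ege1 // ler1n.
have E0 : 0 <= E by apply: sumr_ge0 => h _; exact: frob2_ge0.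
have L0 : 0 <= L by exact: le_trans ler01 L_ge1.
have c2 : `|c^-1| ^+ 2 <= c^-1.
  by rewrite ger0_norm // expr2 ler_piMr // invf_le1.
have sumH (F : H -> 'M[C]_n) : frob2 (c^-1 *: \sum_h F h) <= c^-1 * (L * \sum_h frob2 (F h)).
  rewrite frob2Z; apply: ler_pM; rewrite ?exprn_ge0 ?frob2_ge0 //.
  apply: le_trans (frob2_sum _ _) _.
  by rewrite /L cardE /index_enum -enumT.
pose S := c^-1 *: \sum_h b h *m t *m (a h) ^t*.
have StE : S - t = c^-1 *: \sum_h (b h *m t - t *m a h) *m (a h) ^t*.
  have -> : \sum_h (b h *m t - t *m a h) *m (a h) ^t* = \sum_h b h *m t *m (a h) ^t* - c *: t.
    rewrite (eq_bigr (fun h => b h *m t *m (a h) ^t* - t)); last first.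
      by move=> h _; rewrite mulmxBl -[t *m _ *m _]mulmxA unitarymx_adjr // mulmx1.
    by rewrite sumrB sumr_const /c scaler_nat.
  by rewrite scalerBr scalerA mulVf ?scale1r // gt_eqF.
have nSt : frob2 (S - t) <= L * E.
  rewrite StE; apply: le_trans (sumH _) _.
  rewrite (eq_bigr (fun h => frob2 (b h *m t - t *m a h))); last first.
    by move=> h _; rewrite frob2_Munit // trmxC_unitary.
  by apply: ler_piMl; [exact: mulr_ge0|rewrite invf_le1].
have nSX (X : 'M[C]_n) : frob2 (S ^t* *m X) <= L * frob2 X.
  have -> : S ^t* *m X = c^-1 *: \sum_h a h *m (t ^t* *m ((b h) ^t* *m X)).
    rewrite /S adjmxZ adjmx_sum -scalemxAl mulmx_suml; congr (_ *: _).
      by rewrite geC0_conj.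
    by apply: eq_bigr => h _; rewrite !adjmxM adjmxK !mulmxA.
  apply: le_trans (sumH _) _.
  rewrite (eq_bigr (fun=> frob2 X)); last first.
    by move=> h _; rewrite !frob2_unitM // trmxC_unitary.
  by rewrite sumr_const -[_ *+ _]mulr_natl mulrCA mulKf // gt_eqF.
have Sc h : b h *m S = S *m a h.
  rewrite /S -scalemxAr -scalemxAl; congr (_ *: _).
  rewrite mulmx_sumr mulmx_suml (reindex_inj (mulgI h^-1%g)) /=.
  apply: eq_bigr => g _.
  rewrite bM !mulmxA (urepV _ rb) unitarymx_adjr // mul1mx.
  by rewrite aM (urepV _ ra) adjmxM adjmxK !mulmxA.
have [W [M [SW pP WM nM [Wc _ _]]]] := polar S.
have Wch h : b h *m W = W *m a h.
  by apply: Wc => //; rewrite -(urepV _ rb) -(urepV _ ra); exact: Sc.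
set P := W ^t* *m W in pP WM; pose Q := W *m W ^t*.
have WK : W *m P = W by exact: partial_isometryK.
have pQ : projection Q.
  split; first by rewrite adjmxM adjmxK.
  by rewrite /Q !mulmxA -[W *m _ *m W]mulmxA -/P WK.
have WcV h : W ^t* *m b h = a h *m W ^t*.
  have := congr1 (fun A => A ^t*) (Wch h^-1%g).
  by rewrite !adjmxM (urepV _ rb) (urepV _ ra) !adjmxK.
have aP h : a h *m P = P *m a h by rewrite /P mulmxA -WcV -mulmxA Wch mulmxA.
have bQ h : b h *m Q = Q *m b h by rewrite /Q mulmxA Wch -mulmxA -WcV mulmxA.
have [||||h|W1 [W1c W1P W1Q]] :=
    @equal_character_intertwiner n a b (1%:M - P) (1%:M - Q) ra rb.
- exact: projectionC.
- exact: projectionC.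
- by move=> h; rewrite mulmxBl mulmxBr mulmx1 mul1mx aP.
- by move=> h; rewrite mulmxBl mulmxBr mulmx1 mul1mx bQ.
- rewrite !mulmxBr !mulmx1 !linearB /= ab; congr (_ - _).
  by rewrite /P /Q mulmxA -WcV -mulmxA mxtrace_mulC mulmxA.
have W1K : W1 *m (1%:M - P) = W1.
  by rewrite -W1P; apply: partial_isometryK; rewrite W1P; exact: projectionC.
have W1K2 : (1%:M - Q) *m W1 = W1 by rewrite -W1Q -mulmxA W1P.
have QW : Q *m W = W by rewrite -mulmxA WK.
have W1W : W1 ^t* *m W = 0.
  rewrite -QW -W1K2 adjmxM adjmxB adjmx1 (proj1 pQ) mulmxA.
  rewrite -[_ *m (1%:M - Q) *m Q]mulmxA mulmxBl mul1mx (proj2 pQ) subrr.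
  by rewrite mulmx0 mul0mx.
have WW1 : W ^t* *m W1 = 0.
  by rewrite -[W1]adjmxK -adjmxM W1W trmx0 map_mx0.
have Tu : W + W1 \is unitarymx.
  rewrite -trmxC_unitary; apply/unitarymxP; rewrite adjmxK adjmxD mulmxDl !mulmxDr.
  by rewrite -/P W1P W1W WW1 addr0 add0r addrC subrK.
exists (W + W1); split=> // [h|]; first by rewrite mulmxDr mulmxDl Wch W1c.
have W1M : W1 *m M = 0.
  by rewrite -W1K -WM -mulmxA [_ *m (P *m M)]mulmxA mulmxBl mul1mx (proj2 pP) subrr mul0mx mulmx0.
(* The added part [W1] kills [M], so W + W1 - S = (W + W1) (1 - M) with a unitary left factor. *)
have nTS : frob2 (W + W1 - S) <= frob2 (1%:M - S ^t* *m S).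
  have -> : W + W1 - S = (W + W1) *m (1%:M - M).
    by rewrite mulmxBr mulmx1 mulmxDl W1M addr0 -SW.
  by rewrite frob2_unitM.
have nSS : frob2 (1%:M - S ^t* *m S) <= 4 * L * frob2 (S - t).
  rewrite frob2B.
  have -> : S ^t* *m S - 1%:M = S ^t* *m (S - t) + (S - t) ^t* *m t.
    by rewrite mulmxBr adjmxB mulmxBl (unitarymx_adjl tu) addrA subrK.
  apply: le_trans (frob2D _ _) _; rewrite (frob2_Munit _ tu) frob2_adj.
  have -> : 4 * L * frob2 (S - t) = 2 * (L * frob2 (S - t) + L * frob2 (S - t)) by ring.
  rewrite ler_pM2l // lerD // ?nSX // ler_peMl //; exact: frob2_ge0.
apply: le_trans (frob2_triangle _ S _) _.
have nTS' : frob2 (W + W1 - S) <= 4 * L * (L * E).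
  apply: le_trans nTS (le_trans nSS _); rewrite ler_wpM2l // mulr_ge0 //.
have nSt' : frob2 (S - t) <= L * (L * E).
  by apply: le_trans nSt _; rewrite ler_peMl // mulr_ge0.
have -> : (10 * 4 ^ #|H|)%:R * E = 2 * (4 * L * (L * E) + L * (L * E)).
  by rewrite natrM natrX /L (_ : 4 = 2 * 2 :> C) ?exprMn; [ring|rewrite -natrM].
by rewrite ler_pM2l // lerD.
Qed.

End Intertwiners.

(** * Dimensions of eigenspaces as integer invariants *)

Section EigenProjections.
Variables (C : numClosedFieldType) (H : finGroupType).

Let e := #|H|.
Let e_gt0 : (0 < e)%N. Proof. by apply/card_gt0P; exists 1%g. Qed.

Lemma geometric_root_sum (z : C) : z ^+ e = 1 ->
  e%:R^-1 * (\sum_(k < e) z ^+ k) = (z == 1)%:R.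
Proof.
move=> ze; have [->|z1] := eqVneq z 1.
  under eq_bigr do rewrite expr1n.
  by rewrite sumr_const card_ord mulVf // pnatr_eq0 -lt0n.
have := subrX1 z e; rewrite ze subrr => /esym/eqP; rewrite mulf_eq0 subr_eq0 (negbTE z1) /=.
by move=> /eqP ->; rewrite mulr0.
Qed.

(** Fourier inversion on the cyclic group generated by [h]: the projection onto the eigenspace of
    [a h] for an [e]-th root of unity [r]. The order of [H] serves as a common exponent for all
    [h]. *)
Definition eigen_proj n (a : H -> 'M[C]_n) (h : H) (r : C) : 'M[C]_n :=
  e%:R^-1 *: \sum_(k < e) r^-1 ^+ k *: a (h ^+ k)%g.

Lemma urep_udiag n (a : H -> 'M[C]_n) h : urep a ->
  exists2 U : 'M[C]_n, U \is unitarymx & exists d,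
    (forall i, d i ^+ e = 1) /\ forall k, a (h ^+ k)%g = udiag U (fun i => d i ^+ k).
Proof.
move=> ra; case: (ra) => au aM.
have [|U Uu [d ad]] := @normal_udiag _ _ (a h).
  by rewrite unitarymx_adjr // unitarymx_adjl.
have adk k : a (h ^+ k)%g = udiag U (fun i => d i ^+ k).
  elim: k => [|k IH]; first by rewrite expg0 (urep1 ra) -(udiag1 Uu).
  rewrite expgS aM IH ad udiagM //; congr (udiag U _); apply/funext => i.
  by rewrite exprS.
exists U => //; exists d; split=> // i.
have := adk e; rewrite expg_card (urep1 ra) -(udiag1 Uu) => /(udiag_inj Uu)/(_ i).
by move=> <-.
Qed.

Lemma eigen_projE n (U : 'M[C]_n) (a : H -> 'M[C]_n) h r d : U \is unitarymx ->
  r ^+ e = 1 -> (forall i, d i ^+ e = 1) ->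
  (forall k, a (h ^+ k)%g = udiag U (fun i => d i ^+ k)) ->
  eigen_proj a h r = udiag U (fun i => (d i == r)%:R).
Proof.
move=> Uu re de adk.
have r0 : r != 0 by apply: contra_eq_neq re => ->; rewrite expr0n gtn_eqF // eq_sym oner_neq0.
have sumU (K : finType) (f : K -> 'I_n -> C) :
    \sum_k udiag U (f k) = udiag U (fun i => \sum_k f k i).
  elim: (index_enum K) => [|k s IH]; last first.
    rewrite big_cons IH udiagD; congr (udiag U _); apply/funext => i.
    by rewrite big_cons.
  rewrite big_nil -[LHS](subrr 1%:M) -(udiag1 Uu) udiagB; congr (udiag U _).
  by apply/funext => i; rewrite big_nil subrr.
rewrite /eigen_proj; under eq_bigr do rewrite adk udiagZ.
rewrite sumU udiagZ; congr (udiag U _); apply/funext => i.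
rewrite (eq_bigr (fun k : 'I_e => (r^-1 * d i) ^+ k)); last by move=> k _; rewrite exprMn.
rewrite geometric_root_sum; last by rewrite exprMn exprVn re de invr1 mulr1.
by rewrite -(inj_eq (mulfI r0)) mulVKf // mulr1.
Qed.

Lemma eigen_proj_projection n (a : H -> 'M[C]_n) h r : urep a -> r ^+ e = 1 ->
  projection (eigen_proj a h r).
Proof.
move=> ra re; have [U Uu [d [de adk]]] := urep_udiag h ra.
rewrite (eigen_projE Uu re de adk); split.
  by rewrite udiag_adj; congr (udiag U _); apply/funext => i; rewrite conjC_nat.
by rewrite udiagM //; congr (udiag U _); apply/funext => i; rewrite -natrM mulnb andbb.
Qed.

(** Spectral decomposition of [a h]; consequently equal eigenspace dimensions give equal
    characters. *)
Lemma mxtrace_eigen_proj n (a : H -> 'M[C]_n) h (rts : seq C) : urep a -> uniq rts ->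
  (forall z, (z \in rts) = (z ^+ e == 1)) ->
  \tr (a h) = \sum_(r <- rts) r * \tr (eigen_proj a h r).
Proof.
move=> ra rts_uniq rtsP; have [U Uu [d [de adk]]] := urep_udiag h ra.
rewrite -[h in LHS]expg1 adk mxtrace_udiag // [RHS]big_seq.
rewrite [RHS](eq_bigr (fun r => \sum_i r * (d i == r)%:R)); last first.
  move=> r; rewrite rtsP => /eqP re; rewrite (eigen_projE Uu re de) ?mxtrace_udiag //.
  by rewrite mulr_sumr.
rewrite -[RHS]big_seq exchange_big; apply: eq_bigr => i _ /=.
rewrite expr1 (bigD1_seq (d i)) //= ?rtsP ?de ?eqxx // mulr1 big1 ?addr0 // => r.
by rewrite eq_sym => /negbTE ->; rewrite mulr0.
Qed.

(** The right side is tr P + tr Q - 2 tr (P Q), and tr (P Q) is at most either trace. *)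
Lemma projection_trace_dist n (P Q : 'M[C]_n) : projection P -> projection Q ->
  `|\tr P - \tr Q| <= frob2 (P - Q).
Proof.
move=> pP pQ; case: (pP) => Pa PP; case: (pQ) => Qa QQ.
have E : frob2 (P - Q) = \tr P + \tr Q - 2 * \tr (P *m Q).
  rewrite /frob2 adjmxB Pa Qa !mulmxBr !mulmxBl PP QQ !linearB /=.
  by rewrite [\tr (Q *m P)]mxtrace_mulC; ring.
have le1 (A B : 'M[C]_n) : projection A -> projection B -> \tr (A *m B) <= \tr A.
  move=> pA pB; have [Aa AA] := pA; have [Ba BB] := projectionC pB.
  rewrite -subr_ge0; have -> : \tr A - \tr (A *m B) = frob2 ((1%:M - B) *m A).
    rewrite /frob2 adjmxM Ba Aa mulmxA -[A *m _ *m _]mulmxA BB [RHS]mxtrace_mulC.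
    by rewrite mulmxA AA mulmxBr mulmx1 linearB.
  exact: frob2_ge0.
have h1 := le1 _ _ pP pQ; have h2 := le1 _ _ pQ pP; rewrite mxtrace_mulC in h2.
have [p Ep] := projection_trace_nat pP; have [q Eq] := projection_trace_nat pQ.
rewrite E; move: h1 h2; rewrite Ep Eq; set x := \tr _ => h1 h2.
have [le_qp|/ltnW le_pq] := leqP q p.
  rewrite ger0_norm ?subr_ge0 ?ler_nat // -subr_ge0.
  have -> : p%:R + q%:R - 2 * x - (p%:R - q%:R) = 2 * (q%:R - x) by ring.
  by rewrite mulr_ge0 // subr_ge0.
rewrite distrC ger0_norm ?subr_ge0 ?ler_nat // -subr_ge0.
have -> : p%:R + q%:R - 2 * x - (q%:R - p%:R) = 2 * (p%:R - x) by ring.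
by rewrite mulr_ge0 // subr_ge0.
Qed.

(** After conjugating one projection by [t], the difference is an average of [e] terms whose squared
    norms all occur in the sum on the right; the constant comes from [frob2_sum] over these
    terms. *)
Lemma eigen_proj_dist n (a b : H -> 'M[C]_n) (t : 'M[C]_n) h r :
  urep a -> urep b -> t \is unitarymx -> r ^+ e = 1 ->
  `|\tr (eigen_proj a h r) - \tr (eigen_proj b h r)| <=
  (2 ^ e * e)%:R * \sum_g frob2 (a g *m t - t *m b g).
Proof.
move=> ra rb tu re; set E := \sum_g _.
have nr : `|r| = 1.
  have : `|r| ^+ e = 1 by rewrite -normrX re normr1.
  by move/eqP; rewrite pexprn_eq1 // => /orP[|/eqP ->//]; rewrite gtn_eqF.
pose b' h := t *m b h *m t ^t*.
have Et : \tr (eigen_proj b h r) = \tr (t *m eigen_proj b h r *m t ^t*).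
  by rewrite mxtrace_mulC mulmxA unitarymx_adjl // mul1mx.
have pb : projection (t *m eigen_proj b h r *m t ^t*).
  have [pa pp] := eigen_proj_projection h rb re; split.
    by rewrite !adjmxM adjmxK pa mulmxA.
  rewrite -!mulmxA [t ^t* *m (t *m _)]mulmxA unitarymx_adjl // mul1mx.
  by rewrite [eigen_proj _ _ _ *m (_ *m _)]mulmxA pp.
rewrite Et; apply: le_trans (projection_trace_dist (eigen_proj_projection h ra re) pb) _.
rewrite -(frob2_Munit _ tu) mulmxBl -[_ *m t ^t* *m t]mulmxA unitarymx_adjl // mulmx1.
rewrite /eigen_proj -scalemxAl -scalemxAr -scalerBr frob2Z mulmx_suml mulmx_sumr -sumrB.
have E0 : 0 <= E by apply: sumr_ge0 => g _; exact: frob2_ge0.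
apply: le_trans (_ : 1 * (2 ^ e * e)%:R * E <= _); last by rewrite mul1r.
rewrite -mulrA; apply: ler_pM; rewrite ?exprn_ge0 ?frob2_ge0 //.
  rewrite exprn_ile1 // ger0_norm ?invr_ge0 ?ler0n // invf_le1 ?ltr0n //.
  by rewrite ler1n.
apply: le_trans (frob2_sum _ _) _; rewrite natrM natrX -mulrA.
rewrite (_ : size _ = e); last by rewrite /index_enum -enumT -cardE card_ord.
rewrite ler_pM2l ?exprn_gt0 //.
apply: le_trans (_ : \sum_(k < e) E <= _); last by rewrite sumr_const card_ord mulr_natl.
apply: ler_sum => k _.
have -> : r^-1 ^+ k *: a (h ^+ k)%g *m t - t *m (r^-1 ^+ k *: b (h ^+ k)%g) =
    r^-1 ^+ k *: (a (h ^+ k)%g *m t - t *m b (h ^+ k)%g).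
  by rewrite -scalemxAl -scalemxAr scalerBr.
rewrite frob2Z normrX normfV nr invr1 !expr1n mul1r /E (bigD1 (h ^+ k)%g) //=.
by rewrite lerDl sumr_ge0 // => g _; exact: frob2_ge0.
Qed.

Lemma roots_of_unity_seq : exists2 rts : seq C, uniq rts &
  forall z, (z \in rts) = (z ^+ e == 1).
Proof.
have [rs E] := closed_field_poly_normal ('X^e - 1 : {poly C}).
exists (undup rs); first exact: undup_uniq.
move=> z; rewrite mem_undup -root_prod_XsubC.
have -> : \prod_(z0 <- rs) ('X - z0%:P) = 'X^e - 1.
  by rewrite [RHS]E (monicP (monicXnsubC 1 e_gt0)) scale1r.
by rewrite rootE !hornerE subr_eq0.
Qed.

End EigenProjections.

(** * Class averages and types *)

Section ClassAverages.
Variables (C : numClosedFieldType) (G : groupType) (S : seq G).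
Hypothesis SJ : forall s g, s \in S -> (s ^ g)%g \in S.

Definition conj_class (s : G) : seq G :=
  [seq y <- undup S | `[< exists g, y = (s ^ g)%g >]].

(** The average rather than the sum over the class, so that a trivial representation has eigenvalue
    1 for every [s]. *)
Definition class_avg n (psi : G -> 'M[C]_n) s : 'M[C]_n :=
  (size (conj_class s))%:R^-1 *: \sum_(y <- conj_class s) psi y.

Lemma conj_classP s y : s \in S -> reflect (exists g, y = (s ^ g)%g) (y \in conj_class s).
Proof.
move=> sS; rewrite mem_filter mem_undup; apply: (iffP andP) => [[/asboolP //]|ex].
by split; [apply/asboolP|case: ex => g ->; exact: SJ].
Qed.

Lemma size_conj_class_gt0 s : s \in S -> (0 < size (conj_class s))%N.
Proof.
move=> sS; have : s \in conj_class s.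
  by apply/conj_classP => //; exists 1%g; rewrite conjg1.
by case: (conj_class s).
Qed.

Lemma conj_class_perm s g : s \in S ->
  perm_eq (conj_class s) [seq (y ^ g)%g | y <- conj_class s].
Proof.
move=> sS; apply: uniq_perm; first by rewrite filter_uniq // undup_uniq.
  by rewrite map_inj_uniq; [rewrite filter_uniq // undup_uniq|exact: conjg_inj].
move=> y; apply/conj_classP/mapP => // [[h ->]|[z /conj_classP -/(_ sS)[h ->] ->]].
  exists (s ^ (h * g^-1))%g; last by rewrite -conjgM mulgVK.
  by apply/conj_classP => //; exists (h * g^-1)%g.
by exists (h * g)%g; rewrite conjgM.
Qed.

Section Rep.
Variables (n : nat) (psi : G -> 'M[C]_n).
Hypothesis rpsi : urep psi.

Lemma class_avg_comm s g : s \in S -> psi g *m class_avg psi s = class_avg psi s *m psi g.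
Proof.
move=> sS; rewrite /class_avg -scalemxAr -scalemxAl; congr (_ *: _).
rewrite mulmx_sumr mulmx_suml (perm_big _ (conj_class_perm g sS)) /= big_map.
by apply: eq_bigr => y _; rewrite -!(proj2 rpsi) conjgE mulVKg.
Qed.

Lemma comm_class_avg (X : 'M[C]_n) s :
  (forall g, psi g *m X = X *m psi g) -> class_avg psi s *m X = X *m class_avg psi s.
Proof.
move=> psiX; rewrite /class_avg -scalemxAr -scalemxAl; congr (_ *: _).
by rewrite mulmx_sumr mulmx_suml; apply: eq_bigr.
Qed.

(** The character is constant on the class, so its values on [S] can be read off from the
    eigenvalues of the averages. *)
Lemma mxtrace_class_avg s : s \in S -> \tr (class_avg psi s) = \tr (psi s).
Proof.
move=> sS; rewrite /class_avg linearZ linear_sum /= big_seq.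
rewrite (eq_bigr (fun=> \tr (psi s))); last first.
  move=> y /conj_classP -/(_ sS)[g ->].
  rewrite conjgE !(proj2 rpsi) (urepV _ rpsi) mxtrace_mulC -mulmxA.
  by rewrite unitarymx_adjr ?mulmx1 //; case: rpsi.
rewrite -big_seq big_const_seq count_predT iter_addr addr0 -[\tr _ *+ _]mulr_natl mulKf //.
by rewrite pnatr_eq0 -lt0n size_conj_class_gt0.
Qed.

End Rep.

Variable F : seq G.
Hypotheses (F1 : 1%g \in F) (SF : forall s x, s \in S -> x \in F -> (s * x)%g \in F).

(* On the span of the vectors [v *m psi f], [f \in F], the class average acts by
   a matrix that does not depend on the representation. *)
Lemma class_avg_eigenvalue s : s \in S -> exists ev : seq C,
  forall n (psi : G -> 'M[C]_n) (v : 'rV_n) a,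
    urep psi -> v != 0 -> v *m class_avg psi s = a *: v -> a \in ev.
Proof.
move=> sS; pose N := #|{: seq_sub F}|.
pose f (i : 'I_N) : G := val (enum_val i).
pose M : 'M[C]_N := \matrix_(i, j)
  ((size (conj_class s))%:R^-1 * \sum_(y <- conj_class s) ((y * f i)%g == f j)%:R).
have [ev evE] := closed_field_poly_normal (char_poly M^T).
exists ev => n psi v a rpsi v0 va.
have : root (char_poly M^T) a.
  rewrite -eigenvalue_root_char; apply/eigenvalueP.
  pose X : 'M[C]_(N, n) := \matrix_i (v *m psi (f i)).
  (* Row i of [X] is [v *m psi (f i)], and left multiplication by the class permutes these rows as
     [M] prescribes. A nonzero column of [X], which exists since [v] itself is a row, is then an
     eigenvector of [M]. *)
  have MX : M *m X = a *: X.
    apply/row_matrixP => i; rewrite row_mul mulmx_sum_row linearZ /= rowK.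
    rewrite [RHS]scalemxAl -va /class_avg -scalemxAr -scalemxAl mulmx_sumr mulmx_suml.
    under eq_bigr do rewrite rowK [row _ _ _ _]mxE [M _ _]mxE -scalerA scaler_suml.
    rewrite -scaler_sumr exchange_big /=; congr (_ *: _); rewrite big_seq [RHS]big_seq.
    apply: eq_bigr => y /conj_classP -/(_ sS)[g yE].
    have yfF : (y * f i)%g \in F.
      by apply: SF; [rewrite yE SJ|exact: valP].
    pose j := enum_rank (SeqSub yfF : seq_sub F).
    have fj : f j = (y * f i)%g by rewrite /f enum_rankK.
    rewrite (bigD1 j) //= fj eqxx scale1r (proj2 rpsi) mulmxA big1 ?addr0 // => k kj.
    rewrite (_ : _ == _ = false) ?scale0r //; apply: contraNF kj => /eqP E.
    by apply/eqP/enum_val_inj/val_inj; rewrite -[LHS]/(f k) -[RHS]/(f j) fj.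
  have [j Xj] : exists j, col j X != 0.
    apply: contrapT => no; case/eqP: v0; apply/rowP => j; rewrite mxE.
    pose i := enum_rank (SeqSub F1 : seq_sub F).
    have fi : f i = 1%g by rewrite /f enum_rankK.
    have : col j X = 0 by apply/eqP; apply: contraT => Xj; case: no; exists j.
    by move=> /colP/(_ i); rewrite mxE [X _ _]mxE fi (urep1 rpsi) mulmx1 mxE.
  exists (col j X)^T; last by rewrite -(trmx0 _ N 1) (inj_eq trmx_inj).
  by rewrite tr_col -row_mul -trmx_mul MX !linearZ.
rewrite evE (monicP (char_poly_monic _)) scale1r root_prod_XsubC.
by [].
Qed.

Lemma class_avg_eigenvalues : exists ev : seq C, 1 \in ev /\
  forall s n (psi : G -> 'M[C]_n) (v : 'rV_n) a, s \in S ->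
    urep psi -> v != 0 -> v *m class_avg psi s = a *: v -> a \in ev.
Proof.
suff [ev evP] : exists ev : seq C, forall s n (psi : G -> 'M[C]_n) (v : 'rV_n) a,
    s \in S -> urep psi -> v != 0 -> v *m class_avg psi s = a *: v -> a \in ev.
  exists (1 :: ev); split; first exact: mem_head.
  by move=> s n psi v a sS rpsi v0 /(evP s n psi v a sS rpsi v0); rewrite inE orbC => ->.
suff : forall r : seq G, {subset r <= S} -> exists ev : seq C,
    forall s n (psi : G -> 'M[C]_n) (v : 'rV_n) a, s \in r ->
    urep psi -> v != 0 -> v *m class_avg psi s = a *: v -> a \in ev by apply.
elim=> [_|s r IH rS]; first by exists [::].
have [ev1 ev1P] := class_avg_eigenvalue (rS s (mem_head _ _)).
have [|ev2 ev2P] := IH; first by move=> x xr; apply: rS; rewrite inE xr orbT.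
exists (ev1 ++ ev2) => s' n psi v a; rewrite inE mem_cat => /orP[/eqP ->|s'r] rpsi v0 va.
  by rewrite (ev1P n psi v a).
by rewrite (ev2P s' n psi v a) // orbT.
Qed.

End ClassAverages.

Section BlockRep.
Variable C : numClosedFieldType.

Definition dsum_mx m n (A : 'M[C]_m) (B : 'M[C]_n) : 'M[C]_(m + n) := block_mx A 0 0 B.

Lemma dsum_mxM m n (A A' : 'M[C]_m) (B B' : 'M[C]_n) :
  dsum_mx A B *m dsum_mx A' B' = dsum_mx (A *m A') (B *m B').
Proof. by rewrite /dsum_mx mulmx_block !mulmx0 !mul0mx !addr0 add0r. Qed.

Lemma dsum_mx_adj m n (A : 'M[C]_m) (B : 'M[C]_n) :
  (dsum_mx A B) ^t* = dsum_mx (A ^t*) (B ^t*).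
Proof. by rewrite /dsum_mx tr_block_mx map_block_mx !trmx0 !map_mx0. Qed.

Lemma dsum_mx1 m n : dsum_mx 1%:M 1%:M = 1%:M :> 'M[C]_(m + n).
Proof. by rewrite /dsum_mx -scalar_mx_block. Qed.

Lemma dsum_mxD m n (A A' : 'M[C]_m) (B B' : 'M[C]_n) :
  dsum_mx A B + dsum_mx A' B' = dsum_mx (A + A') (B + B').
Proof. by rewrite /dsum_mx add_block_mx !addr0. Qed.

Lemma dsum_mxZ m n a (A : 'M[C]_m) (B : 'M[C]_n) :
  a *: dsum_mx A B = dsum_mx (a *: A) (a *: B).
Proof. by rewrite /dsum_mx scale_block_mx !scaler0. Qed.

Lemma dsum_mxB m n (A A' : 'M[C]_m) (B B' : 'M[C]_n) :
  dsum_mx A B - dsum_mx A' B' = dsum_mx (A - A') (B - B').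
Proof. by rewrite -scaleN1r dsum_mxZ dsum_mxD !scaleN1r. Qed.

Lemma dsum_mx_sum m n I (r : seq I) (A : I -> 'M[C]_m) (B : I -> 'M[C]_n) :
  \sum_(i <- r) dsum_mx (A i) (B i) = dsum_mx (\sum_(i <- r) A i) (\sum_(i <- r) B i).
Proof.
elim: r => [|i r IH]; last by rewrite !big_cons IH dsum_mxD.
by rewrite !big_nil /dsum_mx block_mx0.
Qed.

Lemma dsum_mx_unitary m n (A : 'M[C]_m) (B : 'M[C]_n) :
  A \is unitarymx -> B \is unitarymx -> dsum_mx A B \is unitarymx.
Proof.
move=> Au Bu; apply/unitarymxP.
by rewrite dsum_mx_adj dsum_mxM !unitarymx_adjr // dsum_mx1.
Qed.

Lemma mxtrace_dsum m n (A : 'M[C]_m) (B : 'M[C]_n) :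
  \tr (dsum_mx A B) = \tr A + \tr B.
Proof. exact: mxtrace_block. Qed.

Lemma frob2_dsum m n (A : 'M[C]_m) (B : 'M[C]_n) :
  frob2 (dsum_mx A B) = frob2 A + frob2 B.
Proof. by rewrite /dsum_mx frob2_block !frob20 addr0 add0r. Qed.

Lemma urep_dsum (G : groupType) m n (a : G -> 'M[C]_m) (b : G -> 'M[C]_n) :
  urep a -> urep b -> urep (fun g => dsum_mx (a g) (b g)).
Proof.
move=> [au aM] [bu bM]; split=> [g|g h]; first exact: dsum_mx_unitary.
by rewrite aM bM dsum_mxM.
Qed.

Definition split_fun (X : Type) m n (f : 'I_m -> X) (g : 'I_n -> X) (k : 'I_(m + n)) : X :=
  match fintype.split k with inl i => f i | inr j => g j end.

Lemma udiag_dsum m n (U : 'M[C]_m) (U' : 'M[C]_n) d d' :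
  dsum_mx (udiag U d) (udiag U' d') = udiag (dsum_mx U U') (split_fun d d').
Proof.
rewrite /udiag dsum_mx_adj.
have -> : diag_mx (\row_k split_fun d d' k) =
    dsum_mx (diag_mx (\row_i d i)) (diag_mx (\row_i d' i)).
  rewrite /dsum_mx -diag_mx_row; congr diag_mx; apply/rowP => k.
  by rewrite !mxE /split_fun; case: splitP => j _; rewrite mxE.
by rewrite !dsum_mxM.
Qed.

End BlockRep.

(** The rule behind keeping a representation on the range of [P] and making it trivial on the
    complement. *)
Lemma compress_mul (C : numClosedFieldType) n (P A B : 'M[C]_n) : projection P ->
  A *m P = P *m A ->
  (P *m A + (1%:M - P)) *m (P *m B + (1%:M - P)) = P *m (A *m B) + (1%:M - P).
Proof.
move=> pP AP; have PP := proj2 pP; have QQ := proj2 (projectionC pP).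
have [Q Qdef] : exists Q, Q = 1%:M - P by exists (1%:M - P).
have PQ : P *m Q = 0 by rewrite Qdef mulmxBr mulmx1 PP subrr.
have QP : Q *m P = 0 by rewrite Qdef mulmxBl mul1mx PP subrr.
have AQ : A *m Q = Q *m A by rewrite Qdef mulmxBr mulmx1 mulmxBl mul1mx AP.
rewrite -Qdef in QQ *; rewrite mulmxDl !mulmxDr QQ.
have -> : P *m A *m Q = 0 by rewrite -mulmxA AQ mulmxA PQ mul0mx.
have -> : Q *m (P *m B) = 0 by rewrite mulmxA QP mul0mx.
have -> : P *m A *m (P *m B) = P *m (A *m B).
  by rewrite mulmxA -[P *m A *m _]mulmxA AP !mulmxA PP.
by rewrite addr0 add0r.
Qed.

(** * Types of vectors in a unitary representation *)

Section Typing.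
Variables (C : numClosedFieldType) (G : groupType) (S : seq G) (ev : seq C).
Hypothesis SJ : forall s g, s \in S -> (s ^ g)%g \in S.
Hypothesis ev1 : 1 \in ev.
Hypothesis evP : forall s n (psi : G -> 'M[C]_n) (v : 'rV_n) a, s \in S ->
  urep psi -> v != 0 -> v *m class_avg S psi s = a *: v -> a \in ev.

Let T := seq_sub S.
Let I := {ffun T -> seq_sub ev}.

Definition trivial_type : I := [ffun=> SeqSub ev1].

(** The rows of [U] form an orthonormal basis of joint eigenvectors of the class averages, and [tau]
    lists their joint eigenvalues. *)
Definition typing n (psi : G -> 'M[C]_n) (U : 'M[C]_n) (tau : 'I_n -> I) :=
  [/\ urep psi, U \is unitarymx &
      forall s : T, class_avg S psi (val s) = udiag U (fun i => val (tau i s))].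

(** A class average commutes with all [psi g], hence with the other averages and with their
    adjoints. *)
Lemma typing_exists n (psi : G -> 'M[C]_n) : urep psi ->
  exists U tau, typing psi U tau.
Proof.
move=> rpsi; pose c (s : T) := class_avg S psi (val s).
have cA s (X : 'M[C]_n) : (forall g, psi g *m X = X *m psi g) -> c s *m X = X *m c s.
  exact: comm_class_avg.
have cc (s : T) g : psi g *m c s = c s *m psi g by apply: class_avg_comm => //; exact: valP.
have [||U Uu Ud] := @codiagonalization _ n [seq c s | s <- enum {: T}].
- by move=> _ _ /mapP[s _ ->] /mapP[t _ ->]; exact/cA/cc.
- move=> _ _ /mapP[s _ ->] /mapP[t _ ->]; apply: cA => g.
  have := congr1 (fun A => A ^t*) (cc t g^-1%g).
  by rewrite !adjmxM !(urepV _ rpsi) adjmxK => ->.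
have ex s : exists d : 'I_n -> C, c s = udiag U d.
  have [|d ->] := Ud (c s); first by apply: map_f; rewrite mem_enum.
  exists (d 0); rewrite /udiag; congr (_ *m diag_mx _ *m _).
  by apply/rowP => i; rewrite mxE.
have [d dE] := boolp.choice ex.
have dev s i : d s i \in ev.
  (* Row i of [U] is a left eigenvector, and it is nonzero because [U] is unitary. *)
  apply: (@evP (val s) n psi (row i U)) => //; first exact: valP.
    apply: contraTneq (ltr01 : 0 < 1 :> C) => Ui0.
    have := congr1 (fun A : 'M[C]_n => A i i) (unitarymx_adjr Uu).
    rewrite mxE [RHS]mxE eqxx mulr1n big1 => [<-|k _]; first by rewrite ltxx.
    by have /rowP/(_ k) := Ui0; rewrite !mxE => ->; rewrite mul0r.
  rewrite -/(c s) dE -row_mul /udiag !mulmxA unitarymx_adjr // mul1mx.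
  by rewrite row_mul row_diag_mx mxE -scalemxAl -rowE.
exists U, (fun i => [ffun s => SeqSub (dev s i)]); split=> // s.
rewrite -/(c s) dE; congr (udiag U _); apply/funext => i.
by rewrite ffunE.
Qed.

Definition type_weight n (tau : 'I_n -> I) (O : I) : nat :=
  if O == trivial_type then 0%N else #|[set i | tau i == O]|.

Section Restriction.
Variables (n : nat) (psi : G -> 'M[C]_n) (U : 'M[C]_n) (tau : 'I_n -> I).
Hypothesis tpsi : typing psi U tau.
Variable J : {set I}.

Definition kept_type i := (tau i \in J) || (tau i == trivial_type).
Definition kept_proj : 'M[C]_n := udiag U (fun i => (kept_type i)%:R).
Definition restr_rep g := kept_proj *m psi g + (1%:M - kept_proj).
Definition restr_type i := if kept_type i then tau i else trivial_type.

Let Uu : U \is unitarymx. Proof. by case: tpsi. Qed.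
Let rpsi : urep psi. Proof. by case: tpsi. Qed.

Lemma kept_proj_projection : projection kept_proj.
Proof.
split; first by rewrite udiag_adj; congr (udiag U _); apply/funext => i; rewrite conjC_nat.
by rewrite udiagM //; congr (udiag U _); apply/funext => i; rewrite -natrM mulnb andbb.
Qed.

(** The projection is a function of the joint eigenvalues of the averages, with which [psi g]
    commutes. *)
Lemma kept_proj_comm g : psi g *m kept_proj = kept_proj *m psi g.
Proof.
apply: (@udiag_comm _ _ _ Uu T (fun s i => val (tau i s))) => [s|i j E].
  by case: tpsi => _ _ <-; apply: class_avg_comm => //; exact: valP.
suff -> : kept_type i = kept_type j by [].
rewrite /kept_type (_ : tau i = tau j) //.
by apply/ffunP => s; apply: val_inj; exact: E.
Qed.

Lemma restr_rep_urep : urep restr_rep.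
Proof.
have [Pa PP] := kept_proj_projection; case: rpsi => pu pM.
have Qa := proj1 (projectionC kept_proj_projection).
have key A B := @compress_mul _ _ _ A B kept_proj_projection.
split=> [g|g h]; last by rewrite /restr_rep key ?pM //; exact: kept_proj_comm.
apply/unitarymxP; have -> : (restr_rep g) ^t* = restr_rep g^-1%g.
  by rewrite /restr_rep adjmxD adjmxM Pa Qa -(urepV _ rpsi) kept_proj_comm.
rewrite /restr_rep key ?kept_proj_comm // -pM mulgV (urep1 rpsi) mulmx1.
by rewrite addrC subrK.
Qed.

Lemma restr_rep_typing : typing restr_rep U restr_type.
Proof.
split=> //; first exact: restr_rep_urep.
move=> s; have sS : val s \in S by exact: valP.
have -> : class_avg S restr_rep (val s) =
    kept_proj *m class_avg S psi (val s) + (1%:M - kept_proj).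
  rewrite /class_avg /restr_rep big_split /= -mulmx_sumr scalerDr -scalemxAr.
  congr (_ + _); rewrite big_const_seq count_predT iter_addr addr0.
  rewrite -[(1%:M - _) *+ _]scaler_nat scalerA mulVf ?scale1r //.
  by rewrite pnatr_eq0 -lt0n size_conj_class_gt0.
case: tpsi => _ _ ->; rewrite /kept_proj udiagM // -(udiag1 Uu) udiagB udiagD.
congr (udiag U _); apply/funext => i; rewrite /restr_type; case: kept_type.
  by rewrite mul1r subrr addr0.
by rewrite mul0r subr0 add0r ffunE.
Qed.

Lemma type_weight_restr O : type_weight restr_type O = ((O \in J) * type_weight tau O)%N.
Proof.
rewrite /type_weight; case: ifPn => [_|OT]; first by rewrite muln0.
have [OJ|OJ] := boolP (O \in J).
  rewrite mul1n; apply: eq_card => i; rewrite !inE /restr_type /kept_type.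
  case: ifP => // /negbT; rewrite negb_or => /andP[nJ _].
  rewrite eq_sym (negbTE OT); apply/esym/negbTE; apply: contraNneq nJ => ->.
  exact: OJ.
apply/eqP; rewrite mul0n cards_eq0; apply/eqP/setP => i; rewrite !inE /restr_type /kept_type.
apply/negbTE; case: ifP => [/orP[tJ|/eqP ->]|_]; last 2 first.
- by rewrite eq_sym.
- by rewrite eq_sym.
by apply: contraNneq OJ => <-.
Qed.

(** With Q the complementary projection the difference is Q psi(g) - Q, and both terms have squared
    norm tr Q, the number of discarded basis vectors. *)
Lemma frob2_restr g :
  frob2 (psi g - restr_rep g) <= 4 * (\sum_(O | O \notin J) type_weight tau O)%N%:R.
Proof.
have pQ := projectionC kept_proj_projection; case: rpsi => pu _.
have -> : psi g - restr_rep g = (1%:M - kept_proj) *m (psi g) - (1%:M - kept_proj).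
  by rewrite /restr_rep mulmxBl mul1mx opprD addrA.
apply: le_trans (frob2D _ _) _; rewrite frob2N frob2_Munit //.
have -> : (4 : C) = 2 * 2 by rewrite -natrM.
have nQ : frob2 (1%:M - kept_proj) = (\sum_(O | O \notin J) type_weight tau O)%N%:R.
  rewrite frob2_projection // /kept_proj -(udiag1 Uu) udiagB mxtrace_udiag //.
  rewrite (eq_bigr (fun i => (~~ kept_type i)%:R)) => [|i _]; last first.
    by case: kept_type; rewrite ?subrr ?subr0.
  rewrite -natr_sum; congr (_%:R).
  rewrite [RHS](eq_bigr (fun O => \sum_i ((O != trivial_type) && (tau i == O)))%N); last first.
    move=> O _; rewrite /type_weight; case: eqP => [_|_] /=; first by rewrite big1.
    by rewrite -sum1_card big_mkcond /=; apply: eq_bigr => i _; rewrite inE; case: eqP.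
  rewrite exchange_big /=; apply: eq_bigr => i _.
  rewrite /kept_type negb_or; have [tJ|tJ] := boolP (tau i \in J).
    rewrite /= big1 // => O OJ; rewrite [tau i == O](_ : _ = false) ?andbF //.
    by apply: contraNF OJ => /eqP <-.
  rewrite /= (bigD1 (tau i)) //= eqxx andbT big1 => [|O /andP[_]].
    by case: (_ == _).
  by rewrite eq_sym => /negbTE ->; rewrite andbF.
by rewrite nQ -mulrA ler_pM2l // mulr_natl mulr2n.
Qed.

End Restriction.

Lemma typing_trace n (psi : G -> 'M[C]_n) U tau (s : T) : typing psi U tau ->
  \tr (psi (val s)) = \sum_i val (tau i s).
Proof.
case=> rpsi Uu tE; rewrite -(mxtrace_class_avg SJ rpsi (valP s)).
by rewrite tE mxtrace_udiag.
Qed.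

Lemma sum_type_weight n (tau : 'I_n -> I) (f : I -> C) : f trivial_type = 0 ->
  \sum_i f (tau i) = \sum_O (type_weight tau O)%:R * f O.
Proof.
move=> f0; rewrite (partition_big tau predT) //=; apply: eq_bigr => O _.
rewrite (eq_bigr (fun=> f O)); last by move=> i /eqP ->.
rewrite sumr_const [RHS]mulr_natl /type_weight.
have [->|_] := eqVneq O trivial_type; first by rewrite f0 !mul0rn.
by rewrite cardsE.
Qed.

Lemma typing_dsum m n (psi : G -> 'M[C]_m) (psi' : G -> 'M[C]_n) U U' tau tau' :
  typing psi U tau -> typing psi' U' tau' ->
  typing (fun g => dsum_mx (psi g) (psi' g)) (dsum_mx U U') (split_fun tau tau').
Proof.
move=> [rpsi Uu tE] [rpsi' Uu' tE']; split.
- exact: urep_dsum.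
- exact: dsum_mx_unitary.
move=> s; rewrite /class_avg dsum_mx_sum dsum_mxZ -!/(class_avg S _ _) tE tE' udiag_dsum.
congr (udiag _ _); apply/funext => k; rewrite /split_fun.
by case: fintype.split.
Qed.

Lemma type_weight_dsum m n (tau : 'I_m -> I) (tau' : 'I_n -> I) O :
  type_weight (split_fun tau tau') O = (type_weight tau O + type_weight tau' O)%N.
Proof.
rewrite /type_weight; case: ifP => // _.
rewrite -!sum1_card big_mkcond big_split_ord /= -!big_mkcond /=.
rewrite /split_fun; congr (_ + _)%N; apply: eq_bigl => i; rewrite !inE.
  by rewrite -[lshift _ _]/(unsplit (inl i)) unsplitK.
by rewrite -[rshift _ _]/(unsplit (inr i)) unsplitK.
Qed.

End Typing.

(** * Correction of unitary representations *)

Section UnitaryCorrection.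
Variables (C : numClosedFieldType) (G : groupType) (H : finGroupType).
Variables (i1 i2 : H -> G) (S : seq G) (ev rts : seq C).
Hypotheses (i1M : ghom i1) (i2M : ghom i2).
Hypotheses (SJ : forall s g, s \in S -> (s ^ g)%g \in S).
Hypotheses (i1S : forall h, i1 h \in S) (i2S : forall h, i2 h \in S).
Hypothesis ev1 : 1 \in ev.
Hypothesis evP : forall s n (psi : G -> 'M[C]_n) (v : 'rV_n) a, s \in S ->
  urep psi -> v != 0 -> v *m class_avg S psi s = a *: v -> a \in ev.
Hypotheses (rts_uniq : uniq rts)
  (rtsP : forall z, (z \in rts) = (z ^+ #|H| == 1)).

Let I := {ffun seq_sub S -> seq_sub ev}.
Let K := (H * seq_sub rts)%type.

Let rootP (r : seq_sub rts) : val r ^+ #|H| = 1.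
Proof. by apply/eqP; rewrite -rtsP; exact: valP. Qed.

Definition eigen_diff n (psi : G -> 'M[C]_n) (k : K) : C :=
  \tr (eigen_proj (psi \o i1) k.1 (val k.2)) -
  \tr (eigen_proj (psi \o i2) k.1 (val k.2)).

(** The share of one basis vector of type [O] in [eigen_diff], found by expanding the
    eigenprojections and reading each trace from the class averages. A priori it is only a complex
    number. *)
Definition eigen_slope (k : K) (O : I) : C := #|H|%:R^-1 *
  \sum_(j < #|H|) (val k.2)^-1 ^+ j *
    (val (O (SeqSub (i1S (k.1 ^+ j)%g))) - val (O (SeqSub (i2S (k.1 ^+ j)%g)))).

Lemma urep_comp n (psi : G -> 'M[C]_n) (i : H -> G) : ghom i -> urep psi -> urep (psi \o i).
Proof. by move=> iM [pu pM]; split=> [h|h h'] /=; rewrite ?iM ?pM. Qed.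

Lemma eigen_diffE n (psi : G -> 'M[C]_n) U tau k : typing psi U tau ->
  eigen_diff psi k = \sum_O (type_weight ev1 tau O)%:R * eigen_slope k O.
Proof.
move=> tpsi; rewrite -sum_type_weight; last first.
  by rewrite /eigen_slope big1 ?mulr0 // => j _; rewrite !ffunE subrr mulr0.
rewrite /eigen_diff /eigen_proj !mxtraceZ !raddf_sum /= -mulrBr -sumrB.
rewrite /eigen_slope -mulr_sumr exchange_big /=; congr (_ * _); apply: eq_bigr => j _.
rewrite !mxtraceZ -mulrBr -mulr_sumr sumrB; congr (_ * (_ - _)).
  exact: (typing_trace SJ (SeqSub (i1S (k.1 ^+ j)%g)) tpsi).
exact: (typing_trace SJ (SeqSub (i2S (k.1 ^+ j)%g)) tpsi).
Qed.

Lemma eigen_diff_int n (psi : G -> 'M[C]_n) k : urep psi ->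
  exists z : int, eigen_diff psi k = z%:~R.
Proof.
move=> rpsi.
have [p Ep] := projection_trace_nat (eigen_proj_projection k.1 (urep_comp i1M rpsi) (rootP k.2)).
have [q Eq] := projection_trace_nat (eigen_proj_projection k.1 (urep_comp i2M rpsi) (rootP k.2)).
by exists (p%:Z - q%:Z); rewrite /eigen_diff Ep Eq intrB.
Qed.

Lemma eigen_diff_dsum m n (psi : G -> 'M[C]_m) (psi' : G -> 'M[C]_n) k :
  eigen_diff (fun g => dsum_mx (psi g) (psi' g)) k = eigen_diff psi k + eigen_diff psi' k.
Proof.
have E (i : H -> G) : eigen_proj ((fun g => dsum_mx (psi g) (psi' g)) \o i) k.1 (val k.2) =
    dsum_mx (eigen_proj (psi \o i) k.1 (val k.2)) (eigen_proj (psi' \o i) k.1 (val k.2)).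
  rewrite /eigen_proj -dsum_mxZ -dsum_mx_sum; congr (_ *: _).
  by apply: eq_bigr => j _; rewrite /= dsum_mxZ.
by rewrite /eigen_diff !E !mxtrace_dsum; ring.
Qed.

(* The slopes are rational: each type carried by some representation is carried,
   up to trivial constituents, by its own isotypic part, where the multiplicity
   differences are integers. *)
Lemma integral_slopes : exists (q : nat) (s : K -> I -> int), (0 < q)%N /\
  forall n (psi : G -> 'M[C]_n) U tau k, typing psi U tau ->
    (functional (s k) (type_weight ev1 tau))%:~R = q%:R * eigen_diff psi k.
Proof.
pose real (O : I) := exists n (psi : G -> 'M[C]_n) U tau,
  typing psi U tau /\ (0 < type_weight ev1 tau O)%N.
have ex O : exists x : nat * (K -> int), (0 < x.1)%N /\
    (real O -> forall k, x.1%:R * eigen_slope k O = (x.2 k)%:~R).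
  (* The slope of a type that no representation carries may be chosen freely, as it is always
     multiplied by weight 0. *)
  have [[n [psi [U [tau [tpsi wO]]]]]|nreal] := pselect (real O); last by exists (1%N, fun=> 0).
  have tO := restr_rep_typing SJ ev1 tpsi [set O].
  have [z zE] := boolp.choice (fun k => eigen_diff_int k (restr_rep_urep SJ ev1 tpsi [set O])).
  (* In the restriction to [O] no other nontrivial type is left, so the integer [eigen_diff] is the
     weight of [O] times its slope; this weight is a denominator. *)
  exists (type_weight ev1 tau O, z); split=> //= _ k.
  rewrite -zE (eigen_diffE k tO) (bigD1 O) //= big1 ?addr0 => [|O' O'O].
    by rewrite type_weight_restr inE eqxx mul1n.
  by rewrite type_weight_restr inE (negbTE O'O) mul0n mul0r.
have [x xP] := boolp.choice ex.
pose q := (\prod_O (x O).1)%N.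
have qO O : q = ((\prod_(O' | O' != O) (x O').1) * (x O).1)%N.
  by rewrite /q (bigD1 O) //= mulnC.
exists q, (fun k O => (\prod_(O' | O' != O) (x O').1)%N%:Z * (x O).2 k); split.
  by rewrite prodn_gt0 // => O; case: (xP O).
move=> n psi U tau k tpsi; rewrite (eigen_diffE k tpsi) mulr_sumr.
rewrite /functional (big_morph (fun z : int => z%:~R : C) (@intrD C) (erefl _)).
apply: eq_bigr => O _; rewrite !intrM /=.
have [->|w0] := posnP (type_weight ev1 tau O); first by rewrite !mul0r mulr0.
have rO : real O by exists n, psi, U, tau.
by rewrite -(proj2 (xP O) rO k) (qO O) natrM; ring.
Qed.

(** [weight_correction] for the integral slopes, which measure [q] times the dimension differences;
    hence the factor [q] in the constant. *)
Lemma eigen_diff_correction : exists c : nat, forall n (psi : G -> 'M[C]_n), urep psi ->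
  exists (U : 'M[C]_n) (tau : 'I_n -> I) (J : {set I}) (n' : nat) (rho : G -> 'M[C]_n'),
    let D := \sum_k `|eigen_diff psi k| in
    [/\ typing psi U tau, urep rho, (\sum_(O | O \notin J) type_weight ev1 tau O)%N%:R <= c%:R * D,
        n'%:R <= c%:R * D &
        forall k, eigen_diff (restr_rep ev1 psi U tau J) k + eigen_diff rho k = 0].
Proof.
have [q [s [q0 sE]]] := integral_slopes.
pose P (w : I -> nat) (d : nat) := exists (psi : G -> 'M[C]_d) U tau,
  typing psi U tau /\ w = type_weight ev1 tau.
have [|||c cP] := @weight_correction I K s P.
- have r1 : urep (fun _ : G => 1%:M : 'M[C]_0).
    by split=> *; rewrite ?mul1mx //; apply/unitarymxP; rewrite adjmx1 mul1mx.
  have [U [tau tp]] := typing_exists SJ evP r1.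
  exists (fun=> 1%:M), U, tau; split=> //; apply/funext => O.
  rewrite /type_weight; case: ifP => // _; apply/esym/eqP; rewrite cards_eq0.
  by apply/eqP/setP => -[].
- move=> w w' d d' [psi [U [tau [tp ->]]]] [psi' [U' [tau' [tp' ->]]]].
  exists (fun g => dsum_mx (psi g) (psi' g)), (dsum_mx U U'), (split_fun tau tau').
  by split; [exact: typing_dsum|apply/funext => O; rewrite type_weight_dsum].
- move=> w d O [psi [U [tau [tp ->]]]].
  exists d, (restr_rep ev1 psi U tau [set O]), U, (restr_type ev1 tau [set O]).
  split; first exact: restr_rep_typing.
  by apply/funext => O'; rewrite type_weight_restr inE.
exists (c * q)%N => n psi rpsi; have [U [tau tp]] := typing_exists SJ evP rpsi.
have [|J [w' [n' [[rho [U' [tau' [tp' ->]]]] JC nC E]]]] := cP (type_weight ev1 tau) n.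
  by exists psi, U, tau.
exists U, tau, J, n', rho.
have DE : (\sum_k `|functional (s k) (type_weight ev1 tau)|)%N%:R =
    q%:R * \sum_k `|eigen_diff psi k| :> C.
  rewrite natr_sum mulr_sumr; apply: eq_bigr => k _.
  by rewrite natr_absz intr_norm (sE _ _ _ _ _ tp) normrM ger0_norm ?ler0n.
rewrite /= natrM -!mulrA -DE -natrM !ler_nat; split=> //; first by case: tp'.
move=> k; have /(congr1 (fun z : int => z%:~R : C)) := E k.
rewrite intrD (sE _ _ _ _ _ tp').
rewrite (_ : (fun i => _) = type_weight ev1 (restr_type ev1 tau J)); last first.
  by apply/funext => O; rewrite type_weight_restr.
rewrite (sE _ _ _ _ _ (restr_rep_typing SJ ev1 tp J)) -mulrDr => /eqP.
by rewrite mulf_eq0 pnatr_eq0 eqn0Ngt q0 => /eqP.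
Qed.

Lemma unitary_hnn_correction : exists c : nat,
  forall n (psi : G -> 'M[C]_n) (t : 'M[C]_n), urep psi -> t \is unitarymx ->
  exists (n' : nat) (Psi : G -> 'M[C]_(n + n')) (t' : 'M[C]_(n + n')),
    let E := \sum_(h : H) frob2 (psi (i1 h) *m t - t *m psi (i2 h)) in
    [/\ urep Psi, t' \is unitarymx, forall h, Psi (i1 h) *m t' = t' *m Psi (i2 h) &
    [/\ n'%:R <= c%:R * E, forall g, frob2 (dsum_mx (psi g) 1%:M - Psi g) <= c%:R * E &
        frob2 (dsum_mx t 1%:M - t') <= c%:R * E]].
Proof.
have [c cP] := eigen_diff_correction.
(* [a] bounds the added and the discarded dimensions per unit of [E], through [eigen_proj_dist] at
   every pair of an element and a root. [c1] is the price of an exact intertwiner. In [c2], each [h]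
   adds [32 * a] for the discarded part and [4 * a] for the new block; [8 * a] is the displacement
   of [psi]. *)
pose a := (c * (#|{: K}| * (2 ^ #|H| * #|H|)))%N.
pose c1 := (10 * 4 ^ #|H|)%N.
pose c2 := (4 + #|H| * (36 * a))%N.
exists (a + 8 * a + c1 * c2)%N => n psi t rpsi tu.
set E := \sum_h _; have E0 : 0 <= E by apply: sumr_ge0 => h _; exact: frob2_ge0.
have [U [tau [J [n' [rho [tp rrho JD nD diff0]]]]]] := cP n psi rpsi.
set D := \sum_k _ in JD nD.
have DE : c%:R * D <= a%:R * E.
  rewrite /a natrM -mulrA ler_wpM2l ?ler0n // natrM -mulrA mulr_natl -sumr_const.
  apply: ler_sum => k _; rewrite /eigen_diff.
  by apply: eigen_proj_dist; [exact: urep_comp|exact: urep_comp| |exact: rootP].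
have {}nD : n'%:R <= a%:R * E by exact: le_trans nD DE.
pose psiJ := restr_rep ev1 psi U tau J.
have JE g : frob2 (psi g - psiJ g) <= 4 * (a%:R * E).
  apply: le_trans (frob2_restr ev1 tp J g) _; rewrite ler_pM2l //.
  exact: le_trans JD DE.
have rpsiJ : urep psiJ := restr_rep_urep SJ ev1 tp J.
pose Psi g := dsum_mx (psiJ g) (rho g).
have rPsi : urep Psi := urep_dsum rpsiJ rrho.
pose tt := dsum_mx t (1%:M : 'M[C]_n').
have ttu : tt \is unitarymx.
  by apply: dsum_mx_unitary => //; apply/unitarymxP; rewrite adjmx1 mul1mx.
have [||//|h|t' [t'u t'c t'E]] :=
    @unitary_intertwiner_correction C H _ (Psi \o i2) (Psi \o i1) tt.
- exact: urep_comp.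
- exact: urep_comp.
- rewrite !(mxtrace_eigen_proj _ _ rts_uniq rtsP); try exact: urep_comp.
  rewrite !big_seq; apply: eq_bigr => r rr; congr (_ * _); apply/esym/eqP.
  rewrite -subr_eq0 -[X in X == _]/(eigen_diff Psi (h, SeqSub rr)).
  by rewrite eigen_diff_dsum diff0.
have aE0 : 0 <= a%:R * E by rewrite mulr_ge0 ?ler0n.
exists n', Psi, t'; split=> //; split.
- by apply: le_trans nD _; rewrite ler_wpM2r // ler_nat -addnA leq_addr.
- move=> g; rewrite /Psi dsum_mxB frob2_dsum.
  have rE : frob2 (1%:M - rho g) <= 4 * (a%:R * E).
    apply: le_trans (frob2D _ _) _; rewrite frob2N !frob2_unitary; last 2 first.
    + by case: rrho.
    + by apply/unitarymxP; rewrite adjmx1 mul1mx.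
    apply: le_trans (_ : 4 * n'%:R <= _); last by rewrite ler_pM2l.
    by rewrite le_eqVlt; apply/orP; left; apply/eqP; ring.
  apply: le_trans (lerD (JE g) rE) _.
  have -> : 4 * (a%:R * E) + 4 * (a%:R * E) = (8 * a)%N%:R * E by rewrite natrM; ring.
  by rewrite ler_wpM2r // ler_nat; lia.
rewrite frob2B; apply: le_trans t'E _; rewrite -/c1.
apply: le_trans (_ : c1%:R * (c2%:R * E) <= _); last first.
  by rewrite mulrA -natrM ler_wpM2r // ler_nat; lia.
rewrite ler_wpM2l ?ler0n //.
(* The new block costs at most 4 n'. In the old block, [psi] is altered both at [i1 h] and at
   [i2 h], each time by at most [4 * (a%:R * E)]. *)
have step h : frob2 ((Psi \o i1) h *m tt - tt *m (Psi \o i2) h) <=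
    4 * frob2 (psi (i1 h) *m t - t *m psi (i2 h)) + 32 * (a%:R * E) + 4 * (a%:R * E).
  rewrite /= /Psi /tt !dsum_mxM dsum_mxB frob2_dsum mulmx1 mul1mx.
  apply: lerD; last first.
    apply: le_trans (frob2D _ _) _; rewrite frob2N !frob2_unitary; try by case: rrho.
    apply: le_trans (_ : 4 * n'%:R <= _); last by rewrite ler_pM2l.
    by rewrite le_eqVlt; apply/orP; left; apply/eqP; ring.
  have -> : psiJ (i1 h) *m t - t *m psiJ (i2 h) =
      (psi (i1 h) *m t - t *m psi (i2 h)) +
      (t *m (psi (i2 h) - psiJ (i2 h)) - (psi (i1 h) - psiJ (i1 h)) *m t).
    rewrite mulmxBr mulmxBl opprB.
    move: (psi _ *m t) (t *m psi _) (psiJ _ *m t) (t *m psiJ _) => x y z u.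
    by rewrite [RHS]addrA [x - y + _]addrA subrK [RHS]addrC addrA subrK.
  apply: le_trans (frob2D _ _) _.
  set f := frob2 (psi _ *m t - _).
  have f0 : 0 <= f by exact: frob2_ge0.
  have g : frob2 (t *m (psi (i2 h) - psiJ (i2 h)) - (psi (i1 h) - psiJ (i1 h)) *m t) <=
      16 * (a%:R * E).
    apply: le_trans (frob2D _ _) _; rewrite frob2N frob2_unitM // frob2_Munit //.
    have -> : 16 * (a%:R * E) = 2 * (4 * (a%:R * E) + 4 * (a%:R * E)) by ring.
    by rewrite ler_pM2l // lerD.
  have -> : 4 * f + 32 * (a%:R * E) = 2 * (f + f + 16 * (a%:R * E)) by ring.
  by rewrite ler_pM2l // lerD // lerDl.
apply: le_trans (ler_sum _ (fun h _ => step h)) _.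
rewrite !big_split /= -mulr_sumr -/E !sumr_const -[_ *+ _]mulr_natl -[32 * _ *+ _]mulr_natl.
rewrite le_eqVlt; apply/orP; left; apply/eqP.
by rewrite /c2 !natrD !natrM; ring.
Qed.

End UnitaryCorrection.

(** * Hilbert-Schmidt stability *)

Section UnitaryGroup.
Variables (C : numClosedFieldType) (n : nat).

Definition unitary_group := {A : 'M[C]_n | A \is unitarymx}.
HB.instance Definition _ := Choice.on unitary_group.

Implicit Types A B : unitary_group.

Let mulP A B : val A *m val B \is unitarymx.
Proof. by rewrite mul_unitarymx ?(valP A) ?(valP B). Qed.
Let invP A : (val A) ^t* \is unitarymx.
Proof. by rewrite trmxC_unitary (valP A). Qed.
Let oneP : (1%:M : 'M[C]_n) \is unitarymx.
Proof. by apply/unitarymxP; rewrite adjmx1 mul1mx. Qed.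

Definition ug_mul A B : unitary_group := exist (fun M : 'M[C]_n => M \is unitarymx) _ (mulP A B).
Definition ug_inv A : unitary_group := exist (fun M : 'M[C]_n => M \is unitarymx) _ (invP A).
Definition ug_one : unitary_group := exist (fun M : 'M[C]_n => M \is unitarymx) _ oneP.

Lemma ug_mulA : associative ug_mul.
Proof. by move=> A B D; apply: val_inj; rewrite /= mulmxA. Qed.
Lemma ug_mul1 : left_id ug_one ug_mul.
Proof. by move=> A; apply: val_inj; rewrite /= mul1mx. Qed.
Lemma ug_mulr1 : right_id ug_one ug_mul.
Proof. by move=> A; apply: val_inj; rewrite /= mulmx1. Qed.
Lemma ug_mulV : left_inverse ug_one ug_inv ug_mul.
Proof. by move=> A; apply: val_inj; rewrite /= unitarymx_adjl // (valP A). Qed.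
Lemma ug_mulrV : right_inverse ug_one ug_inv ug_mul.
Proof. by move=> A; apply: val_inj; rewrite /= unitarymx_adjr // (valP A). Qed.

HB.instance Definition _ := isGroup.Build unitary_group
  ug_mulA ug_mul1 ug_mulr1 ug_mulV ug_mulrV.

End UnitaryGroup.

Section Isometry.
Variable C : numClosedFieldType.

Definition isometry (k m : nat) := {V : 'M[C]_(m, k) | V ^t* *m V == 1%:M}.

Lemma isometryP k m (V : isometry k m) : (val V) ^t* *m val V = 1%:M.
Proof. exact/eqP/(valP V). Qed.

Definition ext_mx k m (V : isometry k m) (A : 'M[C]_k) : 'M[C]_m :=
  val V *m A *m (val V) ^t* + (1%:M - val V *m (val V) ^t*).

Section Ext.
Variables (k m : nat) (V : isometry k m).

Lemma isometry_projection : projection (val V *m (val V) ^t*).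
Proof.
split; first by rewrite adjmxM adjmxK.
by rewrite mulmxA -[_ *m _ *m val V]mulmxA isometryP mulmx1.
Qed.

Lemma ext_mxM A B : ext_mx V (A *m B) = ext_mx V A *m ext_mx V B.
Proof.
rewrite /ext_mx; have := isometryP V; have := proj2 (projectionC isometry_projection).
move: (val V) => W; have [Q QE] : exists Q, Q = 1%:M - W *m W ^t* by eexists.
rewrite -!QE => QQ WW.
have WQ : W ^t* *m Q = 0 by rewrite QE mulmxBr mulmx1 mulmxA WW mul1mx subrr.
have QW : Q *m W = 0 by rewrite QE mulmxBl mul1mx -mulmxA WW mulmx1 subrr.
rewrite mulmxDl !mulmxDr QQ -[W *m A *m W ^t* *m Q]mulmxA WQ mulmx0 addr0.
rewrite !mulmxA QW !mul0mx add0r; congr (_ + _).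
by rewrite -[_ *m _ *m W]mulmxA WW mulmx1.
Qed.

Lemma ext_mx1 : ext_mx V 1%:M = 1%:M.
Proof. by rewrite /ext_mx mulmx1 addrC subrK. Qed.

Lemma ext_mx_adj A : (ext_mx V A) ^t* = ext_mx V (A ^t*).
Proof.
rewrite /ext_mx adjmxD (proj1 (projectionC isometry_projection)).
by rewrite !adjmxM adjmxK mulmxA.
Qed.

Lemma ext_mx_unitary A : A \is unitarymx -> ext_mx V A \is unitarymx.
Proof.
by move=> Au; apply/unitarymxP; rewrite ext_mx_adj -ext_mxM unitarymx_adjr // ext_mx1.
Qed.

Lemma frob2_ext_mx A B : frob2 (ext_mx V A - ext_mx V B) = frob2 (A - B).
Proof.
rewrite /ext_mx opprD addrACA subrr addr0 -mulmxBl -mulmxBr.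
by rewrite frob2_Miso ?frob2_isoM ?adjmxK ?isometryP.
Qed.

Lemma isometry_leq : (k <= m)%N.
Proof.
rewrite -(mxrank1 C k) -(isometryP V).
exact: leq_trans (mxrankM_maxr _ _) (rank_leq_row _).
Qed.

Lemma frob2_compression A B :
  frob2 (A - (val V) ^t* *m B *m val V) <= frob2 (ext_mx V A - B).
Proof.
have -> : A - (val V) ^t* *m B *m val V = (val V) ^t* *m (ext_mx V A - B) *m val V.
  rewrite mulmxBr mulmxBl; congr (_ - _); rewrite /ext_mx.
  have := isometryP V; move: (val V) => W WW.
  rewrite mulmxDr mulmxBr !mulmxA WW mul1mx mulmx1 mul1mx subrr addr0.
  by rewrite -mulmxA WW mulmx1.
rewrite -frob2_adj adjmxM; apply: le_trans (frob2_coisoM _ (isometryP V)) _.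
by rewrite frob2_adj; exact: frob2_coisoM (isometryP V).
Qed.

(** The difference is cut along the range of [V]. The compressed block is the first term; the other
    blocks contain the complementary projection, of rank m - k, multiplied by the unitary [B] or by
    1. The constants come from two uses of [frob2D]. *)
Lemma frob2_ext_mx_le A B : B \is unitarymx ->
  frob2 (ext_mx V A - B) <=
  4 * frob2 (A - (val V) ^t* *m B *m val V) + 12 * (m - k)%N%:R.
Proof.
move=> Bu; have pP := isometry_projection; have VV := isometryP V.
set W := val V in pP VV *.
have pQ := projectionC pP.
have [Q QE] : exists Q, Q = 1%:M - W *m W ^t* by eexists.
rewrite -QE in pQ.
have nQ : frob2 Q = (m - k)%N%:R.
  rewrite frob2_projection // QE linearB /= mxtrace1 mxtrace_mulC VV mxtrace1.
  by rewrite natrB // isometry_leq.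
have WQ : W ^t* *m Q = 0 by rewrite QE mulmxBr mulmx1 mulmxA VV mul1mx subrr.
have QW : Q *m W = 0 by rewrite QE mulmxBl mul1mx -mulmxA VV mulmx1 subrr.
have PQ1 : W *m W ^t* + Q = 1%:M by rewrite QE addrC subrK.
set X := ext_mx V A - B.
have XE : X = W *m (W ^t* *m X *m W) *m W ^t* + W *m W ^t* *m X *m Q + Q *m X.
  rewrite !mulmxA -[_ *m X *m W *m _]mulmxA -mulmxDr PQ1 mulmx1 -mulmxDl PQ1.
  by rewrite mul1mx.
have X1 : W ^t* *m X *m W = A - W ^t* *m B *m W.
  rewrite /X /ext_mx -/W -QE mulmxBr mulmxBl mulmxDr mulmxDl WQ mul0mx addr0.
  by rewrite !mulmxA VV mul1mx -mulmxA VV mulmx1.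
have X2 : W *m W ^t* *m X *m Q = - (W *m W ^t* *m (B *m Q)).
  rewrite /X /ext_mx -/W -QE mulmxBr mulmxBl -!mulmxA.
  rewrite [(_ + Q) *m Q]mulmxDl -!mulmxA WQ !mulmx0 add0r (proj2 pQ) WQ mulmx0.
  by rewrite sub0r.
have X3 : Q *m X = Q - Q *m B.
  rewrite /X /ext_mx -/W -QE mulmxBr mulmxDr (proj2 pQ) !mulmxA QW !mul0mx.
  by rewrite add0r.
rewrite XE X1 X2 X3; apply: le_trans (frob2D _ _) _.
set a := frob2 (A - _); set d : C := (m - k)%N%:R.
have h1 : frob2 (W *m (A - W ^t* *m B *m W) *m W ^t* - W *m W ^t* *m (B *m Q)) <= 2 * (a + d).
  apply: le_trans (frob2D _ _) _; rewrite ler_pM2l // frob2N; apply: lerD.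
    by rewrite frob2_Miso ?frob2_isoM ?adjmxK ?lexx.
  by apply: le_trans (frob2_projM _ pP) _; rewrite frob2_unitM // nQ.
have h2 : frob2 (Q - Q *m B) <= 2 * (d + d).
  by apply: le_trans (frob2D _ _) _; rewrite frob2N frob2_Munit // nQ.
apply: le_trans (_ : 2 * (2 * (a + d) + 2 * (d + d)) <= _).
  by rewrite ler_pM2l // lerD.
have -> : 2 * (2 * (a + d) + 2 * (d + d)) = 4 * a + 12 * d by ring.
exact: lexx.
Qed.

End Ext.

Lemma ext_mx_comp k m p (V : isometry k m) (V' : isometry m p) :
  exists V2 : isometry k p, forall A, ext_mx V2 A = ext_mx V' (ext_mx V A).
Proof.
have V2P : (val V' *m val V) ^t* *m (val V' *m val V) == 1%:M.
  by rewrite adjmxM !mulmxA -[_ *m _ *m val V']mulmxA isometryP mulmx1 isometryP.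
exists (exist (fun W : 'M[C]_(p, k) => W ^t* *m W == 1%:M) _ V2P) => A; rewrite /ext_mx /=.
move: (val V) (val V') => W W'; rewrite !adjmxM.
rewrite mulmxDr mulmxBr mulmxDl mulmxBl mulmx1 !mulmxA -addrA; congr (_ + _).
by rewrite [RHS]addrC addrA subrK.
Qed.

End Isometry.

(** * Unitary groups as a metric family *)

Section HilbertSchmidtFamily.
Variable R : realType.
Local Notation C := R[i].

Lemma le_Re (x y : C) : x <= y -> complex.Re x <= complex.Re y.
Proof. by rewrite lecE => /andP[]. Qed.

Lemma Re_natM (n : nat) (x : C) : complex.Re (n%:R * x) = n%:R * complex.Re x.
Proof. by rewrite !mulr_natl raddfMn. Qed.

Lemma Re_nat (n : nat) : complex.Re (n%:R : C) = n%:R.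
Proof. exact: (raddfMn (@complex.Re R) n 1). Qed.

Definition frob2R m n (A : 'M[C]_(m, n)) : R := complex.Re (frob2 A).

Lemma frob2R_ge0 m n (A : 'M[C]_(m, n)) : 0 <= frob2R A.
Proof. exact: le_Re (frob2_ge0 A). Qed.

Program Definition hs_family : metric_family R := @MetricFamily R nat
  (fun n => unitary_group C n) id
  (fun n A B => frob2R (val A - val B))
  (fun k m => isometry C k m)
  (fun k m V A => exist (fun M : 'M[C]_m => M \is unitarymx) _
                    (ext_mx_unitary V (valP A))) _ _ _ _ _ _ _ _ _ _.
Next Obligation. by move=> n A B; exact: frob2R_ge0. Qed.
Next Obligation. by move=> n A; rewrite /= subrr /frob2R frob20. Qed.
Next Obligation. by move=> n A B; rewrite /= /frob2R frob2B. Qed.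
Next Obligation.
move=> n A B D; rewrite /= /frob2R -raddfD -Re_natM.
exact: le_Re (frob2_triangle _ _ _).
Qed.
Next Obligation.
move=> n D A B; rewrite /= /frob2R -[X in frob2 X]/(val D *m val A - val D *m val B) -mulmxBr.
by rewrite frob2_unitM // (valP D).
Qed.
Next Obligation.
move=> n D A B; rewrite /= /frob2R -[X in frob2 X]/(val A *m val D - val B *m val D) -mulmxBl.
by rewrite frob2_Munit // (valP D).
Qed.
Next Obligation. by move=> k m V A B; apply: val_inj; exact: ext_mxM. Qed.
Next Obligation. by move=> k m V A B; rewrite /= /frob2R frob2_ext_mx. Qed.
Next Obligation. by move=> k m V; exact: isometry_leq V. Qed.
Next Obligation.
move=> k m p V V'; have [V2 V2E] := ext_mx_comp V V'.
by exists V2 => A; apply: val_inj; exact: V2E.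
Qed.

(** The common exponent enters through [dicman]: finitely many products of elements of [S] leave
    finitely many possible eigenvalues, in every dimension at once. *)
Lemma hs_hnn_correctable (G : groupType) (H : finGroupType) (i1 i2 : H -> G) (S : seq G) :
  ghom i1 -> ghom i2 -> (forall s g, s \in S -> (s ^ g)%g \in S) ->
  (forall s, s \in S -> s ^+ #|H| = 1)%g ->
  (forall h, i1 h \in S) -> (forall h, i2 h \in S) ->
  hnn_correctable hs_family i1 i2.
Proof.
move=> i1M i2M SJ SH i1S i2S.
have H_gt0 : (0 < #|H|)%N by apply/card_gt0P; exists 1%g.
have [F [F1 SF]] := dicman SJ H_gt0 SH.
have [ev [ev1 evP]] := class_avg_eigenvalues C SJ F1 SF.
have [rts rts_uniq rtsP] := roots_of_unity_seq C H.
have [c cP] := unitary_hnn_correction i1M i2M SJ i1S i2S ev1 evP rts_uniq rtsP.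
exists c%:R; first exact: ler0n.
move=> n psi t psiM.
have rpsi : urep (fun g => val (psi g)).
  by split=> [g|g h]; [exact: valP|rewrite psiM].
have [n' [Psi [t' [rPsi t'u rel [n'E PsiE t'E]]]]] := cP n _ (val t) rpsi (valP t).
have EE : \sum_h frob2R (val (psi (i1 h)) *m val t - val t *m val (psi (i2 h))) =
    complex.Re (\sum_h frob2 (val (psi (i1 h)) *m val t - val t *m val (psi (i2 h)))).
  by rewrite raddf_sum.
have VP : (col_mx 1%:M 0 : 'M[C]_(n + n', n)) ^t* *m col_mx 1%:M 0 == 1%:M.
  rewrite tr_col_mx map_row_mx mul_row_col mulmx0 addr0 mulmx1.
  by rewrite adjmx1.
pose V : isometry C n (n + n') :=
  exist (fun W : 'M[C]_(n + n', n) => W ^t* *m W == 1%:M) _ VP.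
have VE A : ext_mx V A = dsum_mx A 1%:M.
  rewrite /ext_mx /= tr_col_mx map_row_mx adjmx1 trmx0 map_mx0.
  rewrite mul_col_mx mul1mx mul0mx !mul_col_row !mulmx0 !mul0mx !mulmx1.
  rewrite (@scalar_mx_block _ n n' 1) opp_block_mx add_block_mx add_block_mx.
  by rewrite /dsum_mx subrr !oppr0 !addr0 !add0r.
exists (n + n')%N, V,
  (fun g => exist (fun M : 'M[C]_(n + n') => M \is unitarymx) _ (proj1 rPsi g)),
  (exist (fun M : 'M[C]_(n + n') => M \is unitarymx) _ t'u).
rewrite /= EE -Re_natM; split.
- by move=> g h; apply: val_inj; rewrite /= (proj2 rPsi).
- by move=> h; apply: val_inj; exact: rel.
- by rewrite addKn -Re_nat; exact: le_Re n'E.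
- by move=> g; rewrite VE; exact: le_Re (PsiE g).
- by rewrite VE; exact: le_Re t'E.
Qed.

Lemma hs_normE k (A : 'M[C]_k) : hs_norm A = Num.sqrt (frob2R A / k%:R).
Proof.
rewrite /hs_norm /normalized_tr; congr Num.sqrt; rewrite -/(frob2 A).
(* In dimension 0 both sides are 0, division by 0 giving 0. *)
case: k A => [|k] A; first by rewrite !invr0 !mulr0.
apply: (@mulIf _ k.+1%:R); first by rewrite pnatr_eq0.
by rewrite divfK ?pnatr_eq0 // mulrC -Re_natM mulrC divfK ?pnatr_eq0.
Qed.

Lemma hs_norm_negligible (k : nat -> nat) (A : forall n, 'M[C]_(k n)) :
  (hs_norm (A n) @[n --> \oo] --> (0 : R))%classic <->
  negligible k (fun n => frob2R (A n)).
Proof.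
have E n : frob2R (A n) / (k n)%:R = hs_norm (A n) * hs_norm (A n).
  by rewrite hs_normE -expr2 sqr_sqrtr // divr_ge0 // frob2R_ge0.
split=> [c|c].
  rewrite /negligible; under eq_fun do rewrite E; rewrite -(mulr0 0).
  exact: cvgM.
under eq_fun do rewrite hs_normE; rewrite -[0](sqrtr0 R).
by apply: continuous_cvg => //; exact: sqrt_continuous.
Qed.

(** [hs_norm] tends to 0 exactly when its square does, and the compression and the extension of
    [phi] are comparable by [frob2_compression] and [frob2_ext_mx_le]. *)
Lemma flexibly_HS_stableE (G : groupType) :
  flexibly_HS_stable R G <-> family_stable hs_family G.
Proof.
split=> st.
- move=> k phi k0 phiM.
  have [||//|m [V [psi [VV mk psiu psiM npsi]]]] := st k (fun n g => val (phi n g)).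
  + exact: k0.
  + by move=> n g; exact: valP.
  + by move=> g h; apply/hs_norm_negligible; exact: phiM.
  have VP n : (V n) ^t* *m V n == 1%:M by apply/eqP; exact: VV.
  pose V' n : isometry C (k n) (m n) :=
    exist (fun W : 'M[C]_(m n, k n) => W ^t* *m W == 1%:M) _ (VP n).
  have mk' : negligible k (fun n => (m n - k n)%N%:R : R).
    by apply/ratio_negligible => // n; exact: isometry_leq (V' n).
  exists m, V', (fun n g =>
    exist (fun M : 'M[C]_(m n) => M \is unitarymx) _ (psiu n g)); split=> //.
  + by move=> n g h; apply: val_inj; exact: psiM.
  move=> g; have /hs_norm_negligible ng := npsi g.
  apply: negligible_le (negligibleD (negligibleZ 4 ng) (negligibleZ 12 mk')) => n.
  rewrite frob2R_ge0 /=.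
  have := le_Re (frob2_ext_mx_le (V' n) (val (phi n g)) (psiu n g)).
  by rewrite raddfD /= !Re_natM Re_nat.
move=> k phi k0 phiu phiM.
have [||m [V [psi [mk psiM npsi]]]] := st k
  (fun n g => exist (fun M : 'M[C]_(k n) => M \is unitarymx) _ (phiu n g)).
- exact: k0.
- by move=> g h; have /hs_norm_negligible := phiM g h.
exists m, (fun n => val (V n)), (fun n g => val (psi n g)); split.
- by move=> n; exact: isometryP.
- by apply/ratio_negligible => // n; exact: isometry_leq (V n).
- by move=> n g; exact: valP.
- by move=> n g h; rewrite psiM.
move=> g; apply/hs_norm_negligible; apply: negligible_le (npsi g) => n.
by rewrite frob2R_ge0 /=; exact: le_Re (frob2_compression (V n) _ _).
Qed.

End HilbertSchmidtFamily.

Theorem theorem7 (R : realType) (C : approx_class) (G : groupType)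
    (H : finGroupType) (i1 i2 : {multiplicative H -> G}) :
  finitely_generated G ->
  flexibly_stable R C G ->
  injective i1 -> injective i2 ->
  almost_normal (range i1) -> almost_normal (range i2) ->
  flexibly_stable R C (HNN i1 i2).
Proof.
move=> _ stG _ _ an1 an2.
have i1M : ghom i1 by move=> x y; rewrite gmulfM.
have i2M : ghom i2 by move=> x y; rewrite gmulfM.
have [S1 [i1S S1J S1H]] := almost_normal_conj_closed i1M an1.
have [S2 [i2S S2J S2H]] := almost_normal_conj_closed i2M an2.
(* One conjugation-closed set contains both images, so that a single notion of type measures both
   restrictions to [H]. *)
pose S := S1 ++ S2.
have SJ s g : s \in S -> (s ^ g)%g \in S.
  by rewrite !mem_cat => /orP[/S1J|/S2J] ->; rewrite ?orbT.
have SH s : s \in S -> (s ^+ #|H|)%g = 1%g.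
  by rewrite mem_cat => /orP[/S1H|/S2H].
have {}i1S h : i1 h \in S by rewrite mem_cat i1S.
have {}i2S h : i2 h \in S by rewrite mem_cat i2S orbT.
case: C stG => /= stG.
  apply/flexibly_HS_stableE; apply: hnn_family_stable.
    exact: (hs_hnn_correctable R i1M i2M SJ SH i1S i2S).
  exact/flexibly_HS_stableE.
apply/flexibly_P_stableE; apply: hnn_family_stable.
  exact: (perm_hnn_correctable R i1M i2M SJ i1S i2S).
exact/flexibly_P_stableE.
Qed.
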